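(* Assume $p>3$ and $p>2d=n(n-1)$. Then $h(\mathcal Z)\subseteq \Theta\, u(\mathfrak h)^{W\cdot}+F$.
   Context: Let $F$ be an algebraically closed field of characteristic $p$ and let $n\ge 2$. Let $\mathfrak g=p(n)$ be the Lie superalgebra over $F$ (supercommutator bracket) of block matrices $\begin{pmatrix}a&b\\ c&-a^t\end{pmatrix}$ with $a$ an arbitrary $n\times n$ matrix, $b$ symmetric and $c$ skew-symmetric. Its even part $\mathfrak g_{\bar 0}\cong\mathfrak{gl}(n)$ is given by $b=c=0$; its odd part is $\mathfrak g_{-1}\oplus\mathfrak g_1$, where $\mathfrak g_1$ is given by $a=c=0$ and $\mathfrak g_{-1}$ by $a=b=0$. Put $d=\dim\mathfrak g_{-1}=\frac12 n(n-1)$. The $p$-map $x\mapsto x^{[p]}$ on $\mathfrak g_{\bar 0}$ is the $p$-th matrix power, and $u(\mathfrak g)=U(\mathfrak g)/(x^p-x^{[p]}: x\in\mathfrak g_{\bar 0})$ is the restricted enveloping superalgebra. Let $I$ be the two-sided ideal of $u(\mathfrak g)$ generated by all products of $k$ elements of $\mathfrak g_1$ with $k>d$, and let $\bar{\mathfrak u}=u(\mathfrak g)/I$ (a superalgebra with even part $\bar{\mathfrak u}_{\bar 0}$). The group $G=GL_n(F)$ acts on $\mathfrak g$ by conjugation by $\mathrm{diag}(a,(a^{-1})^t)$, $a\in G$, and hence acts on $u(\mathfrak g)$ and on $\bar{\mathfrak u}$. Let $T\subset G$ be the diagonal torus, $\bar{\mathfrak u}^T$ the subalgebra of $T$-invariants,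 and $$\mathcal Z=\{u\in\bar{\mathfrak u}_{\bar 0}\mid gu=u\ \text{for all } g\in G,\ [u,\mathfrak g_1]=0\}.$$ Let $\mathfrak h\subset\mathfrak g_{\bar 0}$ be the diagonal matrices, with basis $h_i=e_{ii}-e_{n+i,n+i}$ and dual basis $\epsilon_1,\dots,\epsilon_n$ of $\mathfrak h^*$. Let $\Lambda_0=\mathbb F_p\epsilon_1+\dots+\mathbb F_p\epsilon_n$, and $u(\mathfrak h)=F[h_1,\dots,h_n]/(h_i^p-h_i)$, whose elements $f$ are evaluated at $\mu\in\Lambda_0$ by $h_i\mapsto\mu(h_i)$. Let $\mathfrak n_0^{+}$ (resp. $\mathfrak n_0^-$) be the span of $\tilde e_{ij}=e_{ij}-e_{j+n,i+n}$ with $i<j$ (resp. $i>j$), and $\mathfrak n^+=\mathfrak n_0^++\mathfrak g_1$. One has $\bar{\mathfrak u}^T=u(\mathfrak h)\oplus\mathfrak l$, where $\mathfrak l=\bar{\mathfrak u}\mathfrak n^+\cap\bar{\mathfrak u}^T$ is a two-sided ideal of $\bar{\mathfrak u}^T$; $h:\bar{\mathfrak u}^T\to u(\mathfrak h)$ is the projection with kernel $\mathfrak l$ (the Harish-Chandra homomorphism). Note $\mathcal Z\subseteq\bar{\mathfrak u}^T$. Let $W\cong S_n$ be the Weyl group, permuting $\epsilon_1,\dots,\epsilon_n$. Fix $\rho\in\mathfrak h^*$ with $\rho(h_i-h_{i+1})=1$ for $1\le i\le n-1$. The dot action is $w\cdot\lambda=w(\lambda+\rho)-\rho$ on $\mathfrak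 h^*$ (it stabilizes $\Lambda_0$), and on $u(\mathfrak h)$ it is given by $(w\cdot f)(\lambda)=f(w^{-1}\cdot\lambda)$ for $\lambda\in\Lambda_0$; $u(\mathfrak h)^{W\cdot}$ denotes the invariants of the dot action. Finally $\Theta=\prod_{i\ne j}(h_i-h_j+j-i-1)\in u(\mathfrak h)$, i.e. $\Theta(\mu)=\prod_{i\neq j}\big((\mu+\rho)(h_i-h_j)-1\big)$, the product over ordered pairs $1\le i\neq j\le n$. *)

(* Defs.v *)
From HB Require Import structures.
From mathcomp Require Import all_boot all_fingroup all_algebra.
From mathcomp Require Import generic_quotient ring_quotient.
From mathcomp Require boolp classical_sets.
From mathcomp Require Import monalg mpoly.

Set Implicit Arguments.
Unset Strict Implicit.
Unset Printing Implicit Defensive.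

Import GRing.Theory.
Local Open Scope ring_scope.
Local Open Scope quotient_scope.

(* ring_quotient only provides ring structures on quotients of commutative
   rings, so the quotient of a noncommutative algebra is built here. *)

Section IdealGen.
Variables (F : fieldType) (A : algType F).

Inductive ideal_gen (S : A -> Prop) : A -> Prop :=
| IdealGen0 : ideal_gen S 0
| IdealGenD a s b x :
    S s -> ideal_gen S x -> ideal_gen S (a * s * b + x).

Section Closure.
Variable S : A -> Prop.

Lemma ideal_gen_sub s : S s -> ideal_gen S s.
Proof.
move=> Ss; have := IdealGenD 1 1 Ss (IdealGen0 S).
by rewrite mul1r mulr1 addr0.
Qed.

Lemma ideal_genD x y : ideal_gen S x -> ideal_gen S y -> ideal_gen S (x + y).
Proof.
elim=> [|a s b z Ss _ IHz] Iy; first by rewrite add0r.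
by rewrite -addrA; apply: IdealGenD => //; apply: IHz.
Qed.

Lemma ideal_genMl c x : ideal_gen S x -> ideal_gen S (c * x).
Proof.
elim=> [|a s b z Ss _ IHz]; first by rewrite mulr0; apply: IdealGen0.
by rewrite mulrDr !mulrA; apply: IdealGenD.
Qed.

Lemma ideal_genMr c x : ideal_gen S x -> ideal_gen S (x * c).
Proof.
elim=> [|a s b z Ss _ IHz]; first by rewrite mul0r; apply: IdealGen0.
by rewrite mulrDl -mulrA; apply: IdealGenD.
Qed.

Lemma ideal_gen_lrmorph0 (B : lalgType F) (f : {lrmorphism A -> B}) :
  (forall s, S s -> f s = 0) -> forall x, ideal_gen S x -> f x = 0.
Proof.
move=> fS x; elim=> [|a s b y Ss _ fy]; first by rewrite rmorph0.
by rewrite rmorphD !rmorphM /= (fS _ Ss) mulr0 mul0r fy addr0.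
Qed.

End Closure.

(* Properness is what gives the quotient the structure of an algType, in which
   1 != 0 is required. *)
Record proper_gen := ProperGen {
  gen_pred :> A -> Prop;
  gen_properP : ~ ideal_gen gen_pred 1
}.

Lemma lrmorph_proper (S : A -> Prop) (B : lalgType F)
    (f : {lrmorphism A -> B}) :
  (forall s, S s -> f s = 0) -> ~ ideal_gen S 1.
Proof.
by move=> fS /(ideal_gen_lrmorph0 fS)/eqP; rewrite rmorph1 oner_eq0.
Qed.

Definition ideal_mem (S : A -> Prop) : {pred A} :=
  fun x => boolp.asbool (ideal_gen S x).

Lemma ideal_memP (S : A -> Prop) x : reflect (ideal_gen S x) (x \in ideal_mem S).
Proof. exact: boolp.asboolP. Qed.

Fact ideal_mem_zmod_closed S : zmod_closed (ideal_mem S).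
Proof.
split; first by apply/ideal_memP/IdealGen0.
move=> x y /ideal_memP Ix /ideal_memP Iy; apply/ideal_memP.
by apply: ideal_genD => //; rewrite -mulN1r; apply: ideal_genMl.
Qed.

HB.instance Definition _ S :=
  GRing.isZmodClosed.Build A (ideal_mem S) (ideal_mem_zmod_closed S).

End IdealGen.

Section AlgQuotient.
Variables (F : fieldType) (A : algType F) (S : proper_gen A).

Definition alg_quot := {ideal_quot (ideal_mem S : zmodClosed A)}.

HB.instance Definition _ := GRing.Zmodule.on alg_quot.
HB.instance Definition _ := EqQuotient.on alg_quot.

Definition to_quot (x : A) : alg_quot := \pi_alg_quot x.

Lemma to_quotK (u : alg_quot) : to_quot (repr u) = u.
Proof. exact: reprK. Qed.

Lemma to_quot_surj (u : alg_quot) : exists x, u = to_quot x.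
Proof. by exists (repr u); rewrite to_quotK. Qed.

Lemma eq_to_quot x y : to_quot x = to_quot y <-> ideal_gen S (x - y).
Proof.
have := Quotient.idealrBE (ideal_mem S : zmodClosed A) x y.
by split=> [/eqP e|/ideal_memP e]; [apply/ideal_memP; rewrite H|apply/eqP; rewrite -H].
Qed.

Lemma to_quotD x y : to_quot (x + y) = to_quot x + to_quot y.
Proof. by rewrite /to_quot !piE. Qed.

Lemma to_quotB x y : to_quot (x - y) = to_quot x - to_quot y.
Proof. by rewrite /to_quot !piE. Qed.

Let one : alg_quot := to_quot 1.
Let mul (u v : alg_quot) : alg_quot := to_quot (repr u * repr v).
Let scale (c : F) (u : alg_quot) : alg_quot := to_quot (c *: repr u).

Let repr_to_quot x : ideal_gen S (repr (to_quot x) - x).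
Proof. by apply/eq_to_quot; rewrite to_quotK. Qed.

Let to_quotM x y : mul (to_quot x) (to_quot y) = to_quot (x * y).
Proof.
apply/eq_to_quot; set x' := repr _; set y' := repr _.
have -> : x' * y' - x * y = (x' - x) * y' + x * (y' - y).
  by rewrite mulrBl mulrBr addrA subrK.
by apply: ideal_genD; [apply: ideal_genMr | apply: ideal_genMl];
  apply: repr_to_quot.
Qed.

Let to_quotZ c x : scale c (to_quot x) = to_quot (c *: x).
Proof.
apply/eq_to_quot; rewrite -scalerBr -mulr_algl.
by apply: ideal_genMl; apply: repr_to_quot.
Qed.

Let mulqA : associative mul.
Proof.
move=> u v w; have [x ->] := to_quot_surj u; have [y ->] := to_quot_surj v.
by have [z ->] := to_quot_surj w; rewrite !to_quotM mulrA.
Qed.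

Let mul1q : left_id one mul.
Proof. by move=> u; have [x ->] := to_quot_surj u; rewrite to_quotM mul1r. Qed.

Let mulq1 : right_id one mul.
Proof. by move=> u; have [x ->] := to_quot_surj u; rewrite to_quotM mulr1. Qed.

Let mulqDl : left_distributive mul +%R.
Proof.
move=> u v w; have [x ->] := to_quot_surj u; have [y ->] := to_quot_surj v.
have [z ->] := to_quot_surj w.
by rewrite -to_quotD !to_quotM mulrDl to_quotD.
Qed.

Let mulqDr : right_distributive mul +%R.
Proof.
move=> u v w; have [x ->] := to_quot_surj u; have [y ->] := to_quot_surj v.
have [z ->] := to_quot_surj w.
by rewrite -to_quotD !to_quotM mulrDr to_quotD.
Qed.

Let to_quot0 : to_quot 0 = 0.
Proof. by rewrite /to_quot !piE. Qed.

Let oneq_neq0 : one != 0.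
Proof.
apply/eqP; rewrite -to_quot0 => /eq_to_quot; rewrite subr0.
exact: gen_properP.
Qed.

HB.instance Definition _ := GRing.Zmodule_isNzRing.Build alg_quot
  mulqA mul1q mulq1 mulqDl mulqDr oneq_neq0.

Let scaleqA a b u : scale a (scale b u) = scale (a * b) u.
Proof. by have [x ->] := to_quot_surj u; rewrite !to_quotZ scalerA. Qed.

Let scale1q : left_id 1 scale.
Proof. by move=> u; have [x ->] := to_quot_surj u; rewrite to_quotZ scale1r. Qed.

Let scaleqDr : right_distributive scale +%R.
Proof.
move=> a u v; have [x ->] := to_quot_surj u; have [y ->] := to_quot_surj v.
by rewrite -to_quotD !to_quotZ scalerDr to_quotD.
Qed.

Let scaleqDl u : {morph scale^~ u : a b / a + b}.
Proof.
by move=> a b; have [x ->] := to_quot_surj u; rewrite !to_quotZ scalerDl to_quotD.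
Qed.

HB.instance Definition _ := GRing.Zmodule_isLmodule.Build F alg_quot
  scaleqA scale1q scaleqDr scaleqDl.

Let scaleqAl a (u v : alg_quot) : a *: (u * v) = (a *: u) * v.
Proof.
have [x ->] := to_quot_surj u; have [y ->] := to_quot_surj v.
by rewrite [_ *: to_quot x]to_quotZ ![_ * _]to_quotM [LHS]to_quotZ scalerAl.
Qed.

HB.instance Definition _ := GRing.Lmodule_isLalgebra.Build F alg_quot scaleqAl.

Let scaleqAr a (u v : alg_quot) : a *: (u * v) = u * (a *: v).
Proof.
have [x ->] := to_quot_surj u; have [y ->] := to_quot_surj v.
by rewrite [_ *: to_quot y]to_quotZ ![_ * _]to_quotM [LHS]to_quotZ scalerAr.
Qed.

HB.instance Definition _ := GRing.Lalgebra_isAlgebra.Build F alg_quot scaleqAr.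

Fact to_quot_is_zmod_morphism : zmod_morphism to_quot.
Proof. exact: to_quotB. Qed.

Fact to_quot_is_monoid_morphism : monoid_morphism to_quot.
Proof. by split=> // x y; rewrite -to_quotM. Qed.

Fact to_quot_is_scalable : scalable to_quot.
Proof. by move=> c x; rewrite -to_quotZ. Qed.

HB.instance Definition _ :=
  GRing.isZmodMorphism.Build A alg_quot to_quot to_quot_is_zmod_morphism.
HB.instance Definition _ :=
  GRing.isMonoidMorphism.Build A alg_quot to_quot to_quot_is_monoid_morphism.
HB.instance Definition _ :=
  GRing.isScalable.Build F A alg_quot *:%R to_quot to_quot_is_scalable.

Lemma to_quot_gen0 s : S s -> to_quot s = 0.
Proof.
by move=> Ss; rewrite -[RHS](raddf0 to_quot); apply/eq_to_quot; rewrite subr0;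
  apply: ideal_gen_sub.
Qed.

Lemma to_quot_supercomm c x y z :
  x * y - c *: (y * x) = z ->
  to_quot x * to_quot y - c *: (to_quot y * to_quot x) = to_quot z.
Proof. by move=> <-; rewrite to_quotB -to_quotZ -!to_quotM. Qed.

Section Lift.
Variables (B : algType F) (f : A -> B).

Definition quot_lift (u : alg_quot) : B := f (repr u).

End Lift.

Section LiftMorphism.
Variables (B : algType F) (f : {lrmorphism A -> B}).
Hypothesis fS : forall s, S s -> f s = 0.

Lemma quot_liftE x : quot_lift f (to_quot x) = f x.
Proof.
apply/eqP; rewrite -subr_eq0 -raddfB /=; apply/eqP.
by apply: (ideal_gen_lrmorph0 fS); apply: repr_to_quot.
Qed.

Lemma quot_lift_lrmorphism :
  {g : {lrmorphism alg_quot -> B} | forall u, g u = quot_lift f u}.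
Proof.
have fB : zmod_morphism (quot_lift f).
  move=> u v; have [x ->] := to_quot_surj u; have [y ->] := to_quot_surj v.
  by rewrite -raddfB !quot_liftE raddfB.
have fM : monoid_morphism (quot_lift f).
  split=> [|u v]; first by rewrite -[1](rmorph1 to_quot) quot_liftE rmorph1.
  have [x ->] := to_quot_surj u; have [y ->] := to_quot_surj v.
  by rewrite -rmorphM !quot_liftE rmorphM.
have fZ : scalable (quot_lift f).
  move=> c u; have [x ->] := to_quot_surj u.
  by rewrite -linearZ !quot_liftE linearZ.
pose a := GRing.isZmodMorphism.Build _ _ (quot_lift f) fB.
pose m := GRing.isMonoidMorphism.Build _ _ (quot_lift f) fM.
pose z := GRing.isScalable.Build _ _ _ _ (quot_lift f) fZ.
pose g : {lrmorphism alg_quot -> B} := HB.pack (quot_lift f) a m z.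
by exists g.
Qed.

End LiftMorphism.

End AlgQuotient.

Section FreeAlgebra.
Variables (F : fieldType) (X : choiceType).

Definition free_alg := monalg.malg (fmonom X) F.

HB.instance Definition _ := GRing.Lalgebra.on free_alg.

Fact free_alg_scalerAr (c : F) (x y : free_alg) : c *: (x * y) = x * (c *: y).
Proof.
have comm_malgC (z : malg (fmonom X) F) :
    (@malgC (fmonom X) F c) * z = z * @malgC (fmonom X) F c.
  rewrite !monalg.malgM_def monalg.fgmulUg monalg.fgmulgU.
  by apply: eq_bigr => k _; rewrite mulrC monalg.mul1m mulm1.
rewrite -[LHS]monalg.mul_malgC -[c *: y]monalg.mul_malgC.
by rewrite [LHS]mulrA [in LHS]comm_malgC -[LHS]mulrA.
Qed.
HB.instance Definition _ := GRing.Lalgebra_isAlgebra.Build F free_alg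
  free_alg_scalerAr.

Definition free_gen (x : X) : free_alg :=
  monalg.mkmalgU (fmu x) 1.

(* The algebra morphism extending v. *)
Definition free_lift (B : algType F) (v : X -> B) : free_alg -> B :=
  monalg.mmap (in_alg B)
    (fun m : fmonom X => \prod_(x <- fmonom_val m) v x).

Lemma free_lift_gen (B : algType F) (v : X -> B) x :
  free_lift v (free_gen x) = v x.
Proof.
by rewrite /free_lift monalg.mmapU /= scale1r mul1r fmU big_seq1.
Qed.

Lemma free_lift_lrmorphism (B : algType F) (v : X -> B) :
  {g : {lrmorphism free_alg -> B} | forall u, g u = free_lift v u}.
Proof.
pose h (m : fmonom X) := \prod_(x <- fmonom_val m) v x.
have hM : monalg.mmorphism h.
  split=> [m1 m2|]; first by rewrite /h fmM big_cat.
  by rewrite /h fm1 big_nil.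
pose hm := monalg.isMultiplicative.Build _ _ h hM.
pose h' : monalg.MMorphism.type (fmonom X) B := HB.pack h hm.
have fB : zmod_morphism (free_lift v).
  exact: (@monalg.mmap_is_additive _ _ _ (in_alg B) h).
have fM : monoid_morphism (free_lift v).
  have [M1 M2] := @monalg.commr_mmap_is_multiplicative _ _ _ (in_alg B) h'
    (fun g m m' => comm_alg _ _).
  by split.
have fZ : scalable (free_lift v).
  move=> c u; rewrite /free_lift.
  by rewrite (@monalg.mmapZ _ _ _ (in_alg B) h') mulr_algl.
pose ia := GRing.isZmodMorphism.Build _ _ (free_lift v) fB.
pose im := GRing.isMonoidMorphism.Build _ _ (free_lift v) fM.
pose iz := GRing.isScalable.Build _ _ _ _ (free_lift v) fZ.
pose g : {lrmorphism free_alg -> B} := HB.pack (free_lift v) ia im iz.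
by exists g.
Qed.

End FreeAlgebra.

Section PolLift.
Variables (F : fieldType) (n : nat).

Definition pol_lift (B : algType F) (h : 'I_n -> B) : mpoly n F -> B :=
  mpoly.mmap (in_alg B) h.

Lemma pol_lift_lrmorphism (B : algType F) (h : 'I_n -> B) :
    (forall i j, h i * h j = h j * h i) ->
  {g : {lrmorphism mpoly n F -> B} |
     (forall u, g u = pol_lift h u) /\ (forall i, g 'X_i = h i)}.
Proof.
move=> hC.
have mmap1D m1 m2 : mmap1 h (m1 + m2)%MM = mmap1 h m1 * mmap1 h m2.
  rewrite /mmap1.
  suff [] : (\prod_(i < n) h i ^+ (m1 + m2)%MM i =
               \prod_(i < n) h i ^+ m1 i * \prod_(i < n) h i ^+ m2 i)
            /\ (forall j, GRing.comm (\prod_(i < n) h i ^+ m1 i) (h j)) by [].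
  elim/big_rec3: _ => [|i y1 y2 y3 _ [-> cy]].
    by split=> [|j]; [rewrite mulr1 | apply: commr_sym; apply: commr1].
  split=> [|j].
    rewrite mnmDE exprD -!mulrA; congr (_ * _).
    by rewrite !mulrA; congr (_ * _); apply: commr_sym; apply: commrX.
  apply: commr_sym; apply: commrM; last exact/commr_sym.
  by apply: commrX; apply: hC.
have fB : zmod_morphism (pol_lift h) by exact: mpoly.mmap_is_additive.
pose ia := GRing.isZmodMorphism.Build _ _ (pol_lift h) fB.
pose ga : {additive mpoly n F -> B} := HB.pack (pol_lift h) ia.
have fS I (r : seq I) G :
    pol_lift h (\sum_(i <- r) G i) = \sum_(i <- r) pol_lift h (G i).
  exact: (raddf_sum ga).
have fZ : scalable (pol_lift h).
  by move=> c q; rewrite /pol_lift mpoly.mmapZ mulr_algl.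
have fX m : pol_lift h 'X_[m] = mmap1 h m by rewrite /pol_lift mpoly.mmapX.
have fM : monoid_morphism (pol_lift h).
  split=> [|q r]; first by rewrite -mpolyX0 fX mmap11.
  rewrite [q]mpolyE [r]mpolyE mulr_suml !fS mulr_suml.
  apply: eq_bigr => m1 _; rewrite mulr_sumr fS mulr_sumr.
  apply: eq_bigr => m2 _; rewrite -scalerAl -scalerAr -mpolyXD !fZ !fX mmap1D.
  by rewrite -scalerAl -scalerAr.
pose im := GRing.isMonoidMorphism.Build _ _ (pol_lift h) fM.
pose iz := GRing.isScalable.Build _ _ _ _ (pol_lift h) fZ.
pose g : {lrmorphism mpoly n F -> B} := HB.pack (pol_lift h) ia im iz.
by exists g; split=> // i; rewrite /= fX mmap1U.
Qed.

End PolLift.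

Section Periplectic.
Variables (F : fieldType) (n : nat).

Definition pn_mx : {pred 'M[F]_(n + n)} :=
  [pred x | [&& drsubmx x == - (ulsubmx x)^T, (ursubmx x)^T == ursubmx x
              & (dlsubmx x)^T == - dlsubmx x]].

Lemma pn_mxP x :
  reflect [/\ drsubmx x = - (ulsubmx x)^T, (ursubmx x)^T = ursubmx x
            & (dlsubmx x)^T = - dlsubmx x] (x \in pn_mx).
Proof.
by apply: (iffP and3P) => [[/eqP? /eqP? /eqP?]|[-> -> ->]]; split.
Qed.

Lemma pn_mx_block (a b c : 'M[F]_n) :
  b^T = b -> c^T = - c -> block_mx a b c (- a^T) \in pn_mx.
Proof.
move=> bT cT; apply/pn_mxP.
by rewrite block_mxKul block_mxKur block_mxKdl block_mxKdr.
Qed.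

Fact pn_mx_submod_closed : submod_closed pn_mx.
Proof.
split=> [|k x y /pn_mxP[x1 x2 x3] /pn_mxP[y1 y2 y3]]; apply/pn_mxP.
  by split; apply/matrixP => i j; rewrite !mxE ?oppr0.
move: x1 x2 x3 y1 y2 y3 => /matrixP x1 /matrixP x2 /matrixP x3.
move=> /matrixP y1 /matrixP y2 /matrixP y3.
split; apply/matrixP => i j; move: (x1 i j) (x2 i j) (x3 i j);
  move: (y1 i j) (y2 i j) (y3 i j); rewrite !mxE => e1 e2 e3 f1 f2 f3.
- by rewrite e1 f1 opprD mulrN.
- by rewrite e2 f2.
- by rewrite e3 f3 opprD mulrN.
Qed.
HB.instance Definition _ :=
  GRing.isSubmodClosed.Build F 'M[F]_(n + n) pn_mx pn_mx_submod_closed.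

Record pn := Pn { pn_val :> 'M[F]_(n + n); pn_valP : pn_val \in pn_mx }.

HB.instance Definition _ := [isSub for pn_val].
HB.instance Definition _ := [Choice of pn by <:].
HB.instance Definition _ := [SubChoice_isSubLmodule of pn by <:].

(* s = false : even, s = true : odd; on pn, ulsubmx x = 0 forces
   drsubmx x = 0. *)
Definition has_parity (s : bool) (x : pn) : Prop :=
  if s then ulsubmx x = 0 else ursubmx x = 0 /\ dlsubmx x = 0.

Definition in_g1 (x : pn) : Prop := ulsubmx x = 0 /\ dlsubmx x = 0.

(* d = dim g_{-1}, the space of skew-symmetric n x n matrices. *)
Definition dim_gm1 : nat := (n * n.-1)./2.

(* The superbracket of x, y homogeneous of parities s, t. *)
Definition supercomm (s t : bool) (x y : 'M[F]_(n + n)) : 'M[F]_(n + n) :=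
  x *m y - (-1) ^+ (s && t) *: (y *m x).

Lemma supercomm_closed s t (x y : pn) :
  has_parity s x -> has_parity t y -> supercomm s t x y \in pn_mx.
Proof.
case/pn_mxP: (pn_valP x) => x1 x2 x3; case/pn_mxP: (pn_valP y) => y1 y2 y3.
rewrite /has_parity /supercomm => hx hy.
rewrite -[pn_val x]submxK -[pn_val y]submxK x1 y1 {x1 y1}.
move: (ulsubmx x) (ursubmx x) (dlsubmx x) (ulsubmx y) (ursubmx y) (dlsubmx y)
  x2 x3 y2 y3 hx hy => a b c a' b' c' x2 x3 y2 y3 hx hy.
have trN (m : 'M[F]_n) : (- m)^T = - m^T by rewrite linearN.
have trD (m m' : 'M[F]_n) : (m + m')^T = m^T + m'^T by rewrite linearD.
rewrite !mulmx_block scale_block_mx opp_block_mx add_block_mx.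
pose simp := (trD, trN, trmx_mul, trmxK, trmx0, mul0mx, mulmx0, oppr0,
  addr0, add0r, subr0, sub0r, opprK, mulNmx, mulmxN, opprD).
case: s hx; case: t hy => /=;
  rewrite ?block_mxKul ?block_mxKur ?block_mxKdl ?expr0 ?expr1 ?scale1r
    ?scaleN1r ?opprK => hy hx;
  apply/pn_mxP; rewrite block_mxKul block_mxKur block_mxKdl block_mxKdr.
- by rewrite hx hy !simp x2 x3 y2 y3 !simp; split; rewrite // addrC.
- by case: hy => -> ->; rewrite hx !simp x2 x3 !simp; split; rewrite // addrC.
- by case: hx => -> ->; rewrite hy !simp y2 y3 !simp; split; rewrite // addrC.
by case: hx hy => [-> ->] [-> ->]; rewrite !simp; split; rewrite // addrC.
Qed.

Definition h_mx (i : 'I_n) : 'M[F]_(n + n) :=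
  block_mx (delta_mx i i) 0 0 (- delta_mx i i).

Fact h_mx_pn i : h_mx i \in pn_mx.
Proof.
have /= e : (delta_mx i i : 'M[F]_n)^T = delta_mx i i by rewrite trmx_delta.
by rewrite /h_mx -[X in - X]e pn_mx_block ?trmx0 ?oppr0.
Qed.

Definition h_elt (i : 'I_n) : pn := Pn (h_mx_pn i).

Lemma block_diagX (a d : 'M[F]_n) k :
  block_mx a 0 0 d ^+ k = block_mx (a ^+ k) 0 0 (d ^+ k).
Proof.
elim: k => [|k IHk]; first by rewrite !expr0 -scalar_mx_block.
rewrite !exprS IHk -!mulmxE mulmx_block.
by rewrite !mulmx0 !mul0mx !addr0 !add0r.
Qed.

(* The p-map x |-> x^p on g_0 has values in g_0. *)
Lemma pmap_closed k (x : pn) :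
  odd k -> has_parity false x -> pn_val x ^+ k \in pn_mx.
Proof.
move=> k_odd [x2 x3]; case/pn_mxP: (pn_valP x) => x1 _ _.
rewrite -[pn_val x]submxK x1 x2 x3 block_diagX exprNn -signr_odd k_odd expr1 mulN1r.
have -> : (ulsubmx x)^T ^+ k = (ulsubmx x ^+ k)^T.
  elim: k {k_odd} => [|k IHk]; first by rewrite !expr0 trmx1.
  by rewrite exprSr IHk exprS -!mulmxE trmx_mul.
by rewrite pn_mx_block // ?trmx0 ?oppr0.
Qed.

Lemma h_mxX i k : odd k -> h_mx i ^+ k = h_mx i.
Proof.
move=> k_odd; rewrite /h_mx block_diagX exprNn -signr_odd k_odd expr1 mulN1r.
suff -> : (delta_mx i i : 'M[F]_n) ^+ k = delta_mx i i by [].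
case: k k_odd => // k _; elim: k => [|k IHk]; first by rewrite expr1.
by rewrite exprS IHk -mulmxE mul_delta_mx.
Qed.

Lemma h_mxC i j : h_mx i *m h_mx j = h_mx j *m h_mx i.
Proof.
rewrite /h_mx !mulmx_block !mulmx0 !mul0mx !addr0 !add0r !mulmxN !mulNmx.
by rewrite !mul_delta_mx_cond eq_sym; case: eqP => [->|].
Qed.

Definition in_nplus (x : pn) : Prop :=
  dlsubmx x = 0 /\ forall i j : 'I_n, (j <= i)%N -> ulsubmx x i j = 0.

Record GL := MkGL { GL_val :> 'M[F]_n; GL_valP : GL_val \in unitmx }.

Definition GL_diag (a : GL) : 'M[F]_(n + n) :=
  block_mx a 0 0 (invmx a)^T.

Lemma GL_diag_mulV (a : GL) :
  GL_diag a *m block_mx (invmx a) 0 0 (GL_val a)^T = 1%:M.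
Proof.
rewrite /GL_diag mulmx_block !mulmx0 !mul0mx !addr0 !add0r.
by rewrite -trmx_mul mulmxV ?GL_valP // trmx1 -scalar_mx_block.
Qed.

Lemma GL_diag_unit (a : GL) : GL_diag a \in unitmx.
Proof. by case: (mulmx1_unit (GL_diag_mulV a)). Qed.

Lemma invmx_GL_diag (a : GL) :
  invmx (GL_diag a) = block_mx (invmx a) 0 0 (GL_val a)^T.
Proof.
rewrite -[LHS]mulmx1 -(GL_diag_mulV a) mulmxA mulVmx ?GL_diag_unit //.
by rewrite mul1mx.
Qed.

Definition Ad_mx (a : GL) (x : 'M[F]_(n + n)) : 'M[F]_(n + n) :=
  GL_diag a *m x *m invmx (GL_diag a).

Lemma Ad_mx_block (a : GL) x :
  Ad_mx a x = block_mx (GL_val a *m ulsubmx x *m invmx a)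
                       (GL_val a *m ursubmx x *m (GL_val a)^T)
                       ((invmx a)^T *m dlsubmx x *m invmx a)
                       ((invmx a)^T *m drsubmx x *m (GL_val a)^T).
Proof.
rewrite /Ad_mx invmx_GL_diag /GL_diag -{1}[x]submxK !mulmx_block.
by rewrite !mulmx0 !mul0mx !addr0 !add0r.
Qed.

Fact Ad_closed (a : GL) (x : pn) : Ad_mx a x \in pn_mx.
Proof.
case/pn_mxP: (pn_valP x) => x1 x2 x3; rewrite Ad_mx_block x1.
have -> : (invmx a)^T *m - (ulsubmx x)^T *m (GL_val a)^T =
          - (GL_val a *m ulsubmx x *m invmx a)^T.
  by rewrite !trmx_mul mulmxN mulNmx mulmxA.
apply: pn_mx_block; rewrite !trmx_mul ?trmxK.
  by rewrite x2 mulmxA.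
by rewrite x3 mulNmx mulmxN mulmxA.
Qed.

Definition Ad (a : GL) (x : pn) : pn := Pn (Ad_closed a x).

Lemma Ad_linear (a : GL) (c : F) (x y : pn) :
  Ad a (c *: x + y) = c *: Ad a x + Ad a y.
Proof.
apply: val_inj; rewrite /= /Ad_mx.
by rewrite mulmxDr mulmxDl -scalemxAr -scalemxAl.
Qed.

Lemma Ad_mxM (a : GL) x y : Ad_mx a (x *m y) = Ad_mx a x *m Ad_mx a y.
Proof.
by rewrite /Ad_mx !mulmxA mulmxKV ?GL_diag_unit.
Qed.

Lemma Ad_mxX (a : GL) (x : 'M[F]_(n + n)) k : Ad_mx a (x ^+ k) = Ad_mx a x ^+ k.
Proof.
elim: k => [|k IHk].
  by rewrite !expr0 /Ad_mx -[1]/(1%:M) mulmx1 mulmxV ?GL_diag_unit.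
by rewrite !exprS -IHk -!mulmxE Ad_mxM.
Qed.

Lemma Ad_supercomm (a : GL) s t x y :
  Ad_mx a (supercomm s t x y) = supercomm s t (Ad_mx a x) (Ad_mx a y).
Proof.
rewrite /supercomm -!Ad_mxM {1}/Ad_mx mulmxBr mulmxBl.
by rewrite -scalemxAr -scalemxAl.
Qed.

Lemma Ad_parity (a : GL) s x : has_parity s x -> has_parity s (Ad a x).
Proof.
rewrite /has_parity /= Ad_mx_block block_mxKul block_mxKur block_mxKdl.
by case: s => [->|[-> ->]]; rewrite ?mulmx0 ?mul0mx.
Qed.

Lemma Ad_g1 (a : GL) x : in_g1 x -> in_g1 (Ad a x).
Proof.
rewrite /in_g1 /= Ad_mx_block block_mxKul block_mxKdl.
by case=> -> ->; rewrite !mulmx0 !mul0mx.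
Qed.

End Periplectic.

Section Enveloping.
Variables (F : fieldType) (n p : nat).
Hypothesis charFp : p \in [pchar F].

Local Notation g := (pn F n).
Local Notation T := (free_alg F g).

(* U(g) is the quotient of the free algebra on the set g by the linearity and
   the superbracket relations. *)
Inductive U_rel : T -> Prop :=
| U_linear (c : F) (x y : g) :
    U_rel (free_gen F (c *: x + y) - (c *: free_gen F x + free_gen F y))
| U_bracket s t (x y z : g) :
    has_parity s x -> has_parity t y ->
    pn_val z = supercomm s t x y ->
    U_rel (free_gen F x * free_gen F y
             - (-1) ^+ (s && t) *: (free_gen F y * free_gen F x)
           - free_gen F z).

Fact U_rel_proper : ~ ideal_gen U_rel 1.
Proof.
have [e eE] := free_lift_lrmorphism (B := F^o) (fun _ : g => 0).
have e0 x : e (free_gen F x) = 0 by rewrite eE free_lift_gen.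
apply: (lrmorph_proper (f := e)) => _ [c x y|s t x y z _ _ _].
  by rewrite raddfB raddfD /= linearZ /= !e0 scaler0 addr0 subr0.
by rewrite !raddfB /= linearZ /= !rmorphM /= !e0 !mul0r scaler0 !subr0.
Qed.

Definition env_alg := alg_quot (ProperGen U_rel_proper).
HB.instance Definition _ := GRing.Algebra.on env_alg.

Definition env_gen (x : g) : env_alg := to_quot _ (free_gen F x).

(* z = x^[p] is the p-th matrix power, see pmap_closed. *)
Inductive u_rel : env_alg -> Prop :=
| u_pmap (x z : g) :
    has_parity false x -> pn_val z = (pn_val x) ^+ p ->
    u_rel (env_gen x ^+ p - env_gen z).

Fact env_lift_lrmorphism (B : algType F) (phi : g -> B) :
    (forall c x y, phi (c *: x + y) = c *: phi x + phi y) ->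
    (forall s t x y z, has_parity s x -> has_parity t y ->
       pn_val z = supercomm s t x y ->
       phi x * phi y - (-1) ^+ (s && t) *: (phi y * phi x) = phi z) ->
  {f : {lrmorphism env_alg -> B} |
     (forall u, f u = quot_lift (free_lift phi) u)
     /\ (forall x, f (env_gen x) = phi x)}.
Proof.
move=> phi_lin phi_br; have [e eE] := free_lift_lrmorphism phi.
have ex x : e (free_gen F x) = phi x by rewrite eE free_lift_gen.
have eS r : U_rel r -> e r = 0.
  case=> [c x y|s t x y z hx hy hz].
    by rewrite raddfB raddfD /= linearZ /= !ex phi_lin subrr.
  by rewrite !raddfB /= linearZ /= !rmorphM /= !ex (phi_br _ _ _ _ _ hx hy hz) subrr.
have [f fE] := quot_lift_lrmorphism (S := ProperGen U_rel_proper) eS.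
exists f; split=> [u|x]; first by rewrite fE /quot_lift eE.
by rewrite fE quot_liftE.
Qed.

Fact u_rel_proper : ~ ideal_gen u_rel 1.
Proof.
have [||e [_ ex]] := env_lift_lrmorphism (B := F^o) (phi := fun=> 0).
- by move=> *; rewrite scaler0 addr0.
- by move=> *; rewrite mul0r scaler0 subr0.
apply: (lrmorph_proper (f := e)) => _ [x z _ _].
rewrite raddfB /= rmorphXn /= !ex subr0 expr0n.
by rewrite gtn_eqF // prime_gt0 // (pcharf_prime charFp).
Qed.

Definition u_alg := alg_quot (ProperGen u_rel_proper).
HB.instance Definition _ := GRing.Algebra.on u_alg.

Definition u_gen (x : g) : u_alg := to_quot _ (env_gen x).

Inductive ubar_rel : u_alg -> Prop :=
| ubar_nil (s : seq g) :
    {in s, forall x, in_g1 x} -> (dim_gm1 n < size s)%N ->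
    ubar_rel (\prod_(x <- s) u_gen x).

Definition superalg_rep (B : algType F) (phi : g -> B) : Prop :=
  [/\ forall c x y, phi (c *: x + y) = c *: phi x + phi y,
      forall s t x y z, has_parity s x -> has_parity t y ->
        pn_val z = supercomm s t x y ->
        phi x * phi y - (-1) ^+ (s && t) *: (phi y * phi x) = phi z
    & forall x z, has_parity false x -> pn_val z = (pn_val x) ^+ p ->
        phi x ^+ p = phi z].

Fact u_lift_lrmorphism (B : algType F) (phi : g -> B) :
    superalg_rep phi ->
  {f : {lrmorphism u_alg -> B} |
     (forall u, f u = quot_lift (quot_lift (free_lift phi)) u)
     /\ (forall x, f (u_gen x) = phi x)}.
Proof.
case=> phi_lin phi_br phi_p; have [e [eE ex]] := env_lift_lrmorphism phi_lin phi_br.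
have eS r : u_rel r -> e r = 0.
  case=> x z hx hz.
  by rewrite raddfB /= rmorphXn /= !ex (phi_p _ _ hx hz) subrr.
have [f fE] := quot_lift_lrmorphism (S := ProperGen u_rel_proper) eS.
exists f; split=> [u|x]; first by rewrite fE {1}/quot_lift eE.
by rewrite fE quot_liftE.
Qed.

Fact ubar_rel_proper : ~ ideal_gen ubar_rel 1.
Proof.
have [|e [_ ex]] := u_lift_lrmorphism (B := F^o) (phi := fun=> 0).
  split=> *; first by rewrite scaler0 addr0.
    by rewrite mul0r scaler0 subr0.
  by rewrite expr0n gtn_eqF // prime_gt0 // (pcharf_prime charFp).
apply: (lrmorph_proper (f := e)) => _ [[|x s] // _ _].
by rewrite big_cons rmorphM /= ex mul0r.
Qed.

Definition ubar := alg_quot (ProperGen ubar_rel_proper).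
HB.instance Definition _ := GRing.Algebra.on ubar.

Definition iota (x : g) : ubar := to_quot _ (u_gen x).

(* The algebra morphism ubar -> B extending phi if phi satisfies the relations
   of ubar, by ubar_lift_lrmorphism. *)
Definition ubar_lift (B : algType F) (phi : g -> B) : ubar -> B :=
  quot_lift (quot_lift (quot_lift (free_lift phi))).

Lemma ubar_lift_lrmorphism (B : algType F) (phi : g -> B) :
    superalg_rep phi ->
    (forall s : seq g, {in s, forall x, in_g1 x} -> (dim_gm1 n < size s)%N ->
       \prod_(x <- s) phi x = 0) ->
  {f : {lrmorphism ubar -> B} |
     (forall u, f u = ubar_lift phi u) /\ (forall x, f (iota x) = phi x)}.
Proof.
move=> phi_rep phi_nil; have [e [eE ex]] := u_lift_lrmorphism phi_rep.
have eS r : ubar_rel r -> e r = 0.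
  case=> s hs ds; rewrite rmorph_prod /= -[RHS](phi_nil s) //.
  by apply: eq_bigr => x _; rewrite ex.
have [f fE] := quot_lift_lrmorphism (S := ProperGen ubar_rel_proper) eS.
exists f; split=> [u|x]; first by rewrite fE {1}/quot_lift eE.
by rewrite fE quot_liftE.
Qed.

Lemma iota_superalg_rep : superalg_rep iota.
Proof.
split=> [c x y|s t x y z hx hy hz|x z hx hz].
- rewrite -[RHS](linearP (to_quot _)); congr to_quot.
  rewrite -[RHS](linearP (to_quot _)); congr to_quot.
  rewrite -[RHS](linearP (to_quot _)).
  apply/eqP; rewrite -subr_eq0 -raddfB; apply/eqP.
  by apply: to_quot_gen0; apply: U_linear.
- apply: to_quot_supercomm; apply: to_quot_supercomm.
  have /eqP := to_quot_gen0 (S := ProperGen U_rel_proper) (U_bracket hx hy hz).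
  rewrite to_quotB subr_eq0 => /eqP e.
  exact: etrans (to_quot_supercomm _ erefl) e.
have /eqP := to_quot_gen0 (S := ProperGen u_rel_proper) (u_pmap hx hz).
rewrite to_quotB subr_eq0 => /eqP e.
have e1 : u_gen x ^+ p = u_gen z.
  exact: etrans (esym (rmorphXn (to_quot _) p (env_gen x))) e.
rewrite [RHS]/iota -e1; exact: esym (rmorphXn (to_quot _) p (u_gen x)).
Qed.

Lemma iota_nil (s : seq g) :
  {in s, forall x, in_g1 x} -> (dim_gm1 n < size s)%N ->
  \prod_(x <- s) iota x = 0.
Proof.
move=> hs ds.
have <- := rmorph_prod (to_quot (ProperGen ubar_rel_proper)) s xpredT u_gen.
by apply: to_quot_gen0; apply: ubar_nil.
Qed.

(* The action induced by Ad on ubar, by act_lrmorphism. *)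
Definition act (a : GL F n) : ubar -> ubar := ubar_lift (fun x => iota (Ad a x)).

Lemma act_lrmorphism (a : GL F n) :
  {f : {lrmorphism ubar -> ubar} |
     (forall u, f u = act a u) /\ (forall x, f (iota x) = iota (Ad a x))}.
Proof.
have [i_lin i_br i_p] := iota_superalg_rep.
apply: ubar_lift_lrmorphism.
  split=> [c x y|s t x y z hx hy hz|x z hx hz].
  - by rewrite Ad_linear i_lin.
  - apply: i_br; [exact: Ad_parity | exact: Ad_parity |].
    by rewrite /= hz Ad_supercomm.
  by apply: i_p; [exact: Ad_parity | rewrite /= hz Ad_mxX].
move=> s hs ds; rewrite -(big_map (Ad a) xpredT) iota_nil ?size_map //.
by move=> _ /mapP[x xs ->]; apply/Ad_g1/hs.
Qed.

(* The Z/2-grading of ubar: the smallest family of subspaces that contains 1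
   in degree false, the homogeneous elements of g in their degree, and is
   multiplicative. *)
Inductive ubar_parity : bool -> ubar -> Prop :=
| parity0 s : ubar_parity s 0
| parity1 : ubar_parity false 1
| parity_iota s x : has_parity s x -> ubar_parity s (iota x)
| parityD s (c : F) u v :
    ubar_parity s u -> ubar_parity s v -> ubar_parity s (c *: u + v)
| parityM s t u v :
    ubar_parity s u -> ubar_parity t v -> ubar_parity (s (+) t) (u * v).

(* The commutator with x in g_1 is the supercommutator, since z is even. *)
Definition in_Z (z : ubar) : Prop :=
  [/\ ubar_parity false z,
      forall a : GL F n, act a z = z
    & forall x : g, in_g1 x -> z * iota x - iota x * z = 0].

Definition T_invariant (u : ubar) : Prop :=
  forall a : GL F n, is_diag_mx (GL_val a) -> act a u = u.

Inductive left_ideal_nplus : ubar -> Prop :=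
| LeftIdeal0 : left_ideal_nplus 0
| LeftIdealD u x v :
    in_nplus x -> left_ideal_nplus v -> left_ideal_nplus (u * iota x + v).

Definition in_l (u : ubar) : Prop := left_ideal_nplus u /\ T_invariant u.

Inductive uh_rel : mpoly n F -> Prop :=
| uh_pow (i : 'I_n) : uh_rel ('X_i ^+ p - 'X_i).

Lemma pol_lift_uh_rel (B : algType F) (v : 'I_n -> B) :
    (forall i j, v i * v j = v j * v i) -> (forall i, v i ^+ p = v i) ->
  {f : {lrmorphism mpoly n F -> B} |
     [/\ forall q, f q = pol_lift v q, forall i, f 'X_i = v i
       & forall q, uh_rel q -> f q = 0]}.
Proof.
move=> vC vp; have [f [fE fX]] := pol_lift_lrmorphism vC.
by exists f; split=> // _ [i]; rewrite raddfB /= rmorphXn /= !fX vp subrr.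
Qed.

Fact uh_rel_proper : ~ ideal_gen uh_rel 1.
Proof.
have [||f [_ _ f0]] := pol_lift_uh_rel (B := F^o) (v := fun=> 0) => //.
  by move=> i; rewrite expr0n gtn_eqF // prime_gt0 // (pcharf_prime charFp).
exact: (lrmorph_proper (f := f)).
Qed.

Definition uh := alg_quot (ProperGen uh_rel_proper).
HB.instance Definition _ := GRing.Algebra.on uh.

Definition uh_gen (i : 'I_n) : uh := to_quot _ 'X_i.

(* Weights are given by their coordinates mu 0 i = mu(h_i). *)
Definition in_Lambda0 (mu : 'rV[F]_n) : Prop :=
  forall i, exists m : nat, mu 0 i = m%:R.

(* Independent of the representative of f when mu is in Lambda0 (uh_evalE). *)
Definition uh_eval (mu : 'rV[F]_n) (f : uh) : F :=
  (repr f).@[fun i => mu 0 i].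

(* The map u(h) -> ubar sending h_i to iota h_i; it is a morphism of algebras
   for odd p (uh_in_ubar_lrmorphism). *)
Definition uh_in_ubar : uh -> ubar :=
  quot_lift (pol_lift (fun i => iota (h_elt F i))).

Lemma uh_evalE mu q : in_Lambda0 mu ->
  uh_eval mu (to_quot _ q) = q.@[fun i => mu 0 i].
Proof.
move=> mu0; have [|i|f [fE _ f0]] := pol_lift_uh_rel (B := F^o) (v := fun i => mu 0 i).
- by move=> i j; rewrite mulrC.
- by have [m ->] := mu0 i; rewrite -(pFrobenius_autE charFp) rmorph_nat.
have fev r : f r = r.@[fun i => mu 0 i].
  rewrite fE /pol_lift /meval /mpoly.mmap; apply: eq_bigr => m _.
  by rewrite /= [_%:A]mulr1.
have := quot_liftE (S := ProperGen uh_rel_proper) f0 q.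
by rewrite /quot_lift /uh_eval !fev.
Qed.

Lemma uh_in_ubar_lrmorphism : odd p ->
  {f : {lrmorphism uh -> ubar} |
     (forall u, f u = uh_in_ubar u)
     /\ (forall i, f (uh_gen i) = iota (h_elt F i))}.
Proof.
move=> p_odd; have [i_lin i_br i_p] := iota_superalg_rep.
have hC i j : iota (h_elt F i) * iota (h_elt F j)
              = iota (h_elt F j) * iota (h_elt F i).
  have h_even k : has_parity false (h_elt F k : g).
    by rewrite /has_parity /= block_mxKur block_mxKdl.
  have := i_br false false _ _ 0 (h_even i) (h_even j).
  rewrite /supercomm /= h_mxC expr0 !scale1r subrr => /(_ erefl)/eqP.
  have -> : iota 0 = 0.
    have /eqP := i_lin 1 0 0; rewrite !scale1r addr0 -subr_eq0 opprD addrA.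
    by rewrite subrr sub0r oppr_eq0 => /eqP.
  by rewrite subr_eq0 => /eqP.
have hp i : iota (h_elt F i) ^+ p = iota (h_elt F i).
  by apply: i_p; rewrite /= ?block_mxKur ?block_mxKdl ?h_mxX.
have [f [fE fX f0]] := pol_lift_uh_rel hC hp.
have [e eE] := quot_lift_lrmorphism (S := ProperGen uh_rel_proper) f0.
exists e; split=> [u|i]; first by rewrite eE /quot_lift fE.
by rewrite eE quot_liftE.
Qed.

(* The projection of u along l; the value is 0 by convention outside of the sum
   of u(h) and l. *)
Definition harish_chandra (u : ubar) : uh :=
  classical_sets.xget 0 (fun f : uh => in_l (u - uh_in_ubar f)).

(* (w lambda)(h_j) = lambda(h_(w^-1 j)), so that w sends epsilon_i to
   epsilon_(w i). *)
Definition dot (rho : 'rV[F]_n) (w : 'S_n) (lambda : 'rV[F]_n) : 'rV[F]_n :=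
  col_perm w^-1 (lambda + rho) - rho.

(* w . f = f, as (w . f)(lambda) = f(w^-1 . lambda) and an element of u(h) is
   determined by its values on Lambda0. *)
Definition dot_invariant (rho : 'rV[F]_n) (f : uh) : Prop :=
  forall (w : 'S_n) (lambda : 'rV[F]_n), in_Lambda0 lambda ->
    uh_eval (dot rho w^-1 lambda) f = uh_eval lambda f.

Definition Theta : uh :=
  \prod_(i < n) \prod_(j < n | i != j)
    (uh_gen i - uh_gen j + (j%:R - i%:R - 1)%:A).

End Enveloping.

(* Main.v *)
(* Let phi(mu) be the value at mu of h(z).  If L is a left ideal of ubar that
   contains n^+ and the h_i - mu(h_i), then z - phi(mu) lies in L, so phi(mu) is
   the scalar by which z acts on every highest weight vector of weight mu.  Two
   families of such vectors inside the Verma modules of ubar give relations: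
   (1) f_k^(m+1) v with m = lambda(h_k - h_(k+1)) gives invariance of phi under
   the dot action, since z commutes with f_k by GL_n-invariance;
   (2) if lambda(h_(n-1)) = lambda(h_n), a root vector y of g_(-1) applied to v
   is a highest weight vector modulo multiples of f_(n-1) v, which gives
   phi(lambda) = phi(lambda - epsilon_(n-1) - epsilon_n).
   Both need f_k^j v != 0 for j < p, which is checked in a Fock representation.
   From (1) and (2), phi is constant, equal to c, on the zeros of Theta in
   Lambda_0, and (phi - c) / Theta can be interpolated by an element of u(h)
   that is invariant under the dot action. *)
Require Import Defs.
From mathcomp Require Import all_boot all_algebra.
From HB Require Import structures.
From mathcomp Require Import all_fingroup.
From mathcomp Require Import ring zify monalg mpoly.
From mathcomp Require boolp classical_sets.

Set Implicit Arguments.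
Unset Strict Implicit.
Unset Printing Implicit Defensive.

Import GRing.Theory.
Local Open Scope ring_scope.


(** * Fermionic Fock space *)

(** Since [ubar] is given by generators and relations, nonvanishing in it has to be seen in a
    module. In the module induced from g_0 + g_1, where g_1 kills M, each element of g_1 lowers the
    degree in Lambda(g_-1). This degree is at most d, so products of more than d elements of g_1 act
    by 0 and [ubar] acts. In (2), z is not known to commute with y, so z y v cannot be compared with
    y z v. The comparison is made after applying an x in g_1 with [x, y] = -2 f, since x and f both
    commute with z. The obstacle is that y v is a highest weight vector only modulo f v, which
    leaves an error term r f v. By weights r should have weight -2 epsilon_n. The weights of h are
    known modulo p only, and modulo p this is also the weight of f^(p-1) y, so they cannot exclude
    r. The torus of GL_n has integral characters and fixes z; over an infinite field it removes
    r. *)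

Section Fock.
Variables (F : fieldType) (X : finType).

(** The predecessor gives the operators the size [fock_dim.+1], for which square matrices form a
    nonzero ring. *)
Definition fock_dim := #|{set X}|.-1.

Lemma fock_dimE : #|{set X}| = fock_dim.+1.
Proof. by rewrite /fock_dim prednK //; apply/card_gt0P; exists set0. Qed.

Definition fock_rank (S : {set X}) : 'I_fock_dim.+1 :=
  cast_ord fock_dimE (enum_rank S).

Definition fock_set (i : 'I_fock_dim.+1) : {set X} :=
  enum_val (cast_ord (esym fock_dimE) i).

Lemma fock_rankK : cancel fock_rank fock_set.
Proof. by move=> S; rewrite /fock_set /fock_rank cast_ordK enum_rankK. Qed.

Lemma fock_setK : cancel fock_set fock_rank.
Proof. by move=> i; rewrite /fock_set /fock_rank enum_valK cast_ordKV. Qed.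

Definition fock_vec (S : {set X}) : 'cV[F]_fock_dim.+1 :=
  delta_mx (fock_rank S) 0.

Lemma fock_vec_neq0 S : fock_vec S != 0.
Proof.
apply/eqP => /matrixP/(_ (fock_rank S) 0)/eqP.
by rewrite !mxE !eqxx oner_eq0.
Qed.

Definition fock_op (g : {set X} -> 'cV[F]_fock_dim.+1) : 'M[F]_fock_dim.+1 :=
  \matrix_(i, j) g (fock_set j) i 0.

Lemma fock_opE g S : fock_op g *m fock_vec S = g S.
Proof.
rewrite -colE; apply/matrixP=> i j; rewrite !mxE fock_rankK.
by rewrite ord1.
Qed.

Lemma fock_ext (Y Z : 'M[F]_fock_dim.+1) :
  (forall S, Y *m fock_vec S = Z *m fock_vec S) -> Y = Z.
Proof.
move=> YZ; apply/matrixP => i j; have := YZ (fock_set j).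
rewrite -!colE => /matrixP/(_ i 0); rewrite !mxE.
by rewrite fock_setK.
Qed.

(* The Jordan-Wigner sign. *)
Definition fock_sign (t : X) (S : {set X}) : F :=
  (-1) ^+ #|[set s in S | (enum_rank s < enum_rank t)%N]|.

Lemma fock_sign_sqr t S : fock_sign t S * fock_sign t S = 1.
Proof. by rewrite -expr2 sqrr_sign. Qed.

Lemma fock_signU s t (S : {set X}) : t \notin S ->
  fock_sign s (t |: S) = (-1) ^+ (enum_rank t < enum_rank s)%N * fock_sign s S.
Proof.
move=> tS; rewrite /fock_sign -exprD; congr (_ ^+ _).
pose A : {set X} := [set u in S | (enum_rank u < enum_rank s)%N].
have tA : t \notin A by rewrite inE (negPf tS).
case ts: (enum_rank t < enum_rank s)%N; last first.
  rewrite add0n; congr #|pred_of_set _|; apply/setP => u; rewrite !inE.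
  by case: eqP => [->|] //=; rewrite ts andbF.
have -> : [set s0 in t |: S | (enum_rank s0 < enum_rank s)%N] = t |: A.
  apply/setP => u; rewrite !inE.
  by case: eqP => [->|] //=; rewrite ts.
by rewrite cardsU1 tA.
Qed.

Lemma fock_sign_antisym (s t : X) : s != t ->
  (-1) ^+ (enum_rank t < enum_rank s)%N =
  - (-1) ^+ (enum_rank s < enum_rank t)%N :> F.
Proof.
move=> st; have : enum_rank s != enum_rank t by rewrite (inj_eq enum_rank_inj).
by rewrite -val_eqE /=; case: ltngtP => // _ _; rewrite expr1 ?opprK.
Qed.

Definition fock_c (t : X) : 'M[F]_fock_dim.+1 :=
  fock_op (fun S => if t \in S then 0 else fock_sign t S *: fock_vec (t |: S)).

Definition fock_d (t : X) : 'M[F]_fock_dim.+1 :=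
  fock_op (fun S => if t \in S then fock_sign t S *: fock_vec (S :\ t) else 0).

Lemma fock_cE t S : fock_c t *m fock_vec S =
  if t \in S then 0 else fock_sign t S *: fock_vec (t |: S).
Proof. exact: fock_opE. Qed.

Lemma fock_dE t S : fock_d t *m fock_vec S =
  if t \in S then fock_sign t S *: fock_vec (S :\ t) else 0.
Proof. exact: fock_opE. Qed.

Lemma fock_dU t (S : {set X}) : t \notin S ->
  fock_d t *m fock_vec (t |: S) = fock_sign t S *: fock_vec S.
Proof.
move=> tS; rewrite fock_dE setU11 fock_signU // ltnn mul1r.
by congr (_ *: fock_vec _); rewrite setU1K.
Qed.

Lemma fock_cc s t : fock_c s * fock_c t = - (fock_c t * fock_c s).
Proof.
apply: fock_ext => S; rewrite -!mulmxE mulNmx -!mulmxA !fock_cE.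
have [tS|tS] := boolP (t \in S); have [sS|sS] := boolP (s \in S);
  rewrite ?mulmx0 ?oppr0 // -?scalemxAr ?fock_cE ?inE ?sS ?tS ?orbT ?scaler0
    ?oppr0 // ?orbF.
rewrite (negPf sS) (negPf tS) !orbF.
have [->|st] := eqVneq s t; first by rewrite !scaler0 oppr0.
rewrite !scalerA -scaleNr setUCA; congr (_ *: _).
rewrite !fock_signU // (fock_sign_antisym st) !mulNr mulrN.
by congr (- _); rewrite mulrCA [RHS]mulrCA [fock_sign t S * _]mulrC.
Qed.

Lemma fock_dd s t : fock_d s * fock_d t = - (fock_d t * fock_d s).
Proof.
apply: fock_ext => S; rewrite -!mulmxE mulNmx -!mulmxA !fock_dE.
have [tS|tS] := boolP (t \in S); have [sS|sS] := boolP (s \in S);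
  rewrite ?mulmx0 ?oppr0 // -?scalemxAr ?fock_dE ?inE ?(negPf sS) ?(negPf tS)
    ?andbF ?scaler0 ?oppr0 // sS tS !andbT.
have [->|st] := eqVneq s t; first by rewrite !scaler0 oppr0.
rewrite /= !scalerA -scaleNr.
have -> : S :\ s :\ t = S :\ t :\ s by apply/setP => u; rewrite !inE andbCA.
congr (_ *: _).
have sE : fock_sign t S =
    (-1) ^+ (enum_rank s < enum_rank t)%N * fock_sign t (S :\ s).
  by rewrite -fock_signU ?setD11 // setD1K.
have tE : fock_sign s S =
    (-1) ^+ (enum_rank t < enum_rank s)%N * fock_sign s (S :\ t).
  by rewrite -fock_signU ?setD11 // setD1K.
rewrite sE tE (fock_sign_antisym st) !mulNr opprK -!mulrA.
by congr (_ * _); rewrite mulrC.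
Qed.

Lemma fock_dc s t :
  fock_d s * fock_c t = (s == t)%:R - fock_c t * fock_d s.
Proof.
apply: fock_ext => S; rewrite mulmxBl -!mulmxE -!mulmxA fock_cE fock_dE.
have [<-|st] := eqVneq s t.
  rewrite mul1mx; have [tS|tS] := boolP (s \in S).
    rewrite mulmx0 -scalemxAr fock_cE !inE eqxx /= scalerA setD1K //.
    have -> : fock_sign s (S :\ s) = fock_sign s S.
      by rewrite -{2}(setD1K tS) fock_signU ?setD11 // ltnn mul1r.
    by rewrite fock_sign_sqr scale1r subrr.
  by rewrite mulmx0 subr0 -scalemxAr fock_dU // scalerA fock_sign_sqr scale1r.
rewrite mul0mx sub0r; have [tS|tS] := boolP (t \in S).
  rewrite mulmx0; case: ifP => sS; last by rewrite mulmx0 oppr0.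
  by rewrite -scalemxAr fock_cE !inE eq_sym st tS scaler0 oppr0.
rewrite -scalemxAr fock_dE !inE (negPf st) /=; case: ifP => sS; last first.
  by rewrite mulmx0 scaler0 oppr0.
rewrite -scalemxAr fock_cE !inE eq_sym st (negPf tS) /= !scalerA -scaleNr.
have -> : (t |: S) :\ s = t |: (S :\ s).
  apply/setP => u; rewrite !inE; case: eqP => [->|] //=; first by rewrite (negPf st).
congr (_ *: _).
have sE : fock_sign t S =
    (-1) ^+ (enum_rank s < enum_rank t)%N * fock_sign t (S :\ s).
  by rewrite -fock_signU ?setD11 // setD1K.
rewrite sE fock_signU // (fock_sign_antisym st) mulNr mulrN mulrACA -expr2.
by rewrite sqrr_sign mul1r mulrC.
Qed.

(* Reduces a relation between operators on the Fock space to its restriction to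
   the states without modes in [Y]. *)
Lemma fock_vacuum (Y : {set X}) (k : F) (Z : 'M[F]_fock_dim.+1) :
    (forall t, t \in Y -> Z * fock_c t = k *: (fock_c t * Z)) ->
    (forall S : {set X}, [disjoint S & Y] -> Z *m fock_vec S = 0) ->
  Z = 0.
Proof.
move=> Zc Z0; apply: fock_ext => S; rewrite mul0mx.
(* Induction on the number of modes of S in Y: a state with a mode t in Y is created by [fock_c t]
   from a smaller one, and Z moves past [fock_c t] by [Zc]. *)
elim: {S}_.+1 {-2}S (ltnSn #|S :&: Y|) => // m IHm S; rewrite ltnS => mS.
have [dS|] := boolP [disjoint S & Y]; first exact: Z0.
rewrite -setI_eq0 => /set0Pn[t]; rewrite inE => /andP[tS tY].
have -> : fock_vec S = fock_sign t (S :\ t) *: (fock_c t *m fock_vec (S :\ t)).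
  by rewrite fock_cE setD11 scalerA fock_sign_sqr scale1r setD1K.
rewrite -scalemxAr mulmxA [Z *m _]Zc // -scalemxAl -mulmxA IHm.
  by rewrite mulmx0 !scaler0.
apply: leq_trans mS; apply: proper_card; rewrite properEneq setSI ?subD1set //.
rewrite andbT; apply/eqP => /setP/(_ t).
by rewrite !inE eqxx tS tY.
Qed.

End Fock.

(** * Powers of inner derivations in characteristic p *)

Section Commutator.
Variable R : pzRingType.

Definition ad (x y : R) : R := x * y - y * x.

Lemma exprMad (x y : R) k :
  x ^+ k * y = \sum_(i < k.+1) iter i (ad x) y * x ^+ (k - i) *+ 'C(k, i).
Proof.
elim: k => [|k IHk].
  by rewrite big_ord1 /= !expr0 mul1r mulr1 bin0 mulr1n.
have adE z : x * z = z * x + ad x z by rewrite /ad addrCA subrr addr0.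
rewrite exprS -mulrA IHk mulr_sumr.
pose f i := iter i (ad x) y * x ^+ (k.+1 - i).
have fE (i : 'I_k.+1) : x * (iter i (ad x) y * x ^+ (k - i) *+ 'C(k, i)) =
    f i *+ 'C(k, i) + f i.+1 *+ 'C(k, i).
  rewrite mulrnAr -mulrnDl; congr (_ *+ _).
  rewrite mulrA adE mulrDl -mulrA -exprS /f subSS subSn //.
  by rewrite -ltnS ltn_ord.
rewrite (eq_bigr _ (fun i _ => fE i)) big_split /=.
rewrite [RHS]big_ord_recl /= bin0 big_ord_recl /= bin0 -addrA; congr (_ + _).
rewrite [X in X + _ = _](_ : _ = \sum_(i < k.+1) f i.+1 *+ 'C(k, i.+1)).
  by rewrite -big_split /=; apply: eq_bigr => i _; rewrite binS mulrnDr.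
by rewrite big_ord_recr /= bin_small // mulr0n addr0.
Qed.

(** In the expansion of x^p y the middle binomial coefficients are divisible by p. This reduces the
    p-map relations for operators to iterated commutators with creation operators. *)
Lemma ad_pchar p : prime p -> (forall z : R, z *+ p = 0) ->
  forall x y : R, iter p (ad x) y = ad (x ^+ p) y.
Proof.
move=> p_pr p0 x y; rewrite /ad exprMad.
case: p p_pr p0 => // p p_pr p0; rewrite big_ord_recl big_ord_recr /=.
rewrite bin0 subn0 binn subnn expr0 mulr1 !mulr1n big1 => [|i _].
  by rewrite add0r addrAC subrr add0r.
have /dvdnP[m ->] : (p.+1 %| 'C(p.+1, bump 0 i))%N.
  by apply: prime_dvd_bin => //; rewrite /bump /= add1n !ltnS ltn_ord.
by rewrite mulrnA p0.
Qed.

End Commutator.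

(** * A Fock representation of p(n) *)

(* The module Lambda(g_-1) (x) M induced from g_0 + g_1, where M is the fermionic
   Fock space on F^n (x) F^Col with its gl(n)-action and g_1 acts on M by 0.  The
   modes [inl t] generate Lambda(g_-1) and the modes [inr (i, k)] generate M. *)
Section PeriplecticFock.
Variables (F : fieldType) (n : nat) (Col : finType).

Definition lt_pairs := [set ij : 'I_n * 'I_n | (ij.1 < ij.2)%N].

Definition skew_pair := {ij | ij \in lt_pairs}.

Definition skew_basis (t : skew_pair) : 'M[F]_n :=
  delta_mx (val t).1 (val t).2 - delta_mx (val t).2 (val t).1.

Lemma skew_decomp (c : 'M[F]_n) : 2%:R != 0 :> F -> c^T = - c ->
  c = \sum_t c (val t).1 (val t).2 *: skew_basis t.
Proof.
move=> two_neq0 /matrixP cT.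
have cii k : c k k = 0.
  have := cT k k; rewrite !mxE => /eqP.
  by rewrite -subr_eq0 opprK -mulr2n -mulr_natl mulf_eq0 (negPf two_neq0) => /eqP.
pose G (p : 'I_n * 'I_n) := c p.1 p.2 *: delta_mx p.1 p.2 : 'M[F]_n.
pose sw (p : 'I_n * 'I_n) := (p.2, p.1).
have -> : \sum_t c (val t).1 (val t).2 *: skew_basis t =
    \sum_(p : 'I_n * 'I_n | (p.1 < p.2)%N) (G p + G (sw p)).
  rewrite [RHS](eq_bigl (mem lt_pairs)) => [|ij]; last by rewrite !inE.
  rewrite (big_sub lt_pairs).
  apply: eq_bigr => t _; rewrite scalerBr /G /=; congr (_ + _).
  by have := cT (val t).1 (val t).2; rewrite !mxE => ->; rewrite scaleNr.
have swK : involutive sw by case.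
rewrite big_split /= [X in _ + X](reindex_inj (inv_inj swK)) /=.
rewrite {1}[c]matrix_sum_delta pair_bigA (bigID (fun p : 'I_n * 'I_n => p.1 < p.2)%N) /=.
congr (_ + _); rewrite [LHS](bigID (fun p : 'I_n * 'I_n => p.2 < p.1)%N) /=.
rewrite [X in _ + X]big1 ?addr0 => [|[i j] /=].
  apply: eq_big => [[i j]|[i j] _] //=.
  by case: ltngtP.
by case: ltngtP => // /val_inj->; rewrite cii scale0r.
Qed.

Lemma skew_basisT t : (skew_basis t)^T = - skew_basis t.
Proof. by rewrite linearB /= !trmx_delta opprB. Qed.

Local Notation X := (skew_pair + 'I_n * Col)%type.
Local Notation B := 'M[F]_((fock_dim X).+1).
Local Notation c_ := (@fock_c F X).
Local Notation d_ := (@fock_d F X).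

(** Only the entries above the diagonal are read, so that the map is linear on all matrices and no
    proof of skewness is carried along. *)
Definition odd_creation (m : 'M[F]_n) : B :=
  \sum_t m (val t).1 (val t).2 *: c_ (inl t).
Local Notation th := odd_creation.

Definition gl_fock (a : 'M[F]_n) : B :=
  \sum_i \sum_j a i j *: \sum_k c_ (inr (i, k)) * d_ (inr (j, k)).

(** The bracket of g_0 with g_-1, read on the lower left block. *)
Definition gl_act (a c : 'M[F]_n) : 'M[F]_n := - (a^T *m c + c *m a).

(** On the induced module, a acts on M and as a derivation on Lambda(g_-1). The lock keeps the sums
    folded during rewriting. *)
Definition even_op (a : 'M[F]_n) : B :=
  locked (gl_fock a + \sum_t th (gl_act a (skew_basis t)) * d_ (inl t)).

Lemma even_opE a : even_op a =
  gl_fock a + \sum_t th (gl_act a (skew_basis t)) * d_ (inl t).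
Proof. by rewrite /even_op -lock. Qed.

(* Obtained by moving b to the right through a product of elements of g_-1: the
   first sum collects the brackets [b, c_t] acting on M, the second one the
   double brackets [[b, c_t], c_u]. *)
Definition raise_op (b : 'M[F]_n) : B :=
  locked (\sum_t gl_fock (b *m skew_basis t) * d_ (inl t)
  + \sum_t \sum_u th (skew_basis t *m b *m skew_basis u) *
      (d_ (inl u) * d_ (inl t))).

Lemma raise_opE b : raise_op b =
  \sum_t gl_fock (b *m skew_basis t) * d_ (inl t)
  + \sum_t \sum_u th (skew_basis t *m b *m skew_basis u) *
      (d_ (inl u) * d_ (inl t)).
Proof. by rewrite /raise_op -lock. Qed.

Fact odd_creation_is_linear : linear th.
Proof.
move=> k x y; rewrite /th scaler_sumr -big_split /=; apply: eq_bigr => t _.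
by rewrite !mxE scalerDl scalerA.
Qed.
HB.instance Definition _ :=
  GRing.isLinear.Build F 'M[F]_n B _ th odd_creation_is_linear.

Fact gl_fock_is_linear : linear gl_fock.
Proof.
move=> k x y; rewrite /gl_fock scaler_sumr -big_split /=; apply: eq_bigr => i _.
rewrite scaler_sumr -big_split /=; apply: eq_bigr => j _.
by rewrite !mxE scalerDl scalerA.
Qed.
HB.instance Definition _ :=
  GRing.isLinear.Build F 'M[F]_n B _ gl_fock gl_fock_is_linear.

Lemma gl_act_linearl k a a' c :
  gl_act (k *: a + a') c = k *: gl_act a c + gl_act a' c.
Proof.
rewrite /gl_act linearP /= mulmxDl mulmxDr -scalemxAl -scalemxAr.
by rewrite scalerN -opprD scalerDr addrACA.
Qed.

Fact even_op_is_linear : linear even_op.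
Proof.
move=> k x y; rewrite !even_opE scalerDr addrACA -linearP; congr (_ + _).
rewrite scaler_sumr -big_split; apply: eq_bigr => t _.
by rewrite gl_act_linearl linearP mulrDl -scalerAl.
Qed.
HB.instance Definition _ :=
  GRing.isLinear.Build F 'M[F]_n B _ even_op even_op_is_linear.

Fact raise_op_is_linear : linear raise_op.
Proof.
move=> k x y; rewrite !raise_opE scalerDr addrACA; congr (_ + _).
  rewrite scaler_sumr -big_split; apply: eq_bigr => t _.
  by rewrite mulmxDl -scalemxAl linearP mulrDl -scalerAl.
rewrite scaler_sumr -big_split; apply: eq_bigr => t _.
rewrite scaler_sumr -big_split; apply: eq_bigr => u _.
move: (skew_basis t) (skew_basis u) => st su.
by rewrite mulmxDr mulmxDl -scalemxAr -scalemxAl linearP mulrDl -scalerAl.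
Qed.
HB.instance Definition _ :=
  GRing.isLinear.Build F 'M[F]_n B _ raise_op raise_op_is_linear.

Lemma odd_creation_cc m x : th m * c_ x = - (c_ x * th m).
Proof.
rewrite mulr_suml mulr_sumr -sumrN; apply: eq_bigr => t _.
by rewrite -scalerAl -scalerAr fock_cc scalerN.
Qed.

Lemma odd_creation_anti m m' : th m * th m' = - (th m' * th m).
Proof.
rewrite [th m' * _]mulr_suml [LHS]mulr_sumr -sumrN; apply: eq_bigr => t _.
by rewrite -scalerAl -scalerAr odd_creation_cc scalerN.
Qed.

Lemma fock_d_odd t m :
  d_ (inl t) * th m = (m (val t).1 (val t).2)%:A - th m * d_ (inl t).
Proof.
rewrite mulr_sumr mulr_suml (bigD1 t) //= [in RHS](bigD1 t) //=.
rewrite -scalerAr fock_dc eqxx scalerBr -scalerAl mulr1n -addrA opprD.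
congr (_ + (_ + _)); rewrite -sumrN; apply: eq_bigr => u ut.
rewrite -scalerAr fock_dc (inj_eq inl_inj) eq_sym (negPf ut) sub0r scalerN.
by rewrite -scalerAl.
Qed.

Lemma gl_fock_comm_inl a t : gl_fock a * c_ (inl t) = c_ (inl t) * gl_fock a.
Proof.
rewrite mulr_suml mulr_sumr; apply: eq_bigr => i _.
rewrite mulr_suml mulr_sumr; apply: eq_bigr => j _.
rewrite -scalerAl -scalerAr; congr (_ *: _).
rewrite mulr_suml mulr_sumr; apply: eq_bigr => k _.
by rewrite -mulrA fock_dc /= sub0r mulrN mulrA fock_cc mulNr opprK mulrA.
Qed.

Lemma gl_fock_comm_odd a m : gl_fock a * th m = th m * gl_fock a.
Proof.
rewrite [LHS]mulr_sumr [RHS]mulr_suml; apply: eq_bigr => t _.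
by rewrite -scalerAl -scalerAr gl_fock_comm_inl.
Qed.

Lemma gl_fock_c a j k : gl_fock a * c_ (inr (j, k)) =
  c_ (inr (j, k)) * gl_fock a + \sum_i a i j *: c_ (inr (i, k)).
Proof.
rewrite mulr_suml mulr_sumr -big_split /=; apply: eq_bigr => i _.
rewrite mulr_suml mulr_sumr (bigD1 j) //= [in RHS](bigD1 j) //= addrAC.
congr (_ + _); last first.
  apply: eq_bigr => j' jj'; rewrite -scalerAl -scalerAr; congr (_ *: _).
  rewrite mulr_suml mulr_sumr; apply: eq_bigr => k' _.
  rewrite -mulrA fock_dc (inj_eq inr_inj) xpair_eqE (negPf jj') sub0r.
  by rewrite mulrN mulrA fock_cc mulNr opprK mulrA.
rewrite -scalerAl -scalerAr -scalerDr; congr (_ *: _).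
rewrite mulr_suml mulr_sumr (bigD1 k) //= [in RHS](bigD1 k) //= addrAC.
congr (_ + _); last first.
  apply: eq_bigr => k' kk'.
  rewrite -mulrA fock_dc (inj_eq inr_inj) xpair_eqE (negPf kk') andbF sub0r.
  by rewrite mulrN mulrA fock_cc mulNr opprK mulrA.
rewrite -mulrA fock_dc eqxx mulrBr mulr1 mulrA fock_cc mulNr opprK mulrA.
by rewrite addrC.
Qed.

Lemma skew_basis_coord t u :
  skew_basis t (val u).1 (val u).2 = (t == u)%:R.
Proof.
case: t u => [[i j] tP] [[k l] uP]; rewrite -val_eqE /= xpair_eqE !mxE /=.
move: tP uP; rewrite !inE /= => ij kl.
have -> : (k == j) && (l == i) = false.
  by apply/negP => /andP[/eqP kj /eqP li]; move: kl; rewrite kj li ltnNge ltnW.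
by rewrite subr0 eq_sym [l == j]eq_sym.
Qed.

Lemma odd_creation_basis t : th (skew_basis t) = c_ (inl t).
Proof.
rewrite /th (bigD1 t) //= skew_basis_coord eqxx scale1r big1 ?addr0 // => u ut.
by rewrite skew_basis_coord eq_sym (negPf ut) scale0r.
Qed.

Definition odd_modes : {set X} := [set x | if x is inl _ then true else false].

Lemma odd_modes_disjoint (S : {set X}) t :
  [disjoint S & odd_modes] -> inl t \notin S.
Proof.
move/pred0P/(_ (inl t)); rewrite /= inE andbT => ->.
by [].
Qed.

(** The states without odd modes span the subspace 1 (x) M, which generates the induced module under
    g_-1. *)
Definition kills (Z : B) :=
  forall S : {set X}, [disjoint S & odd_modes] -> Z *m fock_vec F S = 0.

Lemma kills0 : kills 0.
Proof. by move=> S _; rewrite mul0mx. Qed.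

Lemma killsD Z Z' : kills Z -> kills Z' -> kills (Z + Z').
Proof. by move=> kZ kZ' S dS; rewrite mulmxDl kZ // kZ' // addr0. Qed.

Lemma killsN Z : kills Z -> kills (- Z).
Proof. by move=> kZ S dS; rewrite mulNmx kZ // oppr0. Qed.

Lemma killsB Z Z' : kills Z -> kills Z' -> kills (Z - Z').
Proof. by move=> kZ /killsN; apply: killsD. Qed.

Lemma killsM Z Z' : kills Z' -> kills (Z * Z').
Proof. by move=> kZ S dS; rewrite -mulmxE -mulmxA kZ // mulmx0. Qed.

Lemma kills_sum (I : finType) (G : I -> B) :
  (forall i, kills (G i)) -> kills (\sum_i G i).
Proof. by move=> kG; elim/big_ind: _ => *; [exact: kills0|exact: killsD|]. Qed.

Lemma kills_d t : kills (d_ (inl t)).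
Proof. by move=> S /(odd_modes_disjoint t)/negPf tS; rewrite fock_dE tS. Qed.

Lemma kills_gl Z a : kills Z -> kills (Z * gl_fock a).
Proof.
move=> kZ S dS; rewrite mulr_sumr mulmx_suml big1 // => i _.
rewrite mulr_sumr mulmx_suml big1 // => j _.
rewrite -scalerAr -scalemxAl mulr_sumr mulmx_suml big1 ?scaler0 // => k _.
rewrite -!mulmxE -!mulmxA fock_dE; case: ifP => jS; last by rewrite !mulmx0.
rewrite -!scalemxAr fock_cE; case: ifP => iS; first by rewrite mulmx0 scaler0.
rewrite -scalemxAr kZ ?scaler0 //; apply/pred0P => x /=.
have /pred0P/(_ x) /= := dS; rewrite !inE.
by case: x => x; rewrite ?andbF // !andbT => ->; rewrite andbF.
Qed.

(** As g_-1 generates the module from 1 (x) M, an identity of operators holds once it is compatible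
    with the action of g_-1 and valid on 1 (x) M. Brackets and p-th powers are checked in this way,
    with k = -1 for odd operators. *)
Lemma odd_vacuum k Z : (forall c, c^T = - c -> Z * th c = k *: (th c * Z)) ->
  kills Z -> Z = 0.
Proof.
move=> Zc kZ; apply: (@fock_vacuum _ _ odd_modes k) => // -[t _|x]; last first.
  by rewrite inE.
by rewrite -odd_creation_basis Zc ?skew_basisT.
Qed.

Lemma gl_act_linear a : linear (gl_act a).
Proof.
move=> k c c'; rewrite /gl_act mulmxDl mulmxDr -scalemxAl -scalemxAr.
by rewrite scalerN -opprD scalerDr addrACA.
Qed.
HB.instance Definition _ a :=
  GRing.isLinear.Build F 'M[F]_n 'M[F]_n _ (gl_act a) (gl_act_linear a).

Lemma gl_actT a c : c^T = - c -> (gl_act a c)^T = - gl_act a c.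
Proof.
move=> cT; rewrite /gl_act !linearN /= linearD /= !trmx_mul trmxK cT.
by rewrite mulmxN mulNmx -[- (c *m a) - _]opprD addrC.
Qed.

Hypothesis two_neq0 : 2%:R != 0 :> F.

Lemma skew_sum (V : lmodType F) (G : {linear 'M[F]_n -> V}) c : c^T = - c ->
  \sum_t c (val t).1 (val t).2 *: G (skew_basis t) = G c.
Proof.
move=> cT; rewrite [in RHS](skew_decomp two_neq0 cT) linear_sum.
by apply: eq_bigr => t _; rewrite linearZ.
Qed.

Lemma even_op_odd a c : c^T = - c ->
  even_op a * th c = th c * even_op a + th (gl_act a c).
Proof.
move=> cT; rewrite even_opE mulrDl mulrDr gl_fock_comm_odd -addrA; congr (_ + _).
rewrite -[th (gl_act a c)](skew_sum (th \o gl_act a) cT) mulr_suml mulr_sumr -big_split /=.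
apply: eq_bigr => t _; rewrite -mulrA fock_d_odd mulrBr -scalerAr mulr1.
by rewrite mulrA [in RHS]odd_creation_anti mulNr -mulrA addrC.
Qed.

Lemma raise_op_odd b c : b^T = b -> c^T = - c ->
  raise_op b * th c + th c * raise_op b = even_op (b *m c).
Proof.
move=> bT cT; rewrite raise_opE even_opE mulrDl mulrDr addrACA; congr (_ + _).
  rewrite -[gl_fock (b *m c)](skew_sum (gl_fock \o mulmx b) cT) mulr_suml mulr_sumr -big_split /=.
  apply: eq_bigr => t _; rewrite -mulrA fock_d_odd mulrBr -scalerAr mulr1.
  by rewrite mulrA gl_fock_comm_odd mulrA subrK.
(* The two contractions of [th c] with the quadratic part of [raise_op b]; their difference is the
   derivation part of [even_op (b *m c)]. *)
pose R1 t := \sum_u c (val t).1 (val t).2 *: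
   (th (skew_basis t *m b *m skew_basis u) * d_ (inl u)).
pose R2 t := \sum_u c (val u).1 (val u).2 *:
   (th (skew_basis t *m b *m skew_basis u) * d_ (inl t)).
transitivity (\sum_t (R1 t - R2 t)).
  rewrite mulr_suml mulr_sumr -big_split /=; apply: eq_bigr => t _.
  rewrite mulr_suml mulr_sumr -big_split -sumrB /=; apply: eq_bigr => u _.
  have dd : d_ (inl u) * d_ (inl t) * th c =
      c (val t).1 (val t).2 *: d_ (inl u) - c (val u).1 (val u).2 *: d_ (inl t)
      + th c * (d_ (inl u) * d_ (inl t)).
    rewrite -mulrA fock_d_odd mulrBr -scalerAr mulr1 [d_ (inl u) * (_ * _)]mulrA fock_d_odd mulrBl.
    by rewrite -scalerAl mul1r opprB mulrA addrA -addrA addrAC addrA.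
  move: (skew_basis t *m b *m skew_basis u) => m.
  rewrite -mulrA dd mulrDr mulrBr -!scalerAr [th m * (th c * _)]mulrA.
  by rewrite odd_creation_anti mulNr -mulrA subrK.
rewrite sumrB /R1 exchange_big /= -sumrB; apply: eq_bigr => t _.
have R1E : \sum_u c (val u).1 (val u).2 *:
    (th (skew_basis u *m b *m skew_basis t) * d_ (inl t)) =
    th (c *m b *m skew_basis t) * d_ (inl t).
  rewrite -mulmxA -[th _](skew_sum (th \o mulmxr (b *m skew_basis t)) cT) mulr_suml.
  by apply: eq_bigr => u _; rewrite scalerAl /= mulmxA.
have R2E : R2 t = th (skew_basis t *m b *m c) * d_ (inl t).
  rewrite -[th _](skew_sum (th \o mulmx (skew_basis t *m b)) cT) mulr_suml.
  by apply: eq_bigr => u _; rewrite scalerAl.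
rewrite R1E R2E -mulrBl -linearB; congr (th _ * _).
by rewrite /gl_act trmx_mul bT cT !mulNmx opprD opprK !mulmxA.
Qed.

Lemma gl_fock_bracket a a' :
  gl_fock a * gl_fock a' - gl_fock a' * gl_fock a
  = gl_fock (a *m a' - a' *m a).
Proof.
apply/eqP; rewrite -subr_eq0; apply/eqP.
have E1 (e e' : 'M[F]_n) j k : gl_fock e * gl_fock e' * c_ (inr (j, k)) =
    c_ (inr (j, k)) * (gl_fock e * gl_fock e')
    + (\sum_i e i j *: c_ (inr (i, k))) * gl_fock e'
    + (\sum_i e' i j *: c_ (inr (i, k))) * gl_fock e
    + \sum_i (e *m e') i j *: c_ (inr (i, k)).
  rewrite -mulrA gl_fock_c mulrDr mulrA gl_fock_c mulrDl -!addrA mulrA.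
  congr (_ + (_ + _)); rewrite mulr_sumr mulr_suml.
  under eq_bigr => i _ do rewrite -scalerAr gl_fock_c scalerDr scalerAl.
  rewrite big_split /=; congr (_ + _).
  under eq_bigr => i _ do rewrite scaler_sumr.
  rewrite exchange_big /=; apply: eq_bigr => i _.
  rewrite mxE scaler_suml; apply: eq_bigr => l _.
  by rewrite scalerA mulrC.
apply: (@fock_vacuum _ _ setT 1) => [[t|[j k]] _|S].
- rewrite scale1r mulrBl mulrBr gl_fock_comm_inl mulrBl mulrBr.
  by rewrite -2!mulrA !gl_fock_comm_inl ![in LHS]mulrA !gl_fock_comm_inl !mulrA.
- rewrite scale1r mulrBl mulrBr gl_fock_c mulrBl mulrBr !E1.
  set s1 := (\sum_i a i j *: _) * _; set s2 := (\sum_i a' i j *: _) * _.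
  have -> : \sum_i (a *m a' - a' *m a) i j *: c_ (inr (i, k)) =
     \sum_i (a *m a') i j *: c_ (inr (i, k)) -
     \sum_i (a' *m a) i j *: c_ (inr (i, k)).
    by rewrite -sumrB; apply: eq_bigr => i _; rewrite !mxE scalerBl.
  rewrite [_ + s2 + s1]addrAC -![_ + s1 + s2]addrA.
  have cancel (V : zmodType) (x y z : V) : (x + z) + (- y - z) = x - y.
    by rewrite addrACA subrr addr0.
  move: (s1 + s2) => w.
  rewrite [- (_ + w + _)]opprD addrACA [- (_ + w)]opprD cancel.
  by rewrite [- (_ + (_ - _))]opprD cancel.
move=> S0; have -> : S = set0.
  by apply/setP => x; have /pred0P/(_ x) := S0; rewrite /= !inE andbT.
have gl0 e : gl_fock e *m fock_vec F set0 = 0.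
  rewrite mulmx_suml big1 // => i _; rewrite mulmx_suml big1 // => j _.
  rewrite -scalemxAl mulmx_suml big1 ?scaler0 // => k _.
  by rewrite -mulmxE -mulmxA fock_dE inE mulmx0.
by rewrite !mulmxBl -!mulmxE -!mulmxA !gl0 !mulmx0 !subr0.
Qed.
End PeriplecticFock.

(** Once the products are generalized, an identity between noncommuting operators is linear in the
    remaining atoms, and [ring] settles it entrywise. *)
Ltac mx_abel :=
  repeat match goal with
  | |- context [?x *m ?y] => let p := fresh "p" in move: (x *m y) => p
  | |- context [?x * ?y] => let p := fresh "p" in move: (x * y) => p
  end;
  let i := fresh "i" in let j := fresh "j" in
  apply/matrixP => i j; rewrite !mxE; ring.

Section PeriplecticRelations.
Variables (F : fieldType) (n : nat) (Col : finType).
Hypothesis two_neq0 : 2%:R != 0 :> F.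

Local Notation X := (skew_pair n + 'I_n * Col)%type.
Local Notation B := 'M[F]_((fock_dim X).+1).
Local Notation c_ := (@fock_c F X).
Local Notation d_ := (@fock_d F X).
Local Notation th := (@odd_creation F n Col).
Local Notation gl_fock := (@gl_fock F n Col).
Local Notation even_op := (@even_op F n Col).
Local Notation raise_op := (@raise_op F n Col).
Local Notation kills := (@kills F n Col).

Lemma gl_act_bracket (a a' c : 'M[F]_n) : gl_act (a *m a' - a' *m a) c =
  gl_act a (gl_act a' c) - gl_act a' (gl_act a c).
Proof.
rewrite /gl_act linearB /= !trmx_mul !mulmxN !mulNmx !opprK.
rewrite !(mulmxDr, mulmxDl, mulmxBr, mulmxBl, mulmxN, mulNmx) !mulmxA.
mx_abel.
Qed.

Lemma kills_even a : kills (even_op a - gl_fock a).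
Proof.
rewrite even_opE addrAC subrr add0r; apply: kills_sum => t.
exact/killsM/kills_d.
Qed.

Lemma kills_raise b : kills (raise_op b).
Proof.
rewrite raise_opE.
apply: killsD; apply: kills_sum => t; first exact/killsM/kills_d.
by apply: kills_sum => u; apply/killsM/killsM/kills_d.
Qed.

Lemma kills_even_r Z a : kills Z -> kills (Z * even_op a).
Proof.
move=> kZ; have -> : Z * even_op a = Z * (even_op a - gl_fock a) + Z * gl_fock a.
  by rewrite mulrBr subrK.
by apply: killsD; [apply/killsM/kills_even | apply: kills_gl].
Qed.

Lemma kills_even_mul a a' :
  kills (even_op a * even_op a' - gl_fock a * gl_fock a').
Proof.
have -> : even_op a * even_op a' - gl_fock a * gl_fock a' =
    even_op a * (even_op a' - gl_fock a') + (even_op a - gl_fock a) * gl_fock a'.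
  by rewrite mulrBr mulrBl addrA subrK.
by apply: killsD; [apply/killsM/kills_even | apply/kills_gl/kills_even].
Qed.

Lemma kills_exp a k : kills (even_op a ^+ k - gl_fock a ^+ k).
Proof.
elim: k => [|k IHk]; first by rewrite !expr0 subrr; apply: kills0.
have -> : even_op a ^+ k.+1 - gl_fock a ^+ k.+1 =
    even_op a ^+ k * (even_op a - gl_fock a)
    + (even_op a ^+ k - gl_fock a ^+ k) * gl_fock a.
  by rewrite !exprSr mulrBr mulrBl addrA subrK.
by apply: killsD; [apply/killsM/kills_even | apply/kills_gl].
Qed.

Lemma even_op_bracket a a' :
  even_op a * even_op a' - even_op a' * even_op a = even_op (a *m a' - a' *m a).
Proof.
apply/eqP; rewrite -subr_eq0; apply/eqP.
apply: (@odd_vacuum _ _ _ 1) => [c cT|].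
  have cE e e' : even_op e * even_op e' * th c = th c * (even_op e * even_op e')
      + (th (gl_act e' c) * even_op e + th (gl_act e c) * even_op e')
      + th (gl_act e (gl_act e' c)).
    rewrite -mulrA even_op_odd // mulrDr mulrA even_op_odd // mulrDl.
    rewrite even_op_odd ?gl_actT // -!addrA mulrA; congr (_ + _).
    by rewrite addrCA.
  rewrite scale1r mulrBl mulrBl !cE even_op_odd // gl_act_bracket.
  rewrite [th (_ - _)]linearB /=.
  rewrite !mulrBr; move: (th (gl_act a (gl_act a' c))) => w1.
  move: (th (gl_act a' (gl_act a c))) => w2; mx_abel.
have -> : even_op a * even_op a' - even_op a' * even_op a
    - even_op (a *m a' - a' *m a) =
    (even_op a * even_op a' - gl_fock a * gl_fock a')
    - (even_op a' * even_op a - gl_fock a' * gl_fock a)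
    - (even_op (a *m a' - a' *m a) - gl_fock (a *m a' - a' *m a)).
  rewrite -gl_fock_bracket; move: (even_op _) => w.
  mx_abel.
by apply: killsB; [apply: killsB; apply: kills_even_mul | apply: kills_even].
Qed.

Lemma even_raise_bracket a b : b^T = b ->
  even_op a * raise_op b - raise_op b * even_op a = raise_op (a *m b + b *m a^T).
Proof.
move=> bT; apply/eqP; rewrite -subr_eq0; apply/eqP.
apply: (@odd_vacuum _ _ _ (-1)) => [c cT|]; last first.
  apply: killsB; last exact: kills_raise.
  by apply: killsB; [apply/killsM/kills_raise | apply/kills_even_r/kills_raise].
have b'T : (a *m b + b *m a^T)^T = a *m b + b *m a^T.
  by rewrite linearD /= !trmx_mul trmxK bT addrC.
have rE e : e^T = e -> raise_op e * th c = even_op (e *m c) - th c * raise_op e.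
  by move=> eT; rewrite -(raise_op_odd _ two_neq0 eT cT) addrK.
have e1 : even_op a * raise_op b * th c =
    even_op a * even_op (b *m c) - th c * (even_op a * raise_op b)
    - th (gl_act a c) * raise_op b.
  rewrite -mulrA rE // mulrBr [even_op a * (th c * _)]mulrA even_op_odd //.
  by rewrite [(th c * _ + _) * _]mulrDl opprD addrA -[th c * _ * _]mulrA.
have e2 : raise_op b * even_op a * th c =
    even_op (b *m c) * even_op a - th c * (raise_op b * even_op a)
    + even_op (b *m gl_act a c) - th (gl_act a c) * raise_op b.
  rewrite -mulrA even_op_odd // mulrDr [raise_op b * (th c * _)]mulrA rE //.
  rewrite mulrBl -[th c * _ * _]mulrA -[RHS]addrA; congr (_ + _).
  by rewrite -(raise_op_odd _ two_neq0 bT (gl_actT _ cT)) addrK.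
rewrite scaleN1r !mulrBl e1 e2 rE // !mulrBr.
have -> : even_op ((a *m b + b *m a^T) *m c) =
  even_op a * even_op (b *m c) - even_op (b *m c) * even_op a
  - even_op (b *m gl_act a c).
  rewrite even_op_bracket -linearB; congr even_op.
  rewrite /gl_act mulmxN opprK mulmxDr mulmxDl !mulmxA.
  mx_abel.
mx_abel.
Qed.

Lemma raise_bracket b b' : b^T = b -> b'^T = b' ->
  raise_op b * raise_op b' + raise_op b' * raise_op b = 0.
Proof.
move=> bT b'T; apply: (@odd_vacuum _ _ _ 1) => [c cT|]; last first.
  by apply: killsD; apply/killsM/kills_raise.
have rE e : e^T = e -> raise_op e * th c = even_op (e *m c) - th c * raise_op e.
  by move=> eT; rewrite -(raise_op_odd _ two_neq0 eT cT) addrK.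
have e1 e e' : e^T = e -> e'^T = e' -> raise_op e * raise_op e' * th c =
    raise_op e * even_op (e' *m c) - even_op (e *m c) * raise_op e'
    + th c * (raise_op e * raise_op e').
  move=> eT e'T; rewrite -mulrA rE // mulrBr [raise_op e * (th c * _)]mulrA.
  rewrite rE // mulrBl -[th c * _ * _]mulrA; mx_abel.
rewrite scale1r mulrDl !e1 // [th c * (_ + _)]mulrDr addrACA -[RHS]add0r; congr (_ + _).
have -> : raise_op b * even_op (b' *m c) - even_op (b *m c) * raise_op b'
  + (raise_op b' * even_op (b *m c) - even_op (b' *m c) * raise_op b) =
  - (even_op (b' *m c) * raise_op b - raise_op b * even_op (b' *m c))
  - (even_op (b *m c) * raise_op b' - raise_op b' * even_op (b *m c)).
  mx_abel.
rewrite !even_raise_bracket //.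
(* Since c is skew and b, b' are symmetric, exchanging b and b' changes the sign, so the two
   brackets cancel. *)
have -> : b' *m c *m b + b *m (b' *m c)^T = - (b *m c *m b' + b' *m (b *m c)^T).
  rewrite !trmx_mul cT bT b'T !mulNmx !mulmxN !mulmxA; mx_abel.
by rewrite linearN opprK subrr.
Qed.

End PeriplecticRelations.

Section PeriplecticPowers.
Variables (F : fieldType) (n p : nat) (Col : finType).
Hypothesis charFp : p \in [pchar F].

Local Notation X := (skew_pair n + 'I_n * Col)%type.
Local Notation B := 'M[F]_((fock_dim X).+1).
Local Notation c_ := (@fock_c F X).
Local Notation d_ := (@fock_d F X).
Local Notation th := (@odd_creation F n Col).
Local Notation gl_fock := (@gl_fock F n Col).
Local Notation even_op := (@even_op F n Col).
Local Notation raise_op := (@raise_op F n Col).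
Local Notation kills := (@kills F n Col).

Lemma mulrn_pchar (V : lmodType F) (z : V) : z *+ p = 0.
Proof. by rewrite -scaler_nat (pcharf0 charFp) scale0r. Qed.

Lemma gl_fock_vac0 a : gl_fock a *m fock_vec F set0 = 0.
Proof.
rewrite mulmx_suml big1 // => i _; rewrite mulmx_suml big1 // => j _.
rewrite -scalemxAl mulmx_suml big1 ?scaler0 // => k _.
by rewrite -mulmxE -mulmxA fock_dE inE mulmx0.
Qed.

(** On creation operators of a fixed column, the commutator with [gl_fock a] is the action of a on
    F^n, so its p-th iterate is the action of a^p. *)
Lemma gl_fock_pchar (a : 'M[F]_n) : gl_fock a ^+ p = gl_fock (a ^+ p).
Proof.
have p_pr := pcharf_prime charFp.
apply/eqP; rewrite -subr_eq0; apply/eqP.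
apply: (@fock_vacuum _ _ setT 1) => [[t|[j k]] _|S].
- rewrite scale1r mulrBl mulrBr gl_fock_comm_inl; congr (_ - _).
  have cm : GRing.comm (c_ (inl t)) (gl_fock a) by rewrite /GRing.comm gl_fock_comm_inl.
  by rewrite -(commrX p cm).
- pose x (w : 'cV[F]_n) : B := \sum_i w i 0 *: c_ (inr (i, k)).
  have glx e w : gl_fock e * x w = x w * gl_fock e + x (e *m w).
    rewrite mulr_sumr mulr_suml.
    under eq_bigr => i _ do rewrite -scalerAr gl_fock_c scalerDr scalerAl.
    rewrite big_split /=; congr (_ + _).
    under eq_bigr => i _ do rewrite scaler_sumr.
    rewrite exchange_big /=; apply: eq_bigr => i _.
    rewrite mxE scaler_suml; apply: eq_bigr => l _.
    by rewrite scalerA mulrC.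
  have adx m w : iter m (ad (gl_fock a)) (x w) = x (a ^+ m *m w).
    elim: m => [|m IHm]; first by rewrite expr0 mul1mx.
    by rewrite iterS IHm /ad glx addrAC subrr add0r exprS mulmxA.
  have c_x : c_ (inr (j, k)) = x (delta_mx j 0).
    rewrite /x (bigD1 j) //= mxE !eqxx scale1r big1 ?addr0 // => i ij.
    by rewrite mxE (negPf ij) scale0r.
  have := ad_pchar p_pr (@mulrn_pchar _) (gl_fock a) (x (delta_mx j 0)).
  rewrite adx /ad c_x scale1r mulrBl mulrBr glx => ->.
  mx_abel.
move=> S0; have -> : S = set0.
  by apply/setP => x; have /pred0P/(_ x) := S0; rewrite /= !inE andbT.
rewrite mulmxBl gl_fock_vac0 subr0.
by rewrite -(prednK (prime_gt0 p_pr)) exprSr -mulmxE -mulmxA gl_fock_vac0 mulmx0.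
Qed.

Hypothesis p_odd : odd p.

Lemma odd_pchar_two_neq0 : 2%:R != 0 :> F.
Proof.
apply/eqP => two0; have : 2 \in [pchar F] by rewrite inE two0 eqxx.
rewrite (pcharf_eq charFp) inE => /eqP p2.
by move: p_odd; rewrite -p2.
Qed.

(** [gl_act a] is the inner derivation by the block matrix of a, restricted to lower left blocks.
    For odd p the block -a^T is compatible with p-th powers. *)
Lemma gl_act_pchar (a c : 'M[F]_n) : iter p (gl_act a) c = gl_act (a ^+ p) c.
Proof.
have p_pr := pcharf_prime charFp.
pose M (e : 'M[F]_n) : 'M[F]_(n + n) := block_mx e 0 0 (- e^T).
pose N (e : 'M[F]_n) : 'M[F]_(n + n) := block_mx 0 0 e 0.
have adMN e e' : ad (M e) (N e') = N (gl_act e e').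
  rewrite /ad /M /N -!mulmxE !mulmx_block !(mulmx0, mul0mx, addr0, add0r).
  by rewrite opp_block_mx add_block_mx !oppr0 !addr0 mulNmx -opprD.
have MX : M a ^+ p = M (a ^+ p).
  rewrite block_diagX exprNn -signr_odd p_odd expr1 mulN1r; congr block_mx.
  congr (- _); elim: (p) => [|m IHm]; first by rewrite !expr0 trmx1.
  by rewrite exprSr IHm exprS -!mulmxE trmx_mul.
have adX m : iter m (ad (M a)) (N c) = N (iter m (gl_act a) c).
  by elim: m => //= m ->; rewrite adMN.
have p0 (z : 'M[F]_(n + n)) : z *+ p = 0 by apply: mulrn_pchar.
have := ad_pchar p_pr p0 (M a) (N c).
by rewrite adX MX adMN /N => /eq_block_mx[].
Qed.

Lemma even_op_pchar (a : 'M[F]_n) : even_op a ^+ p = even_op (a ^+ p).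
Proof.
have p_pr := pcharf_prime charFp.
have two_neq0 := odd_pchar_two_neq0.
apply/eqP; rewrite -subr_eq0; apply/eqP; apply: (@odd_vacuum _ _ _ 1) => [c cT|].
  have adE m : iter m (ad (even_op a)) (th c) = th (iter m (gl_act a) c)
      /\ (iter m (gl_act a) c)^T = - iter m (gl_act a) c.
    elim: m => [|m [IHm cmT]] //=; rewrite IHm gl_actT //; split=> //.
    by rewrite /ad even_op_odd // addrAC subrr add0r.
  have := ad_pchar p_pr (@mulrn_pchar _) (even_op a) (th c).
  have [-> _] := adE p; rewrite gl_act_pchar /ad scale1r mulrBl mulrBr.
  rewrite [even_op (a ^+ p) * th c]even_op_odd // => ->.
  mx_abel.
have -> : even_op a ^+ p - even_op (a ^+ p) =
    (even_op a ^+ p - gl_fock a ^+ p) - (even_op (a ^+ p) - gl_fock (a ^+ p)).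
  by rewrite gl_fock_pchar opprB addrA subrK.
by apply: killsB; [apply: kills_exp | apply: kills_even].
Qed.

(* A raising operator removes at least one odd mode, so that a product of more
   raising operators than there are odd modes vanishes. *)
Definition kills_below k (Z : B) :=
  forall S : {set X}, (#|S :&: odd_modes n Col| < k)%N -> Z *m fock_vec F S = 0.

Lemma kills_belowD k Z Z' :
  kills_below k Z -> kills_below k Z' -> kills_below k (Z + Z').
Proof. by move=> kZ kZ' S dS; rewrite mulmxDl kZ // kZ' // addr0. Qed.

Lemma kills_below_sum k (I : finType) (G : I -> B) :
  (forall i, kills_below k (G i)) -> kills_below k (\sum_i G i).
Proof.
move=> kG; elim/big_ind: _ => //; first by move=> S _; rewrite mul0mx.
by move=> *; apply: kills_belowD.
Qed.

Lemma kills_belowZ k c Z : kills_below k Z -> kills_below k (c *: Z).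
Proof. by move=> kZ S dS; rewrite -scalemxAl kZ // scaler0. Qed.

Lemma kills_below_d k Z t :
  kills_below k Z -> kills_below k.+1 (Z * d_ (inl t)).
Proof.
move=> kZ S; rewrite ltnS -mulmxE -mulmxA fock_dE => Sk.
case: ifP => tS; last by rewrite mulmx0.
rewrite -scalemxAr kZ ?scaler0 //; apply: leq_trans Sk; apply: proper_card.
rewrite properEneq setSI ?subD1set // andbT; apply/eqP => /setP/(_ (inl t)).
by rewrite !inE eqxx tS.
Qed.

Lemma kills_below_c k Z t :
  kills_below k.+1 Z -> kills_below k (Z * c_ (inl t)).
Proof.
move=> kZ S Sk; rewrite -mulmxE -mulmxA fock_cE.
case: ifP => tS; first by rewrite mulmx0.
rewrite -scalemxAr kZ ?scaler0 // setIUl.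
apply: leq_ltn_trans (leq_card_setU _ _) _.
rewrite (@leq_ltn_trans (1 + #|S :&: odd_modes n Col|)%N) // leq_add2r.
by rewrite -(cards1 (inl t : X)) subset_leq_card // subsetIl.
Qed.

Lemma kills_below_gl k Z a : kills_below k Z -> kills_below k (Z * gl_fock a).
Proof.
move=> kZ; rewrite mulr_sumr; apply: kills_below_sum => i.
rewrite mulr_sumr; apply: kills_below_sum => j.
rewrite -scalerAr; apply: kills_belowZ.
rewrite mulr_sumr; apply: kills_below_sum => l S Sk.
rewrite -!mulmxE -!mulmxA fock_dE; case: ifP => jS; last by rewrite !mulmx0.
rewrite -!scalemxAr fock_cE; case: ifP => iS; first by rewrite mulmx0 scaler0.
rewrite -scalemxAr kZ ?scaler0 //; apply: leq_ltn_trans Sk.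
apply/subset_leq_card/subsetP => -[t|x]; rewrite !inE ?andbF //.
Qed.

Lemma kills_below_raise k Z b :
  kills_below k Z -> kills_below k.+1 (Z * raise_op b).
Proof.
move=> kZ; rewrite raise_opE mulrDr; apply: kills_belowD.
  rewrite mulr_sumr; apply: kills_below_sum => t.
  by rewrite mulrA; apply/kills_below_d/kills_below_gl.
rewrite mulr_sumr; apply: kills_below_sum => t.
rewrite mulr_sumr; apply: kills_below_sum => u; rewrite !mulrA.
(* The quadratic term destroys two odd modes and creates one; for k = 0 the bound that remains is
   vacuous. *)
apply: kills_below_d; case: k kZ => [|k] kZ; first by move=> S.
apply: kills_below_d; rewrite mulr_sumr; apply: kills_below_sum => v.
by rewrite -scalerAr; apply/kills_belowZ/kills_below_c.
Qed.

Lemma card_odd_modes : #|odd_modes n Col| = dim_gm1 n.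
Proof.
have -> : odd_modes n Col = inl @: [set: skew_pair n].
  apply/setP => -[t|x]; rewrite inE; first by rewrite imset_f ?inE.
  by apply/esym/imsetP => -[].
rewrite card_imset; last exact: inl_inj.
rewrite cardsT card_sig /dim_gm1 -bin2 -triangular_sum big_mkord -sum1_card.
rewrite (eq_bigl (fun ij : 'I_n * 'I_n => (ij.1 < ij.2)%N)) => [|ij]; last first.
  by rewrite !inE.
rewrite -(pair_big_dep xpredT (fun i j : 'I_n => (i < j)%N) (fun _ _ => 1%N)) /=.
rewrite (exchange_big_dep xpredT) //=; apply: eq_bigr => j _.
by rewrite (big_ord_narrow (ltnW (ltn_ord j))) sum1_card card_ord.
Qed.

Lemma raise_op_nil (s : seq 'M[F]_n) :
  (#|odd_modes n Col| < size s)%N -> \prod_(b <- s) raise_op b = 0.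
Proof.
move=> ds.
have kb k Z : kills_below k Z ->
    kills_below (size s + k) (Z * \prod_(b <- s) raise_op b).
  elim: s {ds} k Z => [|b s IHs] k Z kZ; first by rewrite big_nil mulr1.
  by rewrite big_cons mulrA /= addSnnS; apply/IHs/kills_below_raise.
apply: fock_ext => S; rewrite mul0mx -[\prod_(b <- s) _]mul1r (kb 0%N) //.
by rewrite addn0; apply: leq_ltn_trans ds; apply/subset_leq_card/subsetIr.
Qed.

End PeriplecticPowers.

(** * Highest weight vectors in the Fock module M *)

Section Bilinear.
Variables (F : fieldType) (X : finType).
Local Notation c_ := (@fock_c F X).
Local Notation d_ := (@fock_d F X).

Lemma fock_d_sqr x : d_ x * d_ x = 0.
Proof.
apply: fock_ext => S; rewrite mul0mx -mulmxE -mulmxA fock_dE.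
case: ifP => xS; last by rewrite mulmx0.
by rewrite -scalemxAr fock_dE setD11 scaler0.
Qed.

Lemma fock_cd_comm x y z w : y != z -> w != x ->
  c_ x * d_ y * (c_ z * d_ w) = c_ z * d_ w * (c_ x * d_ y).
Proof.
move=> yz wx; rewrite -!mulrA ![d_ _ * (c_ _ * _)]mulrA !fock_dc.
rewrite (negPf yz) (negPf wx) !sub0r !mulNr !mulrN -!mulrA fock_dd !mulrA.
by rewrite fock_cc !mulrN !mulNr opprK !mulrA.
Qed.

Lemma fock_cd_sqr x y : x != y -> c_ x * d_ y * (c_ x * d_ y) = 0.
Proof.
move=> xy; rewrite -!mulrA [d_ _ * (c_ _ * _)]mulrA fock_dc eq_sym (negPf xy).
by rewrite sub0r mulNr -mulrA fock_d_sqr !mulr0 oppr0 mulr0.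
Qed.

End Bilinear.

Lemma exprD_sqr0 (R : pzRingType) (g f : R) m : g * f = f * g -> g * g = 0 ->
  (g + f) ^+ m.+1 = f ^+ m.+1 + g * f ^+ m *+ m.+1.
Proof.
move=> gf g2; elim: m => [|m IHm]; first by rewrite !expr1 expr0 mulr1 addrC.
have gg : g * (g * f ^+ m) = 0 by rewrite mulrA g2 mul0r.
have fg : f * (g * f ^+ m) = g * f ^+ m.+1 by rewrite mulrA -gf -mulrA -exprS.
rewrite exprS IHm mulrDr !mulrDl !mulrnAr gg fg mul0rn add0r -exprS addrAC.
by rewrite -mulrS addrC.
Qed.

Section HighestWeight.
Variables (F : fieldType) (n p : nat) (Col : finType).
Variable P : 'I_n -> pred Col.

Local Notation X := (skew_pair n + 'I_n * Col)%type.
Local Notation c_ := (@fock_c F X).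
Local Notation d_ := (@fock_d F X).
Local Notation gl_fock := (@gl_fock F n Col).

Definition hw_set : {set X} :=
  [set x | if x is inr (i, k) then P i k else false].
Local Notation v := (fock_vec F hw_set).

Lemma in_hw_set i k : (inr (i, k) \in hw_set) = P i k.
Proof. by rewrite inE. Qed.

Lemma hw_set_disjoint : [disjoint hw_set & odd_modes n Col].
Proof. by apply/pred0P => -[t|[i k]]; rewrite /= !inE ?andbF. Qed.

(** When the rows are filled from the top, a raising operator can only move a mode to a place that
    is already filled. *)
Lemma gl_fock_upper (a : 'M[F]_n) :
    (forall (i j : 'I_n) k, (i < j)%N -> P j k -> P i k) ->
    (forall i j : 'I_n, (j <= i)%N -> a i j = 0) ->
  gl_fock a *m v = 0.
Proof.
move=> Pdown a0; rewrite mulmx_suml big1 // => i _; rewrite mulmx_suml big1 // => j _.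
have [ji|ij] := leqP j i; first by rewrite a0 // scale0r mul0mx.
rewrite -scalemxAl mulmx_suml big1 ?scaler0 // => k _.
rewrite -mulmxE -mulmxA fock_dE in_hw_set; case: ifP => Pj; last by rewrite mulmx0.
rewrite -scalemxAr fock_cE !inE (Pdown i j) //= andbT ifT ?scaler0 //.
by rewrite (inj_eq inr_inj) xpair_eqE -val_eqE /= (ltn_eqF ij).
Qed.

Lemma gl_fock_delta i j :
  gl_fock (delta_mx i j) = \sum_k c_ (inr (i, k)) * d_ (inr (j, k)).
Proof.
rewrite /gl_fock (bigD1 i) //= (bigD1 j) //= mxE !eqxx scale1r.
rewrite [X in _ + X + _]big1 => [|j' j'j]; last first.
  by rewrite mxE (negPf j'j) andbF scale0r.
rewrite [X in _ + X]big1 ?addr0 // => i' i'i; rewrite big1 // => j' _.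
by rewrite mxE (negPf i'i) scale0r.
Qed.

Lemma gl_fock_weight i : gl_fock (delta_mx i i) *m v = #|P i|%:R *: v.
Proof.
rewrite gl_fock_delta mulmx_suml (bigID (P i)) /= [X in _ + X]big1 => [|k Pk].
  rewrite addr0 -sum1_card natr_sum scaler_suml; apply: eq_bigr => k Pk.
  rewrite -mulmxE -mulmxA fock_dE in_hw_set Pk -scalemxAr fock_cE setD11 scalerA.
  rewrite setD1K ?in_hw_set // scale1r; set s := fock_sign _ _ _; set s' := fock_sign _ _ _.
  have -> : s = s'.
    rewrite /s -{1}[hw_set](@setD1K _ (inr (i, k))) ?in_hw_set //.
    by rewrite fock_signU ?setD11 // ltnn mul1r.
  by rewrite fock_sign_sqr scale1r.
by rewrite -mulmxE -mulmxA fock_dE in_hw_set (negPf Pk) mulmx0.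
Qed.

(* If [g a] moves mode (k, a) to (k1, a) and [O] is the reverse move, then [O]
   kills v and commutes with the other summands, so that
   O (\sum_b g b)^(j+1) v = (j+1) (\sum_(b != a) g b)^j v. *)
Lemma lowering_neq0 (k k1 : 'I_n) j : k != k1 -> p \in [pchar F] -> (j < p)%N ->
    (j <= #|[pred a | P k a && ~~ P k1 a]|)%N ->
  gl_fock (delta_mx k1 k) ^+ j *m v != 0.
Proof.
move=> kk1 charFp jp jA; rewrite gl_fock_delta.
pose g a := c_ (inr (k1, a)) * d_ (inr (k, a)).
(* The induction uses up one column at a time, hence the sum over a variable set A of columns. *)
pose f (A : {set Col}) := \sum_(a in A) g a.
rewrite (_ : \sum_a _ = f setT); last by apply: eq_bigl => a; rewrite inE.
have {}jA : (j <= #|[pred a in [set: Col] | P k a && ~~ P k1 a]|)%N.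
  by apply: leq_trans jA _; rewrite subset_leq_card //; apply/subsetP => a; rewrite !inE.
move: [set: Col] jA => A jA.
have kk1' : k1 != k by rewrite eq_sym.
elim: j A jp jA => [|j IHj] A jp jA; first by rewrite expr0 mul1mx fock_vec_neq0.
have /card_gt0P[a /andP[aA /andP[Pka Pk1a]]] := leq_trans (ltn0Sn j) jA.
pose O := c_ (inr (k, a)) * d_ (inr (k1, a)).
have neq_inr (i i' : 'I_n) b b' : (i != i') || (b != b') ->
    inr (i, b) != inr (i', b') :> X.
  by rewrite (inj_eq inr_inj) xpair_eqE negb_and.
have fA : f A = g a + f (A :\ a).
  rewrite /f (bigD1 a) //=; congr (_ + _); apply: eq_bigl => b.
  by rewrite !inE andbC.
have ga_comm : g a * f (A :\ a) = f (A :\ a) * g a.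
  rewrite mulr_sumr mulr_suml; apply: eq_bigr => b _.
  by apply: fock_cd_comm; apply: neq_inr; rewrite kk1.
have O_comm : GRing.comm O (f (A :\ a)).
  rewrite /GRing.comm mulr_sumr mulr_suml; apply: eq_bigr => b; rewrite !inE => /andP[ba _].
  by apply: fock_cd_comm; apply: neq_inr; rewrite ?ba ?orbT // eq_sym ba orbT.
have d1v : d_ (inr (k1, a)) *m v = 0 by rewrite fock_dE in_hw_set (negPf Pk1a).
have Ov : O *m v = 0 by rewrite /O -mulmxE -mulmxA d1v mulmx0.
have Ogv : O * g a *m v = v.
  rewrite /O /g -mulrA [d_ _ * (c_ _ * _)]mulrA fock_dc eqxx mulrBl mul1r mulrBr mulmxBl.
  rewrite -[c_ _ * d_ (inr (k1, a)) * _]mulrA fock_dd !mulrN mulNmx opprK.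
  rewrite -!mulmxE -!mulmxA d1v !mulmx0 addr0.
  rewrite fock_dE in_hw_set Pka -scalemxAr fock_cE setD11 scalerA setD1K ?in_hw_set //.
  set s := fock_sign _ _ _; set s' := fock_sign _ _ _.
  have -> : s = s'.
    rewrite /s -{1}[hw_set](@setD1K _ (inr (k, a))) ?in_hw_set //.
    by rewrite fock_signU ?setD11 // ltnn mul1r.
  by rewrite fock_sign_sqr scale1r.
apply/eqP => /(congr1 (mulmx O)).
rewrite mulmx0 mulmxA mulmxE fA exprD_sqr0 //; last first.
  by apply: fock_cd_sqr; apply: neq_inr; rewrite kk1'.
rewrite mulrDr mulmxDl (commrX _ O_comm) -{1}mulmxE -mulmxA Ov mulmx0 add0r.
have g_comm : GRing.comm (g a) (f (A :\ a)) by [].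
rewrite mulrnAr (commrX j g_comm) mulrA (commrX j O_comm) -mulrA.
rewrite -scaler_nat -scalemxAl -{1}mulmxE -mulmxA Ogv.
apply/eqP; rewrite scaler_eq0 negb_or -(dvdn_pcharf charFp) gtnNdvd //=.
apply: IHj; first exact: ltnW.
rewrite -ltnS; apply: leq_trans jA _.
rewrite (cardD1 a) inE /= aA Pka Pk1a add1n ltnS.
apply/subset_leq_card/subsetP => b; rewrite !inE.
by case/and3P => -> -> ->.
Qed.

End HighestWeight.

(** * Assembling the representation of p(n) *)

Section GlElements.
Variables (F : fieldType) (n : nat).

Fact gl_elt_proof (a : 'M[F]_n) : block_mx a 0 0 (- a^T) \in @pn_mx F n.
Proof. by apply: pn_mx_block; rewrite ?trmx0 ?oppr0. Qed.

Definition gl_elt (a : 'M[F]_n) : pn F n := Pn (gl_elt_proof a).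

Lemma gl_elt_even a : has_parity false (gl_elt a).
Proof. by rewrite /has_parity /= block_mxKur block_mxKdl. Qed.

Lemma h_eltE i : h_elt F i = gl_elt (delta_mx i i : 'M[F]_n).
Proof. by apply: val_inj; rewrite /= /h_mx trmx_delta. Qed.

Lemma pn_block (x : pn F n) :
  pn_val x = block_mx (ulsubmx x) (ursubmx x) (dlsubmx x) (- (ulsubmx x)^T).
Proof. by case/pn_mxP: (pn_valP x) => <- _ _; rewrite submxK. Qed.

Lemma pn_ur_sym (x : pn F n) : (ursubmx x)^T = ursubmx x.
Proof. by case/pn_mxP: (pn_valP x). Qed.

Lemma pn_dl_skew (x : pn F n) : (dlsubmx x)^T = - dlsubmx x.
Proof. by case/pn_mxP: (pn_valP x). Qed.

End GlElements.

Section FockRep.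
Variables (F : fieldType) (n p : nat) (Col : finType).
Hypothesis charFp : p \in [pchar F].
Hypothesis p_odd : odd p.

Local Notation X := (skew_pair n + 'I_n * Col)%type.
Local Notation B := 'M[F]_((fock_dim X).+1).

Definition fock_rep (x : pn F n) : B :=
  even_op Col (ulsubmx x) + raise_op Col (ursubmx x)
  + odd_creation Col (dlsubmx x).

Lemma fock_rep_superalg : superalg_rep p fock_rep.
Proof.
have two_neq0 := odd_pchar_two_neq0 charFp p_odd.
have E0 : even_op Col 0 = 0 :> B := linear0 _.
have R0 : raise_op Col 0 = 0 :> B := linear0 _.
have ED x y : even_op Col (x + y) = even_op Col x + even_op Col y :> B.
  exact: linearD.
have RN x : raise_op Col (- x) = - raise_op Col x :> B := linearN _ x.
have TN x : odd_creation Col (- x) = - odd_creation Col x :> B := linearN _ x.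
have T0 : odd_creation Col 0 = 0 :> B := linear0 _.
split=> [c x y|s t x y z|x z hx zE].
- have xyE : pn_val (c *: x + y) = c *: pn_val x + pn_val y by [].
  rewrite /fock_rep.
  have -> : ulsubmx (c *: x + y) = c *: ulsubmx x + ulsubmx y.
    by apply/matrixP => i j; rewrite xyE !mxE.
  have -> : ursubmx (c *: x + y) = c *: ursubmx x + ursubmx y.
    by apply/matrixP => i j; rewrite xyE !mxE.
  have -> : dlsubmx (c *: x + y) = c *: dlsubmx x + dlsubmx y.
    by apply/matrixP => i j; rewrite xyE !mxE.
  rewrite !linearP !scalerDr [RHS]addrACA; congr (_ + _).
  by rewrite addrACA.
- move=> hx hy zE.
  have := pn_block z; rewrite {1}zE /supercomm (pn_block x) (pn_block y) {zE}.
  have := pn_ur_sym x; have := pn_ur_sym y.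
  have := pn_dl_skew x; have := pn_dl_skew y.
  rewrite /fock_rep; move: hx hy; rewrite /has_parity.
  move: (ulsubmx z) (ursubmx z) (dlsubmx z) => a'' b'' c''.
  move: (ulsubmx y) (ursubmx y) (dlsubmx y) => a' b' c'.
  move: (ulsubmx x) (ursubmx x) (dlsubmx x) => a b c hx hy c'T cT b'T bT.
  rewrite !mulmx_block scale_block_mx opp_block_mx add_block_mx.
  case/eq_block_mx => aE bE cE _; case: s hx aE bE cE; case: t hy => /= [a0|[b0 c0]].
  + move=> a0'; rewrite {}a0 {}a0' expr1 !scaleN1r !opprK.
    rewrite !(mul0mx, mulmx0, trmx0, oppr0, mulmxN, mulNmx, add0r, addr0, sub0r).
    move=> aE <- <-; rewrite E0 R0 T0 !(add0r, addr0) !mulrDl !mulrDr -aE.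
    rewrite ED -(raise_op_odd Col two_neq0 bT c'T).
    rewrite -(raise_op_odd Col two_neq0 b'T cT).
    rewrite [odd_creation Col c * odd_creation Col c']odd_creation_anti.
    have := raise_bracket Col two_neq0 bT b'T => /eqP; rewrite addr_eq0 => /eqP->.
    mx_abel.
  + move=> a0'; rewrite {}b0 {}c0 {}a0' expr0 !scale1r.
    rewrite !(mul0mx, mulmx0, trmx0, oppr0, mulmxN, mulNmx, add0r, addr0, sub0r).
    move=> <- bE cE; rewrite E0 R0 T0 !(add0r, addr0) !mulrDl !mulrDr.
    have := even_raise_bracket Col two_neq0 a' bT => /eqP.
    rewrite subr_eq => /eqP ->.
    have <- : - (a' *m b + b *m a'^T) = b'' by rewrite -bE opprD addrC.
    have <- : - gl_act a' c = c'' by rewrite -cE /gl_act !opprK addrC.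
    rewrite (RN (a' *m b + b *m a'^T)) (TN (gl_act a' c)).
    rewrite (even_op_odd Col two_neq0 a' cT).
    mx_abel.
  + case=> b0' c0'; rewrite {}a0 {}b0' {}c0' expr0 !scale1r.
    rewrite !(mul0mx, mulmx0, trmx0, oppr0, mulmxN, mulNmx, add0r, addr0, sub0r).
    move=> <- bE cE; rewrite E0 R0 T0 !(add0r, addr0) !mulrDl !mulrDr.
    have := even_raise_bracket Col two_neq0 a b'T => /eqP.
    rewrite subr_eq => /eqP ->.
    have <- : gl_act a c' = c'' by rewrite -cE /gl_act opprD.
    have <- : a *m b' + b' *m a^T = b'' by rewrite -bE opprK.
    rewrite (even_op_odd Col two_neq0 a c'T).
    mx_abel.
  case=> b0' c0'; rewrite {}b0 {}c0 {}b0' {}c0' expr0 !scale1r.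
  rewrite !(mul0mx, mulmx0, trmx0, oppr0, mulmxN, mulNmx, add0r, addr0, sub0r).
  move=> aE <- <-; rewrite R0 T0 !addr0 -aE.
  exact: even_op_bracket.
have [ur0 dl0] := hx.
have := pn_block z; rewrite {1}zE (pn_block x) ur0 dl0 block_diagX.
rewrite /fock_rep => /eq_block_mx[<- <- <- _].
by rewrite ur0 dl0 R0 T0 !addr0 even_op_pchar.
Qed.

Lemma fock_rep_nil (s : seq (pn F n)) :
    {in s, forall x, in_g1 x} -> (dim_gm1 n < size s)%N ->
  \prod_(x <- s) fock_rep x = 0.
Proof.
move=> hs ds; rewrite -(card_odd_modes n Col) in ds.
rewrite (eq_big_seq (fun x : pn F n => raise_op Col (ursubmx x))) => [|x /hs[ul0 dl0]].
  by rewrite -(big_map (fun x : pn F n => ursubmx x) xpredT) raise_op_nil ?size_map.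
by rewrite /fock_rep ul0 dl0 !linear0 add0r addr0.
Qed.

End FockRep.

(** * Nonvanishing of the powers of a lowering operator *)

Section NonVanishing.
Variables (F : fieldType) (n p : nat).
Hypothesis charFp : p \in [pchar F].
Hypothesis p_odd : odd p.

Local Notation iota := (@Defs.iota F n p charFp).

Lemma in_Lambda0_sub (lambda : 'rV[F]_n) i (mu : 'rV[F]_n) j :
  in_Lambda0 lambda -> in_Lambda0 mu ->
  exists2 m : nat, (m < p)%N & m%:R = lambda 0 i - mu 0 j.
Proof.
have p_gt0 := prime_gt0 (pcharf_prime charFp).
move=> /(_ i)[a ->] /(_ j)[b ->].
exists ((a + p.-1 * b) %% p)%N; first by rewrite ltn_mod.
rewrite (GRing.natr_mod_pchar charFp) natrD natrM -subn1 natrB //.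
by rewrite (pcharf0 charFp) sub0r mulN1r.
Qed.

(* The highest weight vector fills, for every l, the modes in rows 0, ..., l of
   m_l columns, where m_l is congruent to lambda_l - lambda_(l+1).  Adding p
   columns of type k does not change the weight and makes e_(k1,k)^j v nonzero
   for all j < p. *)
Lemma lowering_rep (lambda : 'rV[F]_n) (k k1 : 'I_n) j :
    in_Lambda0 lambda -> k1 = k.+1 :> nat -> (j < p)%N ->
  exists N (f : {lrmorphism ubar n charFp -> 'M[F]_N.+1}) (v : 'cV[F]_N.+1),
    [/\ forall x, in_nplus x -> f (iota x) *m v = 0,
        forall i, f (iota (h_elt F i)) *m v = lambda 0 i *: v
      & f (iota (gl_elt (delta_mx k1 k))) ^+ j *m v != 0].
Proof.
move=> lam0 k1k jp; have p_gt0 := prime_gt0 (pcharf_prime charFp).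
(* The default gives [lam n = 0], so that the differences [lam l - lam l.+1] from l = i on add up to
   lambda_i. *)
pose lam i := if insub i is Some i' then lambda 0 i' else 0.
have lamE (i : 'I_n) : lam i = lambda 0 i
  by rewrite /lam insubT //= => ?; congr (lambda _ _); apply: val_inj.
have [m0 m0P] : exists m : {ffun 'I_n -> 'I_p}, forall l : 'I_n,
    (m l)%:R = lam l - lam l.+1.
  have ex (l : 'I_n) : exists m : 'I_p, m%:R == lam (nat_of_ord l) - lam l.+1 :> F.
    rewrite lamE /lam; case: insubP => [l' _ _|_].
      by have [m mp <-] := in_Lambda0_sub l l' lam0 lam0; exists (Ordinal mp).
    have z0 : in_Lambda0 (0 : 'rV[F]_n) by move=> i; exists 0%N; rewrite mxE.
    have [m mp mE] := in_Lambda0_sub l l lam0 z0; exists (Ordinal mp).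
    by rewrite /= mE mxE.
  exists [ffun l => xchoose (ex l)] => l; rewrite ffunE.
  exact/eqP/(xchooseP (ex l)).
pose m l : nat := (m0 l + (l == k) * p)%N.
have mE (l : 'I_n) : (m l)%:R = lam l - lam l.+1.
  by rewrite /m natrD natrM (pcharf0 charFp) mulr0 addr0 m0P.
have m_lt l : (m l <= p + p)%N.
  by apply: leq_add; [exact: ltnW | case: (l == k); rewrite ?mul1n].
pose Col : finType := ('I_n * 'I_(p + p))%type.
pose P (i : 'I_n) : pred Col := fun c => (i <= c.1)%N && (c.2 < m c.1)%N.
have repP := @fock_rep_superalg F n p Col charFp p_odd.
have [f [_ fE]] := ubar_lift_lrmorphism charFp repP (@fock_rep_nil F n Col).
pose v := fock_vec F (hw_set P).
have dS := hw_set_disjoint P.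
have evenE a : even_op Col a *m v = gl_fock Col a *m v.
  by apply/eqP; rewrite -subr_eq0 -mulmxBl (kills_even _ dS).
exists (fock_dim (skew_pair n + 'I_n * Col)%type), f, v; split.
- move=> x [dl0 ul_upper]; rewrite fE /fock_rep dl0 linear0 addr0 mulmxDl.
  rewrite (kills_raise _ dS) addr0 evenE; apply: gl_fock_upper => // i i' c ii'.
  by case/andP => /(leq_trans (ltnW ii')) ic ?; apply/andP.
- move=> i; rewrite fE h_eltE /fock_rep /= block_mxKul block_mxKur block_mxKdl.
  rewrite !linear0 !addr0 evenE gl_fock_weight; congr (_ *: _).
  have -> : #|P i| = (\sum_(l < n | (i <= l)%N) m l)%N.
    rewrite -sum1_card (eq_bigl (fun c : Col => (i <= c.1)%N && (c.2 < m c.1)%N)) //.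
    rewrite -(pair_big_dep (fun l : 'I_n => (i <= l)%N)
       (fun l (q : 'I_(p + p)) => (q < m l)%N) (fun _ _ => 1%N)) /=.
    apply: eq_bigr => l _.
    by rewrite (big_ord_narrow (m_lt l)) sum1_card card_ord.
  rewrite natr_sum (eq_bigr (fun l : 'I_n => lam l - lam l.+1)) => [|l _]; last exact: mE.
  transitivity (\sum_(i <= l < n) (lam l - lam l.+1)).
    by rewrite big_geq_mkord; apply: eq_bigl => l.
  rewrite -[LHS]opprK -sumrN.
  under eq_bigr => l _ do rewrite opprB.
  rewrite telescope_sumr; last exact: ltnW.
  by rewrite lamE opprB /lam insubF ?ltnn // subr0.
rewrite fE /fock_rep /= block_mxKul block_mxKur block_mxKdl !linear0 !addr0.
have -> : even_op Col (delta_mx k1 k) ^+ j *m v = gl_fock Col (delta_mx k1 k) ^+ j *m v.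
  by apply/eqP; rewrite -subr_eq0 -mulmxBl (kills_exp _ _ dS).
have kk1 : k != k1 by rewrite -val_eqE /= k1k neq_ltn ltnSn.
apply: (lowering_neq0 kk1 charFp jp).
(* The columns (k, q) with q < p are filled in row k and empty in row k + 1; j of them are available
   because j < p. *)
pose h (q : 'I_j) : Col := (k, widen_ord (leq_trans (ltnW jp) (leq_addr p p)) q).
have h_inj : injective h by move=> q q' [] /val_inj.
rewrite -[X in (X <= _)%N](card_ord j) -(card_imset _ h_inj).
apply/subset_leq_card/subsetP => _ /imsetP[q _ ->]; rewrite !inE /P /= leqnn /=.
rewrite k1k ltnn /= andbT /m eqxx mul1n; apply: leq_trans (leq_addl _ _).
by rewrite (leq_trans (ltn_ord q)) // ltnW.
Qed.

End NonVanishing.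

(** * Invariants of the unipotent one-parameter groups *)

Lemma free_alg_ind (F : fieldType) (Y : choiceType) (Q : free_alg F Y -> Prop) :
    Q 0 -> (forall c u v, Q u -> Q v -> Q (c *: u + v)) ->
    Q 1 -> (forall x u, Q u -> Q (free_gen F x * u)) ->
  forall u, Q u.
Proof.
move=> Q0 QD Q1 QM.
have QU (k : fmonom Y) : Q (mkmalgU k 1).
  rewrite -[k]fmK; elim: (fmonom_val k) => [|x s IHs].
    by rewrite -fmoneE; apply: Q1.
  have -> : mkmalgU (FMonom (x :: s)) 1 = free_gen F x * mkmalgU (FMonom s) 1.
    rewrite malgM_def /free_gen fgmulUU mulr1; congr mkmalgU.
    by apply/eqP; rewrite fmP fmM fmU.
  exact: QM.
move=> u; rewrite [u]monalgE; elim/big_rec: _ => // k w _ Qw; set c := (X in mkmalgU k X).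
have -> : mkmalgU k c = c *: mkmalgU k 1.
  by apply/malgP => k'; rewrite monalg.mcoeffZ !monalg.mcoeffU mulrnAr mulr1.
exact: QD.
Qed.

(** Adding 1 to a product of linear factors gives a polynomial whose roots avoid the given
    points. *)
Lemma closed_field_distinct (F : closedFieldType) m :
  exists t : seq F, [/\ size t = m, uniq t & 0 \notin t].
Proof.
elim: m => [|m [t [st ut t0]]]; first by exists [::].
have [x xt] : exists x, x \notin 0 :: t.
  pose q := \prod_(a <- 0 :: t) ('X - a%:P) + 1.
  have sq : size q = m.+2.
    rewrite /q size_polyDl size_prod_XsubC ?size_poly1 /= ?st //.
  have /closed_rootP[x /rootP qx] : size q != 1 by rewrite sq.
  exists x; rewrite -root_prod_XsubC; apply/negP => /rootP px.
  by move: qx; rewrite /q hornerD px add0r hornerC => /eqP; rewrite oner_eq0.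
move: xt; rewrite inE negb_or => /andP[x0 xt].
by exists (x :: t); rewrite /= st xt ut inE eq_sym negb_or x0 t0.
Qed.

(** Inverting the Vandermonde matrix at m distinct nonzero points extracts the coefficients. As L is
    any subspace, congruences modulo a left ideal are covered. *)
Lemma separate_powers (F : closedFieldType) (V : lmodType F) (L : V -> Prop) m
    (G : nat -> V) :
    (forall c u v, L u -> L v -> L (c *: u + v)) -> L 0 ->
    (forall t : F, t != 0 -> L (\sum_(i < m) t ^+ i *: G i)) ->
  forall i, (i < m)%N -> L (G i).
Proof.
move=> LD L0 LG i im; have [t [st ut t0]] := closed_field_distinct F m.
pose a : 'rV[F]_m := \row_j t`_j.
have Vu : Vandermonde m a \in unitmx.
  rewrite unitmxE unitfE det_Vandermonde; apply/prodf_neq0 => j _.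
  apply/prodf_neq0 => k jk; rewrite !mxE subr_eq0 nth_uniq ?st //.
  by rewrite neq_ltn jk orbT.
pose c j := invmx (Vandermonde m a) j (Ordinal im).
have -> : G i = \sum_(j < m) c j *: \sum_(k < m) t`_j ^+ k *: G k.
  under eq_bigr => j _ do rewrite scaler_sumr.
  rewrite exchange_big /= (bigD1 (Ordinal im)) //= [X in _ + X]big1 => [|k ki].
    rewrite addr0; under eq_bigr => j _ do rewrite scalerA.
    rewrite -scaler_suml (_ : \sum_j _ = 1) ?scale1r //.
    have /matrixP/(_ (Ordinal im) (Ordinal im)) := mulmxV Vu.
    rewrite !mxE eqxx /= mulr1n => <-; apply: eq_bigr => j _.
    by rewrite !mxE mulrC.
  under eq_bigr => j _ do rewrite scalerA.
  rewrite -scaler_suml (_ : \sum_j _ = 0) ?scale0r //.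
  have /matrixP/(_ k (Ordinal im)) := mulmxV Vu.
  rewrite !mxE (negPf ki) /= mulr0n => e; rewrite -[RHS]e; apply: eq_bigr => j _.
  by rewrite !mxE mulrC.
elim/big_rec: _ => // j w _ Lw; apply: LD => //; apply: LG.
by apply: contraNneq t0 => <-; rewrite mem_nth ?st.
Qed.

(** * Generators of [ubar] and induction on words *)

Section UbarBasics.
Variables (F : fieldType) (n p : nat).
Hypothesis charFp : p \in [pchar F].
Hypothesis two_neq0 : 2%:R != 0 :> F.
Local Notation A := (ubar n charFp).
Local Notation iota := (@Defs.iota F n p charFp).

Fact iota_is_linear : linear iota.
Proof. by case: (iota_superalg_rep n charFp). Qed.
HB.instance Definition _ := GRing.isLinear.Build F (pn F n) A _ iota iota_is_linear.

Lemma iota_bracket s t (x y z : pn F n) : has_parity s x -> has_parity t y ->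
    pn_val z = supercomm s t x y ->
  iota x * iota y = (-1) ^+ (s && t) *: (iota y * iota x) + iota z.
Proof.
case: (iota_superalg_rep n charFp) => _ br _ hx hy hz.
by rewrite -(br _ _ _ _ _ hx hy hz) addrCA subrr addr0.
Qed.

(** The odd parts are parametrized by arbitrary matrices, through m + m^T and m - m^T, to avoid
    symmetry conditions; the price is the factor 1/2 in [pn_decomp]. *)
Fact g1_elt_proof (m : 'M[F]_n) : block_mx 0 (m + m^T) 0 0 \in @pn_mx F n.
Proof.
have {3}-> : (0 : 'M[F]_n) = - 0^T by rewrite trmx0 oppr0.
by apply: pn_mx_block; rewrite ?trmx0 ?oppr0 // linearD /= trmxK addrC.
Qed.
Definition g1_elt m : pn F n := Pn (g1_elt_proof m).

Fact gm1_elt_proof (m : 'M[F]_n) : block_mx 0 0 (m - m^T) 0 \in @pn_mx F n.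
Proof.
have {3}-> : (0 : 'M[F]_n) = - 0^T by rewrite trmx0 oppr0.
by apply: pn_mx_block; rewrite ?trmx0 // linearB /= trmxK opprB.
Qed.
Definition gm1_elt m : pn F n := Pn (gm1_elt_proof m).

Lemma g1_elt_in m : in_g1 (g1_elt m).
Proof. by rewrite /in_g1 /= block_mxKul block_mxKdl. Qed.

Lemma g1_elt_odd m : has_parity true (g1_elt m).
Proof. by rewrite /has_parity /= block_mxKul. Qed.

Lemma gm1_elt_odd m : has_parity true (gm1_elt m).
Proof. by rewrite /has_parity /= block_mxKul. Qed.

Lemma half_twice : 2^-1 + 2^-1 = 1 :> F.
Proof. by rewrite -{1 2}[2^-1]mul1r -mulrDl -(natrD _ 1 1) mulfV. Qed.

Lemma pn_decomp (x : pn F n) : x = gl_elt (ulsubmx x)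
  + (g1_elt (2^-1 *: ursubmx x) + gm1_elt (2^-1 *: dlsubmx x)).
Proof.
apply: val_inj; rewrite /= !add_block_mx [LHS]pn_block !addr0 !add0r.
congr block_mx; rewrite linearZ /= ?pn_ur_sym ?pn_dl_skew ?scalerN ?opprK -scalerDl;
  by rewrite half_twice scale1r.
Qed.

Fact gl_elt_is_linear : linear (@gl_elt F n).
Proof.
move=> c a a'; apply: val_inj; rewrite /= scale_block_mx add_block_mx !scaler0 !addr0.
by rewrite linearP opprD scalerN.
Qed.
HB.instance Definition _ :=
  GRing.isLinear.Build F 'M[F]_n (pn F n) _ (@gl_elt F n) gl_elt_is_linear.

Fact gm1_elt_is_linear : linear gm1_elt.
Proof.
move=> c a a'; apply: val_inj; rewrite /= scale_block_mx add_block_mx !scaler0 !addr0.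
by rewrite linearP scalerBr opprD addrACA.
Qed.
HB.instance Definition _ :=
  GRing.isLinear.Build F 'M[F]_n (pn F n) _ gm1_elt gm1_elt_is_linear.

Lemma gm1_diag i : gm1_elt (delta_mx i i) = 0.
Proof.
apply: val_inj; rewrite /= trmx_delta subrr; apply/matrixP => k l; rewrite !mxE.
by case: splitP => ? _; rewrite !mxE; case: splitP => ? _; rewrite !mxE.
Qed.

Lemma pn_ind (Q : pn F n -> Prop) :
    (forall c x y, Q x -> Q y -> Q (c *: x + y)) -> Q 0 ->
    (forall i j, Q (gl_elt (delta_mx i j))) ->
    (forall x, in_g1 x -> Q x) ->
    (forall i j, i != j -> Q (gm1_elt (delta_mx i j))) ->
  forall x, Q x.
Proof.
move=> QD Q0 Qgl Qg1 Qgm1 x.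
have QD1 y z : Q y -> Q z -> Q (y + z) by rewrite -{2}[y]scale1r; apply: QD.
have QZ c y : Q y -> Q (c *: y) by move=> Qy; rewrite -[c *: y]addr0; apply: QD.
rewrite [x]pn_decomp; apply: (QD1); last apply: (QD1).
- rewrite [ulsubmx _]matrix_sum_delta linear_sum; elim/big_ind: _ => // i _.
  by rewrite linear_sum; elim/big_ind: _ => // j _; rewrite linearZ; apply/QZ/Qgl.
- exact/Qg1/g1_elt_in.
rewrite [_ *: _]matrix_sum_delta linear_sum; elim/big_ind: _ => // i _.
rewrite linear_sum; elim/big_ind: _ => // j _; rewrite linearZ; apply: QZ.
suff: Q (gm1_elt (delta_mx i j)) by [].
have [->|] := eqVneq i j; last exact: Qgm1.
by rewrite gm1_diag.
Qed.

(** The superbracket relations concern homogeneous elements, so the letters are taken homogeneous; a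
    general letter is a sum of three such ones. *)
Lemma ubar_ind (Q : A -> Prop) :
    Q 0 -> (forall c u v, Q u -> Q v -> Q (c *: u + v)) -> Q 1 ->
    (forall s x u, has_parity s x -> Q u -> Q (iota x * u)) ->
  forall u, Q u.
Proof.
move=> Q0 QD Q1 QM.
have QMx x u : Q u -> Q (iota x * u).
  move=> Qu; rewrite [x]pn_decomp linearD mulrDl -[X in X + _]scale1r.
  apply: (QD); first exact: QM (gl_elt_even _) Qu.
  rewrite linearD mulrDl -[X in X + _]scale1r.
  by apply: (QD); [apply: QM (g1_elt_odd _) Qu | apply: QM (gm1_elt_odd _) Qu].
move=> u; have [u1 ->] := to_quot_surj u; have [u2 ->] := to_quot_surj u1.
have [w ->] := to_quot_surj u2; elim/free_alg_ind: w => [|c v w Qv Qw||x w Qw].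
- by rewrite !raddf0.
- by rewrite !linearP; apply: QD.
- by rewrite !rmorph1.
by rewrite !rmorphM; apply: QMx.
Qed.

End UbarBasics.

Lemma horner_quadratic (F : fieldType) (R : algType F) (a b c : R) t :
  (a%:P + (b%:P + c%:P * 'X) * 'X).[t%:A] = a + t *: b + t ^+ 2 *: c.
Proof.
rewrite hornerD hornerMX hornerD hornerMX !hornerC !mulr_algr scalerDr.
by rewrite scalerA -expr2 addrA.
Qed.

(** * Algebras generated by p(n) with a compatible action of GL_n *)

Section GeneratedAlgebra.
Variables (F : closedFieldType) (n : nat).
Hypothesis two_neq0 : 2%:R != 0 :> F.
Variables (A : algType F) (iota : {linear pn F n -> A}).
Variable act : GL F n -> {lrmorphism A -> A}.
Hypothesis iota_bracket : forall s t (x y z : pn F n),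
  has_parity s x -> has_parity t y -> pn_val z = supercomm s t x y ->
  iota x * iota y = (-1) ^+ (s && t) *: (iota y * iota x) + iota z.
Hypothesis iota_ind : forall Q : A -> Prop,
  Q 0 -> (forall c u v, Q u -> Q v -> Q (c *: u + v)) -> Q 1 ->
  (forall s x u, has_parity s x -> Q u -> Q (iota x * u)) -> forall u, Q u.
Hypothesis act_iota : forall a x, act a (iota x) = iota (Ad a x).

Section Unipotent.
Variable E : 'M[F]_n.
Hypothesis E2 : E *m E = 0.

Lemma unipotentV (t : F) : (1%:M + t *: E) *m (1%:M - t *: E) = 1%:M.
Proof.
rewrite mulmxDl mul1mx mulmxBr mulmx1 -scalemxAl -scalemxAr E2 !scaler0 subr0.
by rewrite subrK.
Qed.

Definition unipotent (t : F) : GL F n :=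
  MkGL (proj1 (mulmx1_unit (unipotentV t))).

Lemma invmx_unipotent t : invmx (unipotent t) = 1%:M - t *: E.
Proof.
rewrite -[LHS]mulmx1 -{1}(unipotentV t) mulmxA mulVmx ?mul1mx //.
exact: GL_valP (unipotent t).
Qed.

Local Notation e := (gl_elt E).

Lemma Ad_unipotent x : exists y1 y2 : pn F n,
  pn_val y1 = pn_val e *m pn_val x - pn_val x *m pn_val e
  /\ forall t, Ad (unipotent t) x = x + t *: y1 + t ^+ 2 *: y2.
Proof.
(* The coefficients [e, x] of t and -e x e of t^2 have to be exhibited as elements of g, so they are
   recovered from the values of Ad at 1 and -1. *)
pose y1 := 2^-1 *: (Ad (unipotent 1) x - Ad (unipotent (-1)) x).
exists y1, (Ad (unipotent 1) x - x - y1).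
have eE : GL_diag (unipotent 1) = 1%:M + pn_val e.
  rewrite /GL_diag invmx_unipotent /= !scale1r linearB /= trmx1.
  by rewrite [1%:M in RHS](scalar_mx_block n n) add_block_mx !addr0.
pose D := pn_val e *m pn_val x - pn_val x *m pn_val e.
pose Q := pn_val e *m pn_val x *m pn_val e.
have AdE t : pn_val (Ad (unipotent t) x) = pn_val x + t *: D - t ^+ 2 *: Q.
  have -> : pn_val (Ad (unipotent t) x) = GL_diag (unipotent t) *m pn_val x
      *m invmx (GL_diag (unipotent t)) by [].
  have gE : GL_diag (unipotent t) = 1%:M + t *: pn_val e.
    rewrite /GL_diag invmx_unipotent /= linearB /= trmx1 linearZ /=.
    rewrite [1%:M in RHS](scalar_mx_block n n) scale_block_mx add_block_mx.
    by rewrite !scaler0 !addr0 scalerN.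
  have gV : invmx (GL_diag (unipotent t)) = 1%:M - t *: pn_val e.
    have trZ : (t *: E)^T = t *: E^T by rewrite linearZ.
    rewrite invmx_GL_diag invmx_unipotent /= linearD /= trmx1 trZ.
    rewrite [1%:M in RHS](scalar_mx_block n n) scale_block_mx opp_block_mx.
    by rewrite add_block_mx !scaler0 !oppr0 !addr0 scalerN opprK.
  rewrite gV gE /D /Q; move: (pn_val e) (pn_val x) => w X.
  rewrite mulmxBr mulmx1 mulmxDl mul1mx mulmxDl -!scalemxAl -!scalemxAr.
  rewrite scalerA -expr2 scalerBr opprD addrA.
  by congr (_ - _); rewrite addrA.
have DE : pn_val e *m pn_val x - pn_val x *m pn_val e = D by [].
clearbody D Q; rewrite DE.
have y1E : pn_val y1 = D.
  have -> : pn_val y1 = 2^-1 *: (pn_val (Ad (unipotent 1) x)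
                                - pn_val (Ad (unipotent (-1)) x)) by [].
  rewrite !AdE sqrrN !expr1n !scale1r scaleN1r.
  have -> : pn_val x + D - Q - (pn_val x - D - Q) = D + D.
    by move: (pn_val x) => w; mx_abel.
  by rewrite scalerDr -scalerDl half_twice // scale1r.
split=> // t; apply: val_inj.
have -> : \val (x + t *: y1 + t ^+ 2 *: (Ad (unipotent 1) x - x - y1)) =
  pn_val x + t *: pn_val y1 +
  t ^+ 2 *: (pn_val (Ad (unipotent 1) x) - pn_val x - pn_val y1) by [].
rewrite [\val _]AdE !AdE y1E expr1n !scale1r.
have -> : pn_val x + D - Q - pn_val x - D = - Q.
  by move: (pn_val x) => w; mx_abel.
by rewrite scalerN.
Qed.

(** Both sides are multiplicative in u: scalars are central, so evaluation at t respects products of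
    polynomials over A, and the linear coefficient obeys the Leibniz rule of a commutator. *)
Lemma act_unipotent u : exists P : {poly A},
  [/\ P`_0 = u, P`_1 = iota e * u - u * iota e
    & forall t, act (unipotent t) u = P.[t%:A]].
Proof.
have hC (Q : {poly A}) (t : F) : comm_poly Q (t%:A).
  by rewrite /comm_poly mulr_algl mulr_algr.
have gen s x : has_parity s x -> exists P : {poly A},
    [/\ P`_0 = iota x, P`_1 = iota e * iota x - iota x * iota e
      & forall t, act (unipotent t) (iota x) = P.[t%:A]].
  move=> hx; have [y1 [y2 [y1E AdE]]] := Ad_unipotent x.
  exists ((iota x)%:P + ((iota y1)%:P + (iota y2)%:P * 'X) * 'X); split.
  - by rewrite !(coefD, coefC, coefMX) /= addr0.
  - rewrite !(coefD, coefC, coefMX) /= addr0 add0r.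
    rewrite (iota_bracket (gl_elt_even E) hx (z := y1)).
      by rewrite scale1r addrAC subrr add0r.
    by rewrite /supercomm /= scale1r y1E.
  by move=> t; rewrite act_iota AdE !linearD !linearZ horner_quadratic.
elim/iota_ind: u => // [|c u v [P [P0 P1 PE]] [Q [Q0 Q1 QE]]||s x u hx [P [P0 P1 PE]]].
- exists 0; rewrite !coef0 mulr0 mul0r subrr; split=> // t.
  by rewrite rmorph0 horner0.
- exists ((c%:A)%:P * P + Q); rewrite !coefD !coefCM P0 P1 Q0 Q1 !mulr_algl.
  split=> // [|t]; last by rewrite linearP /= hornerD hornerCM mulr_algl PE QE.
  rewrite mulrDr mulrDl -scalerAl -scalerAr scalerBr opprD.
  by rewrite addrACA.
- exists 1; rewrite !coef1 mulr1 mul1r subrr; split=> // t.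
  by rewrite rmorph1 hornerC.
have [Q [Q0 Q1 QE]] := gen _ _ hx.
exists (Q * P); split.
- by rewrite coef0M Q0 P0.
- rewrite coefM !big_ord_recl big_ord0 /= Q0 P1 Q1 P0 addr0.
  by rewrite mulrBr mulrBl !mulrA addrC subrKA.
by move=> t; rewrite rmorphM /= QE PE hornerM_comm.
Qed.

(* The action of 1 + tE on z is polynomial in t with linear term [e, z]; it is
   constant in t, and F is infinite. *)
Lemma invariant_comm z : (forall a, act a z = z) -> iota e * z = z * iota e.
Proof.
move=> zinv; have [P [P0 P1 PE]] := act_unipotent z.
apply/eqP; rewrite -subr_eq0 -P1.
(* The two extra terms keep the coefficient of index 1 in range even if P is constant. *)
pose m := (size P).+2.
pose G i := P`_i - (i == 0%N)%:R *: z.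
have G1 : G 1%N = 0; last by move: G1; rewrite /G scale0r subr0 => ->.
apply: (@separate_powers F A (fun u => u = 0) m G) => // [c u v -> ->|t t0].
  by rewrite scaler0 addr0.
under eq_bigr => i _ do rewrite scalerBr scalerA.
rewrite sumrB [X in _ - X]big_ord_recl /= expr0 mul1r scale1r.
rewrite [X in _ - (_ + X)]big1 => [|i _]; last by rewrite mulr0 scale0r.
rewrite addr0; apply/eqP; rewrite subr_eq0 -(zinv (unipotent t)) PE; apply/eqP.
rewrite (@horner_coef_wide _ m) ?leqW //; apply: eq_bigr => i _.
by rewrite exprZn expr1n mulr_algr.
Qed.

End Unipotent.
End GeneratedAlgebra.

(** * Left ideals generated by highest weight conditions *)

Lemma subrACA (V : zmodType) (a b c d : V) : a - b - (c - d) = a - c - (b - d).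
Proof. by rewrite !opprD !opprK addrACA. Qed.

Lemma mulmx_delta (R : pzRingType) m n q (a : 'M[R]_(m, n)) k (l : 'I_q) i j :
  (a *m delta_mx k l) i j = a i k *+ (j == l).
Proof.
rewrite mxE (bigD1 k) //= mxE eqxx /= big1 => [|r rk].
  by rewrite addr0 mulr_natr.
by rewrite mxE (negPf rk) mulr0.
Qed.

Lemma delta_mulmx (R : pzRingType) m n q (a : 'M[R]_(m, n)) (k : 'I_q) l i j :
  (delta_mx k l *m a) i j = a l j *+ (i == k).
Proof.
rewrite mxE (bigD1 l) //= mxE eqxx andbT big1 => [|r rl].
  by rewrite addr0 mulr_natl.
by rewrite mxE (negPf rl) andbF mul0r.
Qed.

Section HighestWeightIdeals.
Variables (F : closedFieldType) (n p : nat).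
Hypothesis charFp : p \in [pchar F].
Hypothesis p_odd : odd p.
Variables (A : algType F) (iota : {linear pn F n -> A}).
Variable act : GL F n -> {lrmorphism A -> A}.
Hypothesis iota_bracket : forall s t (x y z : pn F n),
  has_parity s x -> has_parity t y -> pn_val z = supercomm s t x y ->
  iota x * iota y = (-1) ^+ (s && t) *: (iota y * iota x) + iota z.
Hypothesis iota_ind : forall Q : A -> Prop,
  Q 0 -> (forall c u v, Q u -> Q v -> Q (c *: u + v)) -> Q 1 ->
  (forall s x u, has_parity s x -> Q u -> Q (iota x * u)) -> forall u, Q u.
Hypothesis act_iota : forall a x, act a (iota x) = iota (Ad a x).

Record left_ideal (L : A -> Prop) : Prop := LeftIdeal {
  left_ideal0 : L 0;
  left_idealD : forall u v, L u -> L v -> L (u + v);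
  left_idealM : forall a u, L u -> L (a * u) }.

Section LeftIdeal.
Variables (L : A -> Prop) (HL : left_ideal L).

Lemma left_idealZ c u : L u -> L (c *: u).
Proof. by move=> Lu; rewrite -mulr_algl; apply: left_idealM. Qed.

Lemma left_idealN u : L u -> L (- u).
Proof. by move=> Lu; rewrite -scaleN1r; apply: left_idealZ. Qed.

Lemma left_idealB u v : L u -> L v -> L (u - v).
Proof. by move=> Lu /left_idealN; apply: left_idealD. Qed.

Lemma left_ideal_trans u v w : L (u - v) -> L (v - w) -> L (u - w).
Proof.
move=> Luv Lvw; have -> : u - w = (u - v) + (v - w) by rewrite addrA subrK.
exact: left_idealD.
Qed.

End LeftIdeal.

(** L stands for the annihilator of a highest weight vector of weight mu in some module; modules of
    A enter through such ideals only. *)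
Record hw_ideal (mu : 'rV[F]_n) (L : A -> Prop) : Prop := HwIdeal {
  hw_ideal_left :> left_ideal L;
  hw_ideal_nplus : forall x, in_nplus x -> L (iota x);
  hw_ideal_h : forall i, L (iota (h_elt F i) - (mu 0 i)%:A) }.

Lemma hw_ideal_poly mu L (g : {lrmorphism mpoly n F -> A}) q :
    hw_ideal mu L -> (forall i, g 'X_i = iota (h_elt F i)) ->
  L (g q - (q.@[fun i => mu 0 i])%:A).
Proof.
move=> HL gX; elim/mpolyind: q => [|c m q _ _ IHq].
  by rewrite !raddf0 scale0r subr0; apply: (left_ideal0 HL).
rewrite linearP mevalD mevalZ /= scalerDl opprD addrACA.
apply: (left_idealD HL) => //; rewrite -scalerA -scalerBr.
apply: (left_idealZ HL); rewrite mpolyXE_id; elim/big_rec: _.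
  by rewrite meval1 rmorph1 scale1r subrr; apply: (left_ideal0 HL).
move=> i r _ IHr; elim: (m i) => [|l IHl]; first by rewrite expr0 mul1r.
rewrite exprS -mulrA rmorphM mevalM mevalXU /= gX.
set r' := _ ^+ l * r in IHl *.
(* L absorbs factors on the left only, so the inner polynomial is evaluated before the outer h_i. *)
rewrite [_ - _](_ : _ = iota (h_elt F i) * (g r' - (r'.@[fun i => mu 0 i])%:A)
  + r'.@[fun i => mu 0 i] *: (iota (h_elt F i) - (mu 0 i)%:A)); last first.
  rewrite mulrBr mulr_algr scalerBr addrA subrK; congr (_ - _).
  by rewrite scalerA mulrC.
apply: (left_idealD HL); first exact: (left_idealM HL).
exact/(left_idealZ HL)/(hw_ideal_h HL).
Qed.

(** The quotient of A by this left ideal is the Verma module of weight lambda. *)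
Inductive verma_ideal (lambda : 'rV[F]_n) : A -> Prop :=
| VermaIdeal0 : verma_ideal lambda 0
| VermaIdeal_nplus a x u :
    in_nplus x -> verma_ideal lambda u -> verma_ideal lambda (a * iota x + u)
| VermaIdeal_h a i u :
    verma_ideal lambda u ->
    verma_ideal lambda (a * (iota (h_elt F i) - (lambda 0 i)%:A) + u).

Lemma verma_ideal_left lambda : left_ideal (verma_ideal lambda).
Proof.
split=> [|u v Ju Jv|a u]; first exact: VermaIdeal0.
  elim: Ju => [|a x w hx _ IHw|a i w _ IHw]; first by rewrite add0r.
    by rewrite -addrA; apply: VermaIdeal_nplus.
  by rewrite -addrA; apply: VermaIdeal_h.
elim=> [|b x w hx _ IHw|b i w _ IHw]; first by rewrite mulr0; apply: VermaIdeal0.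
  by rewrite mulrDr mulrA; apply: VermaIdeal_nplus.
by rewrite mulrDr mulrA; apply: VermaIdeal_h.
Qed.

Lemma verma_ideal_hw lambda : hw_ideal lambda (verma_ideal lambda).
Proof.
split=> [|x hx|i]; first exact: verma_ideal_left.
  by rewrite -[iota x]mul1r -[_ * _]addr0; apply/VermaIdeal_nplus/VermaIdeal0.
by rewrite -[_ - _]mul1r -[_ * _]addr0; apply/VermaIdeal_h/VermaIdeal0.
Qed.

Lemma verma_ideal_min lambda L u :
  hw_ideal lambda L -> verma_ideal lambda u -> L u.
Proof.
move=> HL; elim=> [|a x w hx _ Lw|a i w _ Lw]; first exact: (left_ideal0 HL).
  by apply: (left_idealD HL) => //; apply/(left_idealM HL)/(hw_ideal_nplus HL).
by apply: (left_idealD HL) => //; apply/(left_idealM HL)/(hw_ideal_h HL).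
Qed.

Lemma gl_bracket a a' : iota (gl_elt a) * iota (gl_elt a') =
  iota (gl_elt a') * iota (gl_elt a) + iota (gl_elt (a *m a' - a' *m a)).
Proof.
rewrite (iota_bracket (gl_elt_even a) (gl_elt_even a')
  (z := gl_elt (a *m a' - a' *m a))) ?scale1r //=.
rewrite /supercomm scale1r !mulmx_block !(mulmx0, mul0mx, addr0, add0r).
rewrite opp_block_mx add_block_mx !oppr0 !addr0; congr block_mx.
by rewrite !mulNmx !mulmxN !opprK linearB /= !trmx_mul opprB.
Qed.

Lemma g1_gl_comm (x : pn F n) a : in_g1 x -> exists2 y, in_g1 y &
  iota x * iota (gl_elt a) = iota (gl_elt a) * iota x + iota y.
Proof.
move=> hx; have x_odd : has_parity true x by case: hx.
pose y := Pn (supercomm_closed x_odd (gl_elt_even a)).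
exists y; last by rewrite (iota_bracket x_odd (gl_elt_even a) (z := y)) ?scale1r.
rewrite /in_g1 /= /supercomm; case: hx => ul0 dl0.
rewrite (pn_block x) ul0 dl0 trmx0 oppr0 !mulmx_block scale_block_mx.
rewrite opp_block_mx add_block_mx block_mxKul block_mxKdl.
by rewrite !(mulmx0, mul0mx, addr0, oppr0, scaler0).
Qed.

Lemma nplus_decomp (x : pn F n) : in_nplus x -> exists2 y, in_g1 y &
  x = gl_elt (ulsubmx x) + y.
Proof.
case=> dl0 _; have two_neq0 := odd_pchar_two_neq0 charFp p_odd.
exists (g1_elt (2^-1 *: ursubmx x)); first exact: g1_elt_in.
by rewrite {1}(pn_decomp two_neq0 x) dl0 scaler0 linear0 addr0.
Qed.

Lemma gl_strict_nplus (a : 'M[F]_n) :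
  (forall i j : 'I_n, (j <= i)%N -> a i j = 0) -> in_nplus (@gl_elt F n a).
Proof. by move=> a0; rewrite /in_nplus /= block_mxKul block_mxKdl. Qed.

Lemma in_g1_nplus (x : pn F n) : in_g1 x -> in_nplus x.
Proof. by case=> ul0 dl0; split=> // i j _; rewrite ul0 mxE. Qed.

Section Lowering.
Variables (lambda : 'rV[F]_n) (k k1 : 'I_n).
Hypothesis k1k : k1 = k.+1 :> nat.
Local Notation J := (verma_ideal lambda).
Local Notation f := (iota (gl_elt (delta_mx k1 k))).
Let HJ := verma_ideal_hw lambda.

Lemma lowering_kk1 : k1 != k.
Proof. by rewrite -val_eqE /= k1k neq_ltn ltnSn orbT. Qed.

Lemma lowering_g1 j x : in_g1 x -> J (iota x * f ^+ j).
Proof.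
elim: j x => [|j IHj] x hx.
  by rewrite mulr1; apply/(hw_ideal_nplus HJ)/in_g1_nplus.
rewrite exprS mulrA; have [y hy ->] := g1_gl_comm (delta_mx k1 k) hx.
rewrite mulrDl -mulrA; apply: (left_idealD HJ); last exact: IHj.
by apply: (left_idealM HJ); apply: IHj.
Qed.

(** These matrices form the nilradical of the minimal parabolic subalgebra containing f, which is
    stable under the bracket with f and contained in n^+. *)
Lemma lowering_strict j (a : 'M[F]_n) :
    (forall i i' : 'I_n, (i' <= i)%N -> a i i' = 0) -> a k k1 = 0 ->
  J (iota (gl_elt a) * f ^+ j).
Proof.
elim: j a => [|j IHj] a a0 akk1.
  by rewrite mulr1; apply/(hw_ideal_nplus HJ)/gl_strict_nplus.
rewrite exprS mulrA gl_bracket mulrDl -mulrA; apply: (left_idealD HJ).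
  by apply: (left_idealM HJ); apply: IHj.
have aE i i' : (a *m delta_mx k1 k - delta_mx k1 k *m a) i i' =
    a i k1 *+ (i' == k) - a k i' *+ (i == k1).
  by rewrite mxE mulmx_delta mxE delta_mulmx.
apply: IHj => [i i' i'i|]; rewrite aE.
  case: (eqVneq i' k) => [i'k|_]; case: (eqVneq i k1) => [ik1|ik1];
    rewrite ?mulr0n ?mulr1n ?subr0 ?sub0r ?subrr //.
  - by rewrite ik1 i'k !a0 ?subrr.
  - have [i_eq|ik] := eqVneq i k; first by rewrite i_eq akk1.
    by rewrite a0 // k1k ltn_neqAle -{2}i'k i'i andbT eq_sym.
  have [->|i'k1] := eqVneq i' k1; first by rewrite akk1 oppr0.
  rewrite a0 ?oppr0 // -ltnS -k1k ltn_neqAle.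
  by rewrite val_eqE i'k1 /= -ik1.
by rewrite (negPf lowering_kk1) eq_sym (negPf lowering_kk1) !mulr0n subr0.
Qed.

(** The coordinates of the simple root epsilon_k - epsilon_k1, whose negative is the weight of f. *)
Definition root_coord (i : 'I_n) : F := (i == k)%:R - (i == k1)%:R.

Lemma h_lowering i : iota (h_elt F i) * f = f * iota (h_elt F i) - root_coord i *: f.
Proof.
rewrite h_eltE gl_bracket; congr (_ + _).
rewrite !mul_delta_mx_cond -scaleNr -linearZ -linearZ; congr (iota (gl_elt _)).
rewrite /root_coord opprB scalerBl; congr (_ - _); rewrite -?scaler_nat //.
  by rewrite eq_sym; case: (eqVneq i k1) => [->|]; rewrite ?scale0r.
by rewrite [k == i]eq_sym; case: (eqVneq i k) => [->|]; rewrite ?scale0r.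
Qed.

Lemma lowering_h j i :
  J ((iota (h_elt F i) - (lambda 0 i - j%:R * root_coord i)%:A) * f ^+ j).
Proof.
elim: j => [|j IHj]; first by rewrite mul0r subr0 mulr1; apply: (hw_ideal_h HJ).
have -> : (iota (h_elt F i) - (lambda 0 i - j.+1%:R * root_coord i)%:A) * f ^+ j.+1
  = f * ((iota (h_elt F i) - (lambda 0 i - j%:R * root_coord i)%:A) * f ^+ j).
  rewrite exprS !mulrA; congr (_ * _).
  rewrite [LHS]mulrBl [RHS]mulrBr h_lowering mulr_algl mulr_algr -addrA -opprD.
  rewrite -scalerDl; congr (_ - _ *: _); rewrite -natr1; move: (root_coord i) => r.
  ring.
exact: (left_idealM HJ).
Qed.

(** The sl_2 identity e f^(j+1) v = (j+1) (m - j) f^j v, where m = lambda(h_k - h_k1). *)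
Lemma lowering_e j :
  J (iota (gl_elt (delta_mx k k1)) * f ^+ j.+1
     - (j.+1%:R * (lambda 0 k - lambda 0 k1 - j%:R)) *: f ^+ j).
Proof.
have ef : iota (gl_elt (delta_mx k k1)) * f = f * iota (gl_elt (delta_mx k k1))
    + (iota (h_elt F k) - iota (h_elt F k1)).
  rewrite gl_bracket; congr (_ + _); rewrite !mul_delta_mx.
  by rewrite !linearB !h_eltE.
elim: j => [|j IHj].
  rewrite expr1 expr0 mul1r subr0 ef -addrA.
  apply: (left_idealD HJ).
    apply: (left_idealM HJ); apply: (hw_ideal_nplus HJ); apply: gl_strict_nplus.
    move=> i i' i'i; rewrite mxE; case: eqP => [ik|] //; case: eqP => [i'k1|] //.
    by move: i'i; rewrite ik i'k1 k1k ltnn.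
  rewrite scalerBl subrACA.
  by apply: (left_idealB HJ); apply: (hw_ideal_h HJ).
have rk : root_coord k = 1.
  by rewrite /root_coord eqxx eq_sym (negPf lowering_kk1) subr0.
have rk1 : root_coord k1 = -1.
  by rewrite /root_coord eqxx (negPf lowering_kk1) sub0r.
set c := (X in X *: f ^+ j) in IHj.
pose muk := lambda 0 k - j.+1%:R; pose muk1 := lambda 0 k1 + j.+1%:R.
have -> : j.+2%:R * (lambda 0 k - lambda 0 k1 - j.+1%:R) = c + (muk - muk1).
  by rewrite /c /muk /muk1 -[j.+2%:R]natr1 -[j.+1%:R]natr1; ring.
rewrite [in X in J (X - _)]exprS mulrA ef mulrDl scalerDl opprD addrACA.
have := lowering_h j.+1 k; have := lowering_h j.+1 k1.
rewrite rk rk1 mulr1 mulrN1 opprK !mulrBl !mulr_algl => J1 Jk.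
rewrite scalerBl subrACA; apply: (left_idealD HJ); last exact: (left_idealB HJ).
have := left_idealM HJ f IHj; rewrite mulrBr -scalerAr -exprS -mulrA.
by [].
Qed.

(** The ideal is the annihilator of f^(m+1) v; the scalar of [lowering_e] vanishes at j = m, so e
    kills this vector. *)
Lemma lowering_hw m : m%:R = lambda 0 k - lambda 0 k1 ->
  hw_ideal (\row_i (lambda 0 i - m.+1%:R * root_coord i))
    (fun u => J (u * f ^+ m.+1)).
Proof.
move=> mE; split.
- split=> [|u v Ju Jv|a u Ju]; first by rewrite mul0r; apply: (left_ideal0 HJ).
    by rewrite mulrDl; apply: (left_idealD HJ).
  by rewrite -mulrA; apply: (left_idealM HJ).
- move=> x hx; have [y hy xE] := nplus_decomp hx.
  case: hx => _ ax; rewrite xE linearD mulrDl.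
  apply: (left_idealD HJ); last exact: lowering_g1.
  move: (ulsubmx x) ax => a ax.
  have -> : a = (a - a k k1 *: delta_mx k k1) + a k k1 *: delta_mx k k1.
    by rewrite subrK.
  rewrite linearD linearD mulrDl; apply: (left_idealD HJ).
    apply: lowering_strict => [i i' i'i|]; rewrite !mxE ?eqxx ?mulr1 ?subrr //.
    rewrite (ax i i' i'i) sub0r; case: (eqVneq i k) => [ik|]; last by rewrite mulr0 oppr0.
    case: (eqVneq i' k1) => [i'k1|]; last by rewrite mulr0 oppr0.
    by move: i'i; rewrite ik i'k1 k1k ltnn.
  rewrite !linearZ -scalerAl; apply: (left_idealZ HJ).
  by have := lowering_e m; rewrite -mE subrr mulr0 scale0r subr0.
by move=> i; rewrite mxE; apply: lowering_h.
Qed.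

End Lowering.

End HighestWeightIdeals.

(** * Separation by torus weights *)

Section Torus.
Variables (F : closedFieldType) (n : nat).

(* The weights are chosen so that for adjacent last indices k, k1 the element
   e_(k1,k) has weight 4 and the element of g_-1 at (k,k1) has weight 6, while
   every root vector of n_0^- + g_-1 has weight at least 4: the difference 2 is
   not the weight of a product of such vectors. *)
Definition torus_weight (i : 'I_n) : nat := (4 * (n - i.+1)).+1.

Definition torus_row (t : F) : 'rV[F]_n := \row_i t ^+ torus_weight i.

Lemma torusV (t : F) : t != 0 ->
  diag_mx (torus_row t^-1) *m diag_mx (torus_row t) = 1%:M.
Proof.
move=> t0; rewrite mulmx_diag -[RHS]diag_const_mx; congr diag_mx.
apply/rowP => i.
by rewrite !mxE exprVn mulVf // expf_neq0.
Qed.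

(** The negative exponents give the vectors of n_0^- and g_-1 positive weights, so that products of
    them transform by nonnegative powers of t. *)
Definition torus (t : F) (t0 : t != 0) : GL F n :=
  MkGL (proj1 (mulmx1_unit (torusV t0))).

Lemma invmx_torus t (t0 : t != 0) : invmx (torus t0) = diag_mx (torus_row t).
Proof.
rewrite -[LHS]mulmx1 -(torusV t0) mulmxA mulVmx ?mul1mx //.
exact: GL_valP (torus t0).
Qed.

Lemma torus_conj t (t0 : t != 0) (m : 'M[F]_n) :
  GL_val (torus t0) *m m *m invmx (torus t0) =
  \matrix_(i, j) (t^-1 ^+ torus_weight i * t ^+ torus_weight j * m i j).
Proof.
rewrite invmx_torus /= mul_diag_mx mul_mx_diag; apply/matrixP => i j.
by rewrite !mxE mulrAC.
Qed.

Lemma torus_conj_dual t (t0 : t != 0) (m : 'M[F]_n) :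
  (invmx (torus t0))^T *m m *m invmx (torus t0) =
  \matrix_(i, j) (t ^+ (torus_weight i + torus_weight j) * m i j).
Proof.
rewrite invmx_torus tr_diag_mx mul_diag_mx mul_mx_diag; apply/matrixP => i j.
by rewrite !mxE exprD mulrAC.
Qed.

Definition has_weight w (x : pn F n) :=
  forall t (t0 : t != 0), Ad (torus t0) x = t ^+ w *: x.

Lemma gl_weight (i j : 'I_n) : (j <= i)%N ->
  has_weight (4 * (i - j)) (gl_elt (delta_mx i j)).
Proof.
move=> ji t t0; rewrite -linearZ; apply: val_inj.
rewrite /= Ad_mx_block block_mxKul block_mxKur block_mxKdl block_mxKdr.
rewrite !mulmx0 !mul0mx.
have -> : (invmx (torus t0))^T *m - (delta_mx i j)^T *m (GL_val (torus t0))^T =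
   - (GL_val (torus t0) *m delta_mx i j *m invmx (torus t0))^T.
  by rewrite !trmx_mul mulmxN mulNmx mulmxA.
suff -> : GL_val (torus t0) *m delta_mx i j *m invmx (torus t0) =
   t ^+ (4 * (i - j)) *: delta_mx i j by [].
rewrite torus_conj; apply/matrixP => k l; rewrite !mxE.
case: (eqVneq k i) => [->|_]; last by rewrite !mulr0.
case: (eqVneq l j) => [->|_] /=; last by rewrite !mulr0.
congr (_ * _); rewrite exprVn.
have -> : torus_weight j = (torus_weight i + 4 * (i - j))%N.
  by rewrite /torus_weight; have := ltn_ord i; lia.
by rewrite exprD mulKf // expf_neq0.
Qed.

Lemma gm1_weight (i j : 'I_n) :
  has_weight (torus_weight i + torus_weight j) (gm1_elt (delta_mx i j)).
Proof.
move=> t t0; rewrite -linearZ; apply: val_inj.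
rewrite /= Ad_mx_block block_mxKul block_mxKur block_mxKdl block_mxKdr.
rewrite !mulmx0 !mul0mx torus_conj_dual; congr block_mx.
have e (k l : 'I_n) :
    t ^+ (torus_weight k + torus_weight l) * ((k == i) && (l == j))%:R =
    t ^+ (torus_weight i + torus_weight j) * ((k == i) && (l == j))%:R.
  case: (eqVneq k i) => [->|_]; last by rewrite !mulr0.
  by case: (eqVneq l j) => [->|_] //; rewrite !mulr0.
apply/matrixP => k l; rewrite !mxE mulrBr; congr (_ - _); first exact: e.
by rewrite addnC; exact: e.
Qed.

Lemma torus_nplus t (t0 : t != 0) x : in_nplus x -> in_nplus (Ad (torus t0) x).
Proof.
rewrite /in_nplus /= Ad_mx_block block_mxKul block_mxKdl => -[-> ax].
rewrite mulmx0 mul0mx; split=> // i j ji.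
by rewrite torus_conj mxE ax // mulr0.
Qed.

Lemma torus_h t (t0 : t != 0) i : Ad (torus t0) (h_elt F i) = h_elt F i.
Proof.
by rewrite h_eltE (gl_weight (leqnn i)) subnn muln0 scale1r.
Qed.

End Torus.

Section Separation.
Variables (F : closedFieldType) (n p : nat).
Hypothesis charFp : p \in [pchar F].
Hypothesis p_odd : odd p.
Variables (A : algType F) (iota : {linear pn F n -> A}).
Variable act : GL F n -> {lrmorphism A -> A}.
Hypothesis iota_bracket : forall s t (x y z : pn F n),
  has_parity s x -> has_parity t y -> pn_val z = supercomm s t x y ->
  iota x * iota y = (-1) ^+ (s && t) *: (iota y * iota x) + iota z.
Hypothesis iota_ind : forall Q : A -> Prop,
  Q 0 -> (forall c u v, Q u -> Q v -> Q (c *: u + v)) -> Q 1 ->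
  (forall s x u, has_parity s x -> Q u -> Q (iota x * u)) -> forall u, Q u.
Hypothesis act_iota : forall a x, act a (iota x) = iota (Ad a x).
Local Notation verma := (verma_ideal iota).

Lemma verma_ideal_torus lambda t (t0 : t != 0) u :
  verma lambda u -> verma lambda (act (torus n t0) u).
Proof.
elim=> [|a x v hx _ IHv|a i v _ IHv]; first by rewrite rmorph0; apply: VermaIdeal0.
  rewrite rmorphD rmorphM /= act_iota; apply: VermaIdeal_nplus => //.
  exact: torus_nplus.
rewrite rmorphD rmorphM rmorphB /= act_iota torus_h linearZ /= rmorph1.
exact: VermaIdeal_h.
Qed.

(** The factors come in any order and with repetitions, as spanning is wanted and not independence.
    Each factor has weight at least 4, so a word is 1 or has weight at least 4. *)
Inductive lowering_word : nat -> A -> Prop :=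
| LoweringWord1 : lowering_word 0 1
| LoweringWordM w0 w s x u :
    (3 < w0)%N -> has_weight w0 x -> has_parity s x -> lowering_word w u ->
    lowering_word (w0 + w) (iota x * u).

Lemma lowering_word_act w u t (t0 : t != 0) :
  lowering_word w u -> act (torus n t0) u = t ^+ w *: u.
Proof.
elim=> [|w0 w' s x v _ wx _ _ IHv]; first by rewrite rmorph1 scale1r.
rewrite rmorphM /= act_iota wx linearZ /= IHv -scalerAl -scalerAr scalerA.
by rewrite exprD.
Qed.

Lemma lowering_word_neq2 w u : lowering_word w u -> w != 2%N.
Proof. by case=> // w0 w' s x v; case: w0 => [|[|[|]]]. Qed.

Section Lambda.
Variable lambda : 'rV[F]_n.
Local Notation J := (verma lambda).
Let HJ := verma_ideal_hw iota lambda.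

Inductive lowering_span : A -> Prop :=
| LoweringSpanJ u : J u -> lowering_span u
| LoweringSpanW c w u v :
    lowering_word w u -> lowering_span v -> lowering_span (c *: u + v).
Local Notation S := lowering_span.

Lemma lowering_spanD u v : S u -> S v -> S (u + v).
Proof.
elim=> [u' Ju|c w u' u'' Wu _ IHu] Sv; last first.
  by rewrite -addrA; apply: LoweringSpanW Wu _; apply: IHu.
elim: Sv => [v' Jv|c w v' v'' Wv _ IHv].
  by apply/LoweringSpanJ/(left_idealD HJ).
by rewrite addrCA; apply: LoweringSpanW Wv _.
Qed.

Lemma lowering_spanZ k u : S u -> S (k *: u).
Proof.
elim=> [v Jv|c w v v' Wv _ IHv]; first by apply/LoweringSpanJ/(left_idealZ HJ).
by rewrite scalerDr scalerA; apply: LoweringSpanW Wv _.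
Qed.

Lemma lowering_spanW w u : lowering_word w u -> S u.
Proof.
move=> Wu; rewrite -[u]scale1r -[_ *: _]addr0; apply: LoweringSpanW Wu _.
exact/LoweringSpanJ/(left_ideal0 HJ).
Qed.

Lemma lowering_span_low w s x u : (3 < w)%N -> has_weight w x ->
  has_parity s x -> S u -> S (iota x * u).
Proof.
move=> w3 wx hx; elim=> [v Jv|c w' v v' Wv _ IHv].
  by apply/LoweringSpanJ/(left_idealM HJ).
rewrite mulrDr -scalerAr; apply: LoweringSpanW IHv.
exact: LoweringWordM w3 wx hx Wv.
Qed.

(** The spanning half of a PBW argument: x is moved past the first letter of the word, and the
    induction hypothesis, stated for every x, covers both the shorter word and the bracket. *)
Lemma lowering_span_mul w u : lowering_word w u -> forall x, S (iota x * u).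
Proof.
have two_neq0 := odd_pchar_two_neq0 charFp p_odd.
have low_gl (i j : 'I_n) : (j < i)%N ->
    (3 < 4 * (i - j))%N /\ has_weight (4 * (i - j)) (gl_elt (delta_mx i j) : pn F n).
  by move=> ji; split; [lia | apply/gl_weight/ltnW].
have low_gm1 (i j : 'I_n) : i != j ->
   (3 < torus_weight i + torus_weight j)%N.
  rewrite -val_eqE /= /torus_weight; have := ltn_ord i; have := ltn_ord j; lia.
elim=> [|w0 w' s y v w03 wy hy Wv IHv] x.
  rewrite mulr1; elim/(@pn_ind F n two_neq0): x => [c x y Sx Sy||i j|x hx|i j ij].
  - by rewrite linearP; apply: lowering_spanD => //; apply: lowering_spanZ.
  - by rewrite linear0; apply/LoweringSpanJ/(left_ideal0 HJ).
  - have [ji|ij|/val_inj->] := ltngtP j i.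
    + have [w3 wx] := low_gl _ _ ji.
      rewrite -[iota _]mulr1; apply: lowering_span_low w3 wx (gl_elt_even _) _.
      exact: lowering_spanW LoweringWord1.
    + apply/LoweringSpanJ/(hw_ideal_nplus HJ)/gl_strict_nplus => k l lk.
      rewrite mxE; case: eqP => // ki; case: eqP => // lj.
      by move: lk; rewrite ki lj leqNgt ij.
    rewrite -h_eltE -[iota _](subrK (lambda 0 i)%:A).
    apply: lowering_spanD; first exact/LoweringSpanJ/(hw_ideal_h HJ).
    exact/lowering_spanZ/(lowering_spanW LoweringWord1).
  - exact/LoweringSpanJ/(hw_ideal_nplus HJ)/in_g1_nplus.
  rewrite -[iota _]mulr1.
  apply: lowering_span_low (low_gm1 _ _ ij) (gm1_weight i j) (gm1_elt_odd _) _.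
  exact: lowering_spanW LoweringWord1.
have spanM t x' : has_parity t x' -> S (iota x' * (iota y * v)).
  move=> hx; pose z := Pn (supercomm_closed hx hy).
  rewrite mulrA (iota_bracket hx hy (z := z)) // mulrDl.
  apply: lowering_spanD; last exact: IHv.
  rewrite -scalerAl -mulrA; apply: lowering_spanZ.
  exact: lowering_span_low w03 wy hy (IHv _).
rewrite [x](pn_decomp two_neq0) !linearD !mulrDl.
apply: lowering_spanD; first exact: spanM (gl_elt_even _).
by apply: lowering_spanD; [apply: spanM (g1_elt_odd _) | apply: spanM (gm1_elt_odd _)].
Qed.

Lemma lowering_span_all u : S u.
Proof.
elim/iota_ind: u => [|c u v Su Sv||s x u _ Su].
- exact/LoweringSpanJ/(left_ideal0 HJ).
- by apply: lowering_spanD => //; apply: lowering_spanZ.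
- exact: lowering_spanW LoweringWord1.
elim: Su => [v Jv|c w v v' Wv _ IHv].
  by apply/LoweringSpanJ/(left_idealM HJ).
rewrite mulrDr -scalerAr; apply: lowering_spanD => //; apply: lowering_spanZ.
exact: lowering_span_mul Wv _.
Qed.

(** Modulo J, u is a combination of words, and each word contributes its weight as an exponent of t;
    no word has weight 2. The bound 2 < N puts the coefficient of t^2 in range. *)
Lemma torus_expansion u : exists N (P : nat -> A), [/\ (2 < N)%N, P 2 = 0 &
  forall t (t0 : t != 0), J (act (torus n t0) u - \sum_(k < N) t ^+ k *: P k)].
Proof.
elim: (lowering_span_all u) => [v Jv|c w v v' Wv _ [N [P [N2 P2 PJ]]]].
  exists 3, (fun=> 0); split=> // t t0; rewrite big1 ?subr0 => [|k _].
    exact: verma_ideal_torus.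
  by rewrite scaler0.
pose P' k := (if (k < N)%N then P k else 0) + (if k == w then c *: v else 0).
exists (maxn N w.+1), P'; split.
- by rewrite leq_max N2.
- by rewrite /P' N2 P2 eq_sym (negPf (lowering_word_neq2 Wv)) addr0.
move=> t t0; have Nm : (N <= maxn N w.+1)%N by apply: leq_maxl.
have wm : (w < maxn N w.+1)%N by apply: leq_maxr.
have -> : \sum_(k < maxn N w.+1) t ^+ k *: P' k =
    \sum_(k < N) t ^+ k *: P k + t ^+ w *: (c *: v).
  under eq_bigr => k _ do rewrite scalerDr.
  rewrite big_split /=; congr (_ + _).
    rewrite (big_ord_widen _ (fun k => t ^+ k *: P k) Nm) [RHS]big_mkcond /=.
    by apply: eq_bigr => k _; case: ifP; rewrite ?scaler0.
  rewrite (bigD1 (Ordinal wm)) //= eqxx big1 ?addr0 // => k kw.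
  by rewrite ifN ?scaler0.
rewrite linearP /= (lowering_word_act t0 Wv) scalerA [c * _]mulrC -scalerA.
by rewrite [\sum_(k < N) _ + _]addrC opprD addrACA subrr add0r.
Qed.

End Lambda.
End Separation.

(** * Relations between the central characters *)

Section CentralCharacter.
Variables (F : closedFieldType) (n p : nat).
Hypothesis charFp : p \in [pchar F].
Hypothesis p_odd : odd p.
Variables (A : algType F) (iota : {linear pn F n -> A}).
Variable act : GL F n -> {lrmorphism A -> A}.
Hypothesis iota_bracket : forall s t (x y z : pn F n),
  has_parity s x -> has_parity t y -> pn_val z = supercomm s t x y ->
  iota x * iota y = (-1) ^+ (s && t) *: (iota y * iota x) + iota z.
Hypothesis iota_ind : forall Q : A -> Prop,
  Q 0 -> (forall c u v, Q u -> Q v -> Q (c *: u + v)) -> Q 1 ->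
  (forall s x u, has_parity s x -> Q u -> Q (iota x * u)) -> forall u, Q u.
Hypothesis act_iota : forall a x, act a (iota x) = iota (Ad a x).
Local Notation verma := (verma_ideal iota).
Hypothesis verma_neq : forall (lambda : 'rV[F]_n) (k k1 : 'I_n) j,
  in_Lambda0 lambda -> k1 = k.+1 :> nat -> (j < p)%N ->
  ~ verma lambda (iota (gl_elt (delta_mx k1 k)) ^+ j).

Variable z : A.
Hypothesis z_inv : forall a, act a z = z.
Hypothesis z_g1 : forall x, in_g1 x -> z * iota x = iota x * z.
Variable phi : 'rV[F]_n -> F.
Hypothesis z_phi : forall mu L, in_Lambda0 mu -> hw_ideal iota mu L ->
  L (z - (phi mu)%:A).

Lemma z_lowering (k k1 : 'I_n) : k1 != k ->
  iota (gl_elt (delta_mx k1 k)) * z = z * iota (gl_elt (delta_mx k1 k)).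
Proof.
move=> kk1; have two_neq0 := odd_pchar_two_neq0 charFp p_odd.
apply: (invariant_comm two_neq0 iota_bracket iota_ind act_iota) => //.
by rewrite mul_delta_mx_cond eq_sym (negPf kk1).
Qed.

Lemma left_ideal_scalar (L : A -> Prop) c u : left_ideal L ->
  L (c *: u) -> ~ L u -> c = 0.
Proof.
move=> HL Lcu Lu; apply/eqP/negPn/negP => c0; apply: Lu.
by rewrite -[u]scale1r -(mulVf c0) -scalerA; apply: (left_idealZ HL).
Qed.

(* f^(m+1) is a highest weight vector of weight [s_k . lambda] in the Verma
   module of weight lambda, and it is nonzero there. *)
Lemma phi_reflection lambda (k k1 : 'I_n) m :
    in_Lambda0 lambda -> k1 = k.+1 :> nat -> (m.+1 < p)%N ->
    m%:R = lambda 0 k - lambda 0 k1 ->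
    in_Lambda0 (\row_i (lambda 0 i - m.+1%:R * root_coord F k k1 i)) ->
  phi (\row_i (lambda 0 i - m.+1%:R * root_coord F k k1 i)) = phi lambda.
Proof.
move=> lam0 k1k mp mE mu0; set mu := \row_i _ in mu0 *.
have HJ := verma_ideal_hw iota lambda.
have Jmu := z_phi mu0 (lowering_hw charFp p_odd iota_bracket k1k mE).
have Jlam := z_phi lam0 HJ.
set f := iota _ in Jmu.
have zf : f ^+ m.+1 * z = z * f ^+ m.+1.
  have cm : GRing.comm z f by rewrite /GRing.comm z_lowering ?(lowering_kk1 k1k).
  by rewrite (commrX m.+1 cm).
(* z is evaluated on f^(m+1) v twice: as on a highest weight vector of weight mu, and through z v
   after commuting z with f. *)
have e : (phi lambda - phi mu) *: f ^+ m.+1 =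
    (z - (phi mu)%:A) * f ^+ m.+1 - f ^+ m.+1 * (z - (phi lambda)%:A).
  rewrite mulrBl mulrBr mulr_algl mulr_algr zf subrACA subrr sub0r opprB.
  by rewrite scalerBl.
have := left_ideal_scalar HJ _ (verma_neq lam0 k1k mp); rewrite -/f.
move=> /(_ (phi lambda - phi mu)); rewrite e => /(_ _)/eqP.
rewrite subr_eq0 eq_sym => h; apply/eqP/h.
by apply: (left_idealB HJ) => //; apply: (left_idealM HJ).
Qed.

Lemma gl_gm1_bracket (a m : 'M[F]_n) :
  iota (gl_elt a) * iota (gm1_elt m) =
  iota (gm1_elt m) * iota (gl_elt a) + iota (gm1_elt (gl_act a m)).
Proof.
rewrite (iota_bracket (gl_elt_even a) (gm1_elt_odd m)
  (z := gm1_elt (gl_act a m))) ?expr0 ?scale1r //.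
rewrite /supercomm /= scale1r !mulmx_block !(mulmx0, mul0mx, addr0, add0r).
rewrite opp_block_mx add_block_mx !oppr0 !addr0 ?add0r; congr block_mx.
have -> : (gl_act a m)^T = gl_act a m^T.
  by rewrite /gl_act [LHS]linearN /= linearD /= !trmx_mul trmxK addrC.
by rewrite -linearB /= /gl_act opprD mulNmx.
Qed.

(* Modulo the left ideal J of the Verma module of weight lambda, y in g_-1 has
   weight mu and is killed by n^+ up to multiples of f, so that
   (z - phi mu) y = r f mod J for some r.  Comparing torus weights removes r f,
   and applying x in g_1 to y yields (z - phi mu) f = 0 mod J. *)
Lemma phi_shift lambda (k k1 : 'I_n) :
    in_Lambda0 lambda -> k1 = k.+1 :> nat -> k1.+1 = n -> lambda 0 k = lambda 0 k1 ->
    in_Lambda0 (\row_i (lambda 0 i - (i == k)%:R - (i == k1)%:R)) ->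
  phi (\row_i (lambda 0 i - (i == k)%:R - (i == k1)%:R)) = phi lambda.
Proof.
move=> lam0 k1k k1n lamk mu0; set mu := \row_i _ in mu0 *.
have two_neq0 := odd_pchar_two_neq0 charFp p_odd.
have p_gt1 := prime_gt1 (pcharf_prime charFp).
have kk1 := lowering_kk1 k1k.
have HJ := verma_ideal_hw iota lambda.
set J := verma lambda in HJ.
pose f := iota (gl_elt (delta_mx k1 k)).
pose y := iota (gm1_elt (delta_mx k k1)).
pose c : 'M[F]_n := delta_mx k k1 - (delta_mx k k1)^T.
have cE : c = delta_mx k k1 - delta_mx k1 k by rewrite /c trmx_delta.
have g1y x : in_g1 x -> iota x * y = - (y * iota x) + iota (gl_elt (ursubmx x *m c)).
  move=> hx; have x_odd : has_parity true x by case: hx.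
  rewrite /y (iota_bracket x_odd (gm1_elt_odd _) (z := gl_elt (ursubmx x *m c))).
    by rewrite expr1 scaleN1r.
  case: hx => ul0 dl0; rewrite /supercomm (pn_block x) ul0 dl0 /= -/c.
  rewrite expr1 scaleN1r opprK !mulmx_block trmx0 oppr0.
  rewrite !(mulmx0, mul0mx, addr0, add0r) add_block_mx !(addr0, add0r).
  congr block_mx; rewrite block_mxKur // trmx_mul pn_ur_sym /c linearB /= trmxK -mulNmx.
  by rewrite opprB.
(* With b the upper right block of x, [x, y] is b c. As k1 is the last index, its entries on and
   below the diagonal give -b_(k,k1) (h_k - h_k1) and -b_(k1,k1) f. The former lies in J because
   lambda agrees on h_k and h_k1. *)
have J_g1 x : in_g1 x -> J (iota x * y - - ursubmx x k1 k1 *: f).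
  move=> hx; rewrite g1y // -addrA; apply: (left_idealD HJ).
    apply: (left_idealN HJ); apply: (left_idealM HJ).
    exact/(hw_ideal_nplus HJ)/in_g1_nplus.
  have bT := pn_ur_sym x; move: (ursubmx x) bT => b bT.
  have bs i j : b i j = b j i by rewrite -{1}bT mxE.
  have mE (i j : 'I_n) : (b *m c) i j = b i k *+ (j == k1) - b i k1 *+ (j == k).
    by rewrite cE mulmxBr mxE mulmx_delta mxE mulmx_delta.
  move: (b *m c) mE => m mE; pose m' := m - (- b k k1 *: (delta_mx k k - delta_mx k1 k1)
     + - b k1 k1 *: delta_mx k1 k).
  have m'_upper (i j : 'I_n) : (j <= i)%N -> m' i j = 0.
    move=> ji; rewrite !mxE mE.
    have [jk1|jk1] := eqVneq j k1.
      have ik1 : i = k1.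
        by apply: val_inj; apply/eqP; rewrite eqn_leq -{2}jk1 ji -ltnS k1n ltn_ord.
      rewrite jk1 ik1 (negPf kk1) eqxx /= bs; ring.
    have [jk|jk] := eqVneq j k; last by rewrite ?andbF /=; ring.
    have [ik|ik] := eqVneq i k.
      by rewrite ik eq_sym (negPf kk1) /=; ring.
    have ik1 : i = k1.
      apply: val_inj; apply/eqP; rewrite eqn_leq -ltnS k1n ltn_ord /= k1k.
      by rewrite ltn_neqAle -{2}jk ji andbT eq_sym.
    by rewrite ik1 eqxx /=; ring.
  have -> : m = m' + (- b k k1 *: (delta_mx k k - delta_mx k1 k1)
     + - b k1 k1 *: delta_mx k1 k) by rewrite subrK.
  have glD (a D : 'M[F]_n) e : iota (gl_elt (a + (D + e *: delta_mx k1 k))) =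
      iota (gl_elt a) + iota (gl_elt D) + e *: f.
    by rewrite !linearD !linearZ addrA.
  rewrite glD addrK.
  apply: (left_idealD HJ); first exact/(hw_ideal_nplus HJ)/gl_strict_nplus.
  have -> : iota (gl_elt (- b k k1 *: (delta_mx k k - delta_mx k1 k1))) =
      - b k k1 *: (iota (h_elt F k) - iota (h_elt F k1)).
    by rewrite !h_eltE -linearB -linearZ -linearB -linearZ.
  apply: (left_idealZ HJ).
  have -> : iota (h_elt F k) - iota (h_elt F k1) =
     (iota (h_elt F k) - (lambda 0 k)%:A) - (iota (h_elt F k1) - (lambda 0 k1)%:A).
    by rewrite subrACA lamk subrr subr0.
  by apply: (left_idealB HJ); apply: (hw_ideal_h HJ).
have J_h i : (iota (h_elt F i) - (mu 0 i)%:A) * y = y * (iota (h_elt F i) - (lambda 0 i)%:A).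
  rewrite h_eltE mulrBl mulrBr gl_gm1_bracket mulr_algl mulr_algr -/y -addrA.
  have -> : gl_act (delta_mx i i : 'M[F]_n) (delta_mx k k1) =
      - ((i == k)%:R + (i == k1)%:R) *: delta_mx k k1.
    rewrite /gl_act trmx_delta !mul_delta_mx_cond scaleNr scalerDl; congr (- (_ + _)).
      by case: eqP => [->|]; rewrite ?scale1r ?scale0r.
    by rewrite eq_sym; case: eqP => [->|]; rewrite ?scale1r ?scale0r.
  have -> e : iota (gm1_elt (e *: delta_mx k k1)) = e *: y by rewrite !linearZ.
  by rewrite -scalerBl -scaleNr mxE; congr (_ + _ *: _); ring.
(* The annihilator of y v in the quotient of the Verma module by the submodule generated by f v. *)
have HJ' : hw_ideal iota mu (fun u => exists r, J (u * y - r * f)).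
  split=> [|x hx|i].
  - split=> [|u v [r Jr] [r' Jr']|a u [r Jr]].
    + by exists 0; rewrite !mul0r subr0; apply: (left_ideal0 HJ).
    + exists (r + r'); rewrite !mulrDl opprD addrACA.
      exact: (left_idealD HJ).
    by exists (a * r); rewrite -!mulrA -mulrBr; apply: (left_idealM HJ).
  - have [x1 x1g xE] := nplus_decomp charFp p_odd hx.
    exists (- ursubmx x1 k1 k1)%:A; rewrite mulr_algl xE linearD mulrDl -addrA.
    apply: (left_idealD HJ); last exact: J_g1.
    case: hx => _; move: (ulsubmx x) => b b_upper.
    have -> : iota (gl_elt b) * y = y * iota (gl_elt b).
      rewrite gl_gm1_bracket.
      have -> : gl_act b (delta_mx k k1) = - b k k1 *: delta_mx k1 k1.
        apply/matrixP => i j; rewrite mxE mxE mulmx_delta delta_mulmx !mxE.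
        rewrite (b_upper k1 j) ?mul0rn ?addr0; last by rewrite -ltnS k1n ltn_ord.
        have [->|ik1] := eqVneq i k1; last first.
          rewrite b_upper ?mul0rn ?oppr0 ?mulr0 // -ltnS -k1k ltn_neqAle ik1.
          by rewrite -ltnS k1n ltn_ord.
        by rewrite ?eqxx /= mulNr mulr_natr.
      by rewrite !linearZ /= gm1_diag linear0 scaler0 addr0.
    by apply: (left_idealM HJ); apply/(hw_ideal_nplus HJ)/gl_strict_nplus.
  exists 0; rewrite mul0r subr0 J_h; apply/(left_idealM HJ)/(hw_ideal_h HJ).
have [r Jr] := z_phi mu0 HJ'.
have lamk0 : 0%:R = lambda 0 k - lambda 0 k1 by rewrite lamk subrr.
have HL := lowering_hw charFp p_odd iota_bracket k1k lamk0.
set nu := \row_i _ in HL.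
(* Since f v is a highest weight vector of weight nu, r f v depends only on r modulo the Verma ideal
   of nu, and r is expanded modulo that ideal. *)
have [N [P [N2 P2 PJ]]] := torus_expansion charFp p_odd iota_bracket iota_ind act_iota nu r.
pose a := (z - (phi mu)%:A) * y.
have Ja : J a.
  (* The torus fixes z and scales y by t^6 and f by t^4, hence t^2 a - (t.r) f lies in J. Its
     coefficient of t^2 is a - P_2 f = a. *)
  pose G i := (if i == 2%N then a else 0) - P i * f.
  have -> : a = G 2%N by rewrite /G P2 mul0r subr0.
  apply: (@separate_powers F A J N G) => // [c0 u v Ju Jv||t t0].
  - by apply: (left_idealD HJ) => //; apply: (left_idealZ HJ).
  - exact: (left_ideal0 HJ).
  have := verma_ideal_torus act_iota t0 Jr.
  have z_inv' : act (torus n t0) (z - (phi mu)%:A) = z - (phi mu)%:A.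
    by rewrite rmorphB /= z_inv linearZ /= rmorph1.
  rewrite rmorphB !rmorphM /= z_inv' !act_iota.
  rewrite (gm1_weight k k1) (gl_weight (ltnW _)) ?k1k //.
  rewrite [iota (t ^+ _ *: gm1_elt _)]linearZ [iota (t ^+ _ *: gl_elt _)]linearZ /=.
  rewrite -/f -/y -!scalerAr -/a => J0.
  have -> : \sum_(i < N) t ^+ i *: G i =
      t ^+ 2 *: a - (\sum_(i < N) t ^+ i *: P i) * f.
    under eq_bigr => i _ do rewrite scalerBr.
    rewrite sumrB mulr_suml; congr (_ - _); last first.
      by apply: eq_bigr => i _; rewrite scalerAl.
    rewrite (bigD1 (Ordinal N2)) //= big1 ?addr0 // => i i2.
    by rewrite ifN ?scaler0.
  have := verma_ideal_min HL (PJ t t0); rewrite expr1 mulrBl => J1.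
  have w4 : (4 * (k.+1 - k) = 4)%N by lia.
  have w6 : (torus_weight k + torus_weight k1 = 4 + 2)%N.
    by rewrite /torus_weight k1k; move: k1n; rewrite k1k; lia.
  move: J0; rewrite w4 w6 exprD -scalerA -scalerBr => /(left_idealZ HJ (t ^+ 4)^-1).
  rewrite scalerA mulVf ?expf_neq0 // scale1r => J0.
  exact: (left_ideal_trans HJ J0 J1).
(* Chosen so that [x, y] = -2 f. *)
pose x := g1_elt (delta_mx k1 k1 : 'M[F]_n).
have xg1 : in_g1 x by apply: g1_elt_in.
have J1 := left_idealM HJ (iota x) Ja.
have J2 := left_idealM HJ (z - (phi mu)%:A) (J_g1 _ xg1).
have xz : iota x * (z - (phi mu)%:A) = (z - (phi mu)%:A) * iota x.
  by rewrite mulrBl mulrBr mulr_algl mulr_algr z_g1.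
have J3 : J ((z - (phi mu)%:A) * f).
  have := left_idealB HJ J1 J2; rewrite /a mulrA xz -mulrA -mulrBr subKr.
  rewrite /x /= block_mxKur !mxE !eqxx /= -mulr2n scaleNr mulrN -scalerAr.
  move/(left_idealN HJ); rewrite opprK => /(left_idealZ HJ 2^-1).
  by rewrite scalerA mulVf // scale1r.
have J4 := left_idealM HJ f (z_phi lam0 HJ).
have := left_ideal_scalar HJ _ (@verma_neq _ _ _ 1 lam0 k1k p_gt1).
rewrite expr1 -/f => /(_ (phi lambda - phi mu)) h.
apply/esym/eqP; rewrite -subr_eq0; apply/eqP/h.
have -> : (phi lambda - phi mu) *: f =
    (z - (phi mu)%:A) * f - f * (z - (phi lambda)%:A).
  rewrite mulrBl mulrBr mulr_algl mulr_algr (z_lowering kk1) subrACA subrr.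
  by rewrite sub0r opprB scalerBl.
exact: (left_idealB HJ).
Qed.

End CentralCharacter.

(** * Interpolation in u(h) *)

Section Interpolation.
Variables (F : fieldType) (n p : nat).
Hypothesis charFp : p \in [pchar F].

Lemma pchar_natX m : m%:R ^+ p = m%:R :> F.
Proof. by rewrite -(pFrobenius_autE charFp) rmorph_nat. Qed.

Lemma pchar_nat_inj (a b : 'I_p) : a%:R = b%:R :> F -> a = b.
Proof.
wlog ab : a b / (a <= b)%N => [H e|].
  by case/orP: (leq_total a b) => ab; [apply: H | apply/esym/H].
move/esym/eqP; rewrite -subr_eq0 -natrB // -(dvdn_pcharf charFp) => pab.
apply: val_inj; apply/eqP; rewrite eqn_leq ab /= -subn_eq0.
by apply: contraTT pab => ba; rewrite gtnNdvd ?lt0n // (leq_ltn_trans (leq_subr _ _)).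
Qed.

(* By Fermat's little theorem this is the indicator of c on the prime field. *)
Definition fermat_poly (c : 'I_p) : {poly F} := 1 - ('X - (c%:R)%:P) ^+ p.-1.

(** The difference of the two sides has degree less than p and vanishes at the p elements of the
    prime field. *)
Lemma fermat_poly_sum : \sum_c fermat_poly c = 1.
Proof.
have p_gt0 := prime_gt0 (pcharf_prime charFp).
have p_gt1 := prime_gt1 (pcharf_prime charFp).
apply/eqP; rewrite -subr_eq0; apply/negPn/negP => S0.
pose rs : seq F := [seq (c : 'I_p)%:R | c <- enum 'I_p].
have urs : uniq rs by rewrite map_inj_uniq ?enum_uniq //; apply: pchar_nat_inj.
have := max_poly_roots S0 _ urs; rewrite size_map size_enum_ord => lt_p.
have /lt_p : all (root (\sum_c fermat_poly c - 1)) rs.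
  apply/allP => _ /mapP[b _ ->]; apply/rootP.
  rewrite hornerD horner_sum hornerN hornerC (bigD1 b) //= big1 => [|c cb].
    have /negPf p1_neq0 : p.-1 != 0%N by rewrite -lt0n -ltnS prednK.
    by rewrite /fermat_poly !hornerE subrr expr0n p1_neq0 subr0 ?addr0 subrr.
  rewrite /fermat_poly !hornerE.
  have bc : b%:R - c%:R != 0 :> F.
    by rewrite subr_eq0; apply: contra cb => /eqP/pchar_nat_inj->.
  have : (b%:R - c%:R) ^+ p = b%:R - c%:R :> F.
    by rewrite -(pFrobenius_autE charFp) rmorphB !rmorph_nat.
  have -> x : x ^+ p = x * x ^+ p.-1 :> F by rewrite -exprS prednK.
  move/(congr1 (fun x => (b%:R - c%:R)^-1 * x)).
  by rewrite mulKf // mulVf // => ->; rewrite subrr.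
rewrite ltnNge => /negP[]; apply: leq_trans (size_polyD _ _) _.
rewrite geq_max size_polyN size_poly1 p_gt0 andbT.
apply: leq_trans (size_sum _ _ _) _; apply/bigmax_leqP => c _.
apply: leq_trans (size_polyD _ _) _; rewrite geq_max size_poly1 p_gt0 /=.
by rewrite size_polyN size_exp_XsubC prednK.
Qed.

Lemma fermat_polyM (c : 'I_p) : ('X - (c%:R)%:P) * fermat_poly c = 'X - 'X^p.
Proof.
have p_gt0 := prime_gt0 (pcharf_prime charFp).
have chP : p \in [pchar {poly F}] by rewrite pchar_poly.
rewrite /fermat_poly mulrBr mulr1 -exprS prednK //.
rewrite -[_ ^+ p](pFrobenius_autE chP) rmorphB /= !pFrobenius_autE.
by rewrite -polyC_exp pchar_natX opprB addrA subrK.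
Qed.

Definition fermat_mpoly (a : {ffun 'I_n -> 'I_p}) : mpoly n F :=
  \prod_i (map_poly (@mpolyC n F) (fermat_poly (a i))).['X_i].

Lemma fermat_mpoly_sum : \sum_a fermat_mpoly a = 1.
Proof.
rewrite /fermat_mpoly.
rewrite -(bigA_distr_bigA (fun i c => (map_poly (@mpolyC n F) (fermat_poly c)).['X_i])).
rewrite big1 // => i _; rewrite -horner_sum -rmorph_sum fermat_poly_sum.
by rewrite rmorph1 hornerC.
Qed.

Lemma fermat_mpolyM (a : {ffun 'I_n -> 'I_p}) i :
  exists r, ('X_i - ((a i)%:R)%:MP) * fermat_mpoly a =
  ('X_i - 'X_i ^+ p) * r.
Proof.
rewrite /fermat_mpoly (bigD1 i) //=.
set h := \prod_(j | _) _; exists h; rewrite mulrA; congr (_ * _).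
have := congr1 (fun q : {poly F} => (map_poly (@mpolyC n F) q).['X_i]) (fermat_polyM (a i)).
rewrite /= rmorphM hornerM !rmorphB /= map_polyX map_polyC map_polyXn.
by rewrite !hornerE.
Qed.

Section Quotient.
Variables (R : algType F) (pi : {lrmorphism mpoly n F -> R}).
Hypothesis pi0 : forall i, pi ('X_i ^+ p - 'X_i) = 0.

(** By [fermat_mpolyM], the image of [fermat_mpoly a] is killed by every X_i - a_i, hence is a
    common eigenvector for multiplication by polynomials. *)
Lemma pi_fermat q (a : {ffun 'I_n -> 'I_p}) :
  pi (q * fermat_mpoly a) = q.@[fun i => (a i)%:R] *: pi (fermat_mpoly a).
Proof.
have piX i : pi ('X_i * fermat_mpoly a) = (a i)%:R *: pi (fermat_mpoly a).
  have [r rE] := fermat_mpolyM a i.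
  have : pi (('X_i - ((a i)%:R)%:MP) * fermat_mpoly a) = 0.
    by rewrite rE rmorphM -[_ - _]opprB rmorphN /= pi0 oppr0 mul0r.
  by rewrite mulrBl rmorphB /= mul_mpolyC linearZ => /eqP; rewrite subr_eq0 => /eqP.
elim/mpolyind: q => [|c m q _ _ IHq].
  by rewrite mul0r !raddf0 scale0r.
rewrite mevalD mevalZ mulrDl -scalerAl linearP /= IHq scalerDl -scalerA.
congr (_ *: _ + _); rewrite mpolyXE_id; elim/big_rec: _.
  by rewrite meval1 mul1r scale1r.
move=> i r _ IHr; elim: (m i) => [|l IHl]; first by rewrite expr0 mul1r.
rewrite exprS -mulrA mevalM mevalXU.
rewrite -mulrA rmorphM /= IHl -scalerAr -rmorphM /= piX scalerA.
by rewrite mulrC.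
Qed.

Lemma pi_interpolation q : pi q =
  \sum_(a : {ffun 'I_n -> 'I_p}) q.@[fun i => (a i)%:R] *: pi (fermat_mpoly a).
Proof.
rewrite -[q in LHS]mulr1 -fermat_mpoly_sum mulr_sumr raddf_sum /=.
by apply: eq_bigr => a _; rewrite pi_fermat.
Qed.

End Quotient.

Lemma meval_fermat (a b : {ffun 'I_n -> 'I_p}) :
  (fermat_mpoly a).@[fun i => (b i)%:R] = (a == b)%:R.
Proof.
have neq0 a' : a' != b -> (fermat_mpoly a').@[fun i => (b i)%:R] = 0.
  move=> ab; have [i abi] : exists i, a' i != b i.
    by apply/existsP; apply: contraNT ab; rewrite negb_exists => /forallP e;
      apply/eqP/ffunP => i; apply/eqP/negPn/e.
  have [r rE] := fermat_mpolyM a' i.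
  have := congr1 (meval (fun i => (b i)%:R)) rE.
  rewrite !mevalM !mevalB rmorphXn /= mevalXU mevalC pchar_natX subrr mul0r.
  move/eqP; rewrite mulf_eq0 subr_eq0 => /orP[/eqP/pchar_nat_inj e|/eqP //].
  by rewrite e eqxx in abi.
have [->|/neq0 //] := eqVneq a b.
have := congr1 (meval (fun i => (b i)%:R)) fermat_mpoly_sum.
rewrite meval1 raddf_sum (bigD1 b) //= big1 ?addr0 // => a' ab.
Qed.

Local Notation uh := (uh n charFp).

Lemma Lambda0_ffun (mu : 'rV[F]_n) : in_Lambda0 mu ->
  exists a : {ffun 'I_n -> 'I_p}, mu = \row_i (a i)%:R.
Proof.
have p_gt0 := prime_gt0 (pcharf_prime charFp).
move=> mu0; have ex i : exists c : 'I_p, mu 0 i == c%:R.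
  have [m mE] := mu0 i; exists (Ordinal (ltn_pmod m p_gt0)).
  by rewrite /= (GRing.natr_mod_pchar charFp) mE.
exists [ffun i => xchoose (ex i)]; apply/rowP => i; rewrite mxE ffunE.
exact/eqP/(xchooseP (ex i)).
Qed.

Lemma row_Lambda0 (a : {ffun 'I_n -> 'I_p}) :
  in_Lambda0 (\row_i (a i)%:R : 'rV[F]_n).
Proof. by move=> i; exists (a i); rewrite mxE. Qed.

Lemma uh_evalM (mu : 'rV[F]_n) (f g : uh) : in_Lambda0 mu ->
  uh_eval mu (f * g) = uh_eval mu f * uh_eval mu g.
Proof.
move=> mu0; have [q ->] := to_quot_surj f; have [r ->] := to_quot_surj g.
by rewrite -rmorphM !uh_evalE // mevalM.
Qed.

Lemma uh_evalP (mu : 'rV[F]_n) c (f g : uh) : in_Lambda0 mu ->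
  uh_eval mu (c *: f + g) = c * uh_eval mu f + uh_eval mu g.
Proof.
move=> mu0; have [q ->] := to_quot_surj f; have [r ->] := to_quot_surj g.
by rewrite -linearP !uh_evalE // mevalD mevalZ.
Qed.

Lemma uh_eval1 (mu : 'rV[F]_n) : in_Lambda0 mu -> uh_eval mu (1 : uh) = 1.
Proof. by move=> mu0; rewrite -[1](rmorph1 (to_quot _)) uh_evalE // meval1. Qed.

Lemma uh_eval0 (mu : 'rV[F]_n) : in_Lambda0 mu -> uh_eval mu (0 : uh) = 0.
Proof. by move=> mu0; rewrite -[0](raddf0 (to_quot _)) uh_evalE // meval0. Qed.

Lemma uh_gen_eval (mu : 'rV[F]_n) i : in_Lambda0 mu -> uh_eval mu (uh_gen charFp i) = mu 0 i.
Proof. by move=> mu0; rewrite uh_evalE // mevalXU. Qed.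

Lemma uh_ext (f g : uh) :
  (forall mu : 'rV[F]_n, in_Lambda0 mu -> uh_eval mu f = uh_eval mu g) -> f = g.
Proof.
have [q ->] := to_quot_surj f; have [r ->] := to_quot_surj g => qr.
have pi0 i : to_quot (ProperGen (@uh_rel_proper F n p charFp)) ('X_i ^+ p - 'X_i) = 0.
  by apply: to_quot_gen0; apply: uh_pow.
rewrite (pi_interpolation pi0 q) [RHS](pi_interpolation pi0 r).
apply: eq_bigr => a _; congr (_ *: _).
have := qr _ (row_Lambda0 a); rewrite !uh_evalE; try exact: row_Lambda0.
by rewrite !(meval_eq (v2 := fun i => (a i)%:R)) // => i; rewrite mxE.
Qed.

Lemma uh_interpolation (G : 'rV[F]_n -> F) :
  exists f : uh, forall mu : 'rV[F]_n, in_Lambda0 mu -> uh_eval mu f = G mu.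
Proof.
exists (to_quot _ (\sum_(a : {ffun 'I_n -> 'I_p}) G (\row_i (a i)%:R) *: fermat_mpoly a)).
move=> mu mu0.
have [a aE] := Lambda0_ffun mu0; rewrite uh_evalE // aE raddf_sum /=.
rewrite (bigD1 a) //= big1 => [|b ba]; rewrite mevalZ.
  rewrite (meval_eq (v2 := fun i => (a i)%:R)) => [|i]; last by rewrite mxE.
  by rewrite meval_fermat eqxx mulr1 addr0.
rewrite (meval_eq (v2 := fun i => (a i)%:R)) => [|i]; last by rewrite mxE.
by rewrite meval_fermat (negPf ba) mulr0.
Qed.

End Interpolation.

(** * The dot action *)

Section DotAction.
Variables (F : fieldType) (n p : nat).
Hypothesis charFp : p \in [pchar F].
Variable rho : 'rV[F]_n.
Hypothesis rho_step : forall i j : 'I_n, j = i.+1 :> nat -> rho 0 i - rho 0 j = 1.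

Definition prime_field (x : F) := exists m : nat, x = m%:R.

Lemma prime_field_nat m : prime_field m%:R.
Proof. by exists m. Qed.

Lemma prime_fieldD x y : prime_field x -> prime_field y -> prime_field (x + y).
Proof. by move=> [a ->] [b ->]; exists (a + b)%N; rewrite natrD. Qed.

Lemma prime_fieldN x : prime_field x -> prime_field (- x).
Proof.
have p_gt0 := prime_gt0 (pcharf_prime charFp).
move=> [a ->]; exists (a * p.-1)%N; rewrite natrM -subn1 natrB //.
by rewrite (pcharf0 charFp) sub0r mulrN1.
Qed.

Lemma prime_fieldB x y : prime_field x -> prime_field y -> prime_field (x - y).
Proof. by move=> hx /prime_fieldN; apply: prime_fieldD. Qed.

(** (p + 1) / 2 is an inverse of 2 modulo p. *)
Lemma prime_field_half x : odd p -> prime_field x -> exists t, x = t%:R * 2%:R.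
Proof.
move=> p_odd [a ->]; exists (a * uphalf p)%N.
by rewrite -natrM -mulnA muln2 odd_uphalfK // mulnS natrD natrM (pcharf0 charFp) mulr0 addr0.
Qed.

Lemma rho_sub (i j : 'I_n) : rho 0 i - rho 0 j = j%:R - i%:R.
Proof.
have le k : forall i j : 'I_n, j = (i + k)%N :> nat -> rho 0 i - rho 0 j = j%:R - i%:R.
  elim: k => [|k IHk] {}i {}j.
    by rewrite addn0 => /val_inj->; rewrite !subrr.
  move=> jE; have i1 : (i.+1 < n)%N.
    by apply: leq_ltn_trans (ltn_ord j); rewrite jE addnS ltnS leq_addr.
  have /= s1 := rho_step (i := i) (j := Ordinal i1) erefl.
  have /= s2 := IHk (Ordinal i1) j ltac:(by rewrite /= jE addnS addSn).
  by rewrite -[LHS](subrKA (rho 0 (Ordinal i1))) s1 s2 -[i.+1]addn1 natrD; ring.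
case/orP: (leq_total i j) => ij; first by apply: (le (j - i)%N); rewrite subnKC.
by apply: oppr_inj; rewrite !opprB; apply: (le (i - j)%N); rewrite subnKC.
Qed.

Lemma dotE w (lambda : 'rV[F]_n) i :
  dot rho w lambda 0 i = lambda 0 (w^-1%g i) + rho 0 (w^-1%g i) - rho 0 i.
Proof. by rewrite !mxE. Qed.

(** Permutations are composed from left to right, so v * w applies v first. *)
Lemma dotM v w (lambda : 'rV[F]_n) :
  dot rho w (dot rho v lambda) = dot rho (v * w)%g lambda.
Proof. by rewrite /dot subrK -col_permM invMg. Qed.

Lemma dot1 (lambda : 'rV[F]_n) : dot rho 1 lambda = lambda.
Proof. by rewrite /dot invg1 col_perm1 addrK. Qed.

Lemma dot_Lambda0 w (lambda : 'rV[F]_n) :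
  in_Lambda0 lambda -> in_Lambda0 (dot rho w lambda).
Proof.
move=> lam0 i; rewrite dotE -addrA rho_sub; apply: prime_fieldD; first exact: lam0.
by apply: prime_fieldB; apply: prime_field_nat.
Qed.

Section DotInvariance.
Variable phi : 'rV[F]_n -> F.
Hypothesis phi_reflection : forall (lambda : 'rV[F]_n) (k k1 : 'I_n) m,
  in_Lambda0 lambda -> k1 = k.+1 :> nat -> (m.+1 < p)%N ->
  m%:R = lambda 0 k - lambda 0 k1 ->
  in_Lambda0 (\row_i (lambda 0 i - m.+1%:R * ((i == k)%:R - (i == k1)%:R))) ->
  phi (\row_i (lambda 0 i - m.+1%:R * ((i == k)%:R - (i == k1)%:R))) = phi lambda.

Let fixes w := forall lambda, in_Lambda0 lambda -> phi (dot rho w lambda) = phi lambda.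

Let fixesM v w : fixes v -> fixes w -> fixes (v * w)%g.
Proof.
move=> fv fw lambda lam0; rewrite -dotM fw ?fv //; exact: dot_Lambda0.
Qed.

Lemma dot_adjacent (lambda : 'rV[F]_n) (k k1 : 'I_n) m : k1 = k.+1 :> nat ->
  m%:R = lambda 0 k - lambda 0 k1 ->
  dot rho (tperm k k1) lambda =
    \row_i (lambda 0 i - m.+1%:R * ((i == k)%:R - (i == k1)%:R)).
Proof.
move=> k1k mE; apply/rowP => i; rewrite dotE tpermV !mxE -natr1 mE.
have rhok := rho_step k1k; have kk1 : k1 != k by rewrite -val_eqE /= k1k neq_ltn leqnn orbT.
have [->|->|ik ik1] := tpermP.
- rewrite eqxx eq_sym (negPf kk1) /= subr0 mulr1 -rhok; ring.
- rewrite eqxx (negPf kk1) /= sub0r mulrN mulr1 -rhok; ring.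
- by rewrite (introF eqP ik) (introF eqP ik1) subrr mulr0 addrK subr0.
Qed.

Let fixes_adjacent (k k1 : 'I_n) : k1 = k.+1 :> nat -> fixes (tperm k k1).
Proof.
move=> k1k lambda lam0.
have [m mp mE] := in_Lambda0_sub charFp k k1 lam0 lam0.
have dE := dot_adjacent k1k mE.
have [m1|] := ltnP m.+1 p.
  by rewrite dE phi_reflection // -dE; apply: dot_Lambda0.
(* The remaining case m + 1 = p: the reflection shifts by a multiple of p and fixes lambda. *)
move=> pm; have m1p : m.+1 = p by apply/eqP; rewrite eqn_leq mp.
congr phi; rewrite dE; apply/rowP => i; rewrite mxE m1p (pcharf0 charFp).
by rewrite mul0r subr0.
Qed.

Let fixes_tperm (i j : 'I_n) : fixes (tperm i j).
Proof.
have le k : forall i j : 'I_n, j = (i + k)%N :> nat -> fixes (tperm i j).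
  elim: k => [|k IHk] {}i {}j.
    by rewrite addn0 => /val_inj-> lambda _; rewrite tperm1 dot1.
  move=> jE; have j1 : (i + k < n)%N by apply: leq_trans (ltn_ord j); rewrite jE addnS.
  have aj : fixes (tperm (Ordinal j1) j) by apply: fixes_adjacent; rewrite jE addnS.
  have [k0|k0] := posnP k.
    by have -> : i = Ordinal j1 by apply: val_inj; rewrite /= k0 addn0.
  (* The transposition (i, j) is the conjugate of the shorter (i, j - 1) by an adjacent one. *)
  have -> : tperm i j = (tperm i (Ordinal j1) ^ tperm (Ordinal j1) j)%g.
    rewrite tpermJ tpermL tpermD //.
      by rewrite -val_eqE /=; lia.
    by rewrite -val_eqE /=; lia.
  rewrite /conjg tpermV; apply: fixesM => //; apply: fixesM => //.
  exact: IHk.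
case/orP: (leq_total i j) => ij; first by apply: (le (j - i)%N); rewrite subnKC.
by rewrite tpermC; apply: (le (i - j)%N); rewrite subnKC.
Qed.

Lemma phi_dot w (lambda : 'rV[F]_n) :
  in_Lambda0 lambda -> phi (dot rho w lambda) = phi lambda.
Proof.
have [ts -> _] := prod_tpermP w; move: lambda; elim: ts => [|t ts IHt].
  by move=> lambda _; rewrite big_nil dot1.
by rewrite big_cons; apply: fixesM => //; apply: fixes_tperm.
Qed.

Hypothesis p_odd : odd p.
Hypothesis phi_shift : forall (lambda : 'rV[F]_n) (k k1 : 'I_n),
  in_Lambda0 lambda -> k1 = k.+1 :> nat -> k1.+1 = n ->
  lambda 0 k = lambda 0 k1 ->
  in_Lambda0 (\row_i (lambda 0 i - (i == k)%:R - (i == k1)%:R)) ->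
  phi (\row_i (lambda 0 i - (i == k)%:R - (i == k1)%:R)) = phi lambda.

Variables i0 i1 : 'I_n.
Hypotheses (i1_i0 : i1 = i0.+1 :> nat) (i1_last : i1.+1 = n).

Let i01 : i0 != i1.
Proof. by rewrite -val_eqE /= i1_i0 neq_ltn leqnn. Qed.

Lemma phi_diagonal t (lambda : 'rV[F]_n) : in_Lambda0 lambda ->
  lambda 0 i0 = lambda 0 i1 ->
  phi (\row_i (lambda 0 i - t%:R * ((i == i0)%:R + (i == i1)%:R))) = phi lambda.
Proof.
move=> lam0 lam01; elim: t => [|t <-].
  by congr phi; apply/rowP => i; rewrite mxE mul0r subr0.
set mu := \row_i (_ - t%:R * _).
have mu0 : in_Lambda0 mu.
  move=> i; rewrite mxE; apply: prime_fieldB; first exact: lam0.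
  by rewrite -natrD -natrM; apply: prime_field_nat.
have muE : \row_i (lambda 0 i - t.+1%:R * ((i == i0)%:R + (i == i1)%:R)) =
    \row_i (mu 0 i - (i == i0)%:R - (i == i1)%:R).
  by apply/rowP => i; rewrite !mxE -natr1; ring.
rewrite muE; apply: phi_shift => //.
  by rewrite !mxE lam01 !eqxx [i1 == i0]eq_sym (negPf i01) [1 + _]addrC.
move=> i; rewrite mxE; do 2![apply: prime_fieldB; last exact: prime_field_nat].
exact: mu0.
Qed.

(* In the shifted coordinates mu = lambda + rho the weight is (x; b+1, b) at
   (k; i0, i1).  Shifting the last two entries gives (x; x-1, x-2), which is
   conjugate to (x-2; x, x-1), and shifting back yields (x-2; b+1, b). *)
Lemma phi_two_coord (lambda : 'rV[F]_n) k : in_Lambda0 lambda ->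
  lambda 0 i0 = lambda 0 i1 -> k != i0 -> k != i1 ->
  phi (\row_i (lambda 0 i - 2%:R * (i == k)%:R)) = phi lambda.
Proof.
move=> lam0 lam01 ki0 ki1.
have [t tE] : prime_field (lambda 0 i1 - lambda 0 k + (rho 0 i1 - rho 0 k) + 1).
  apply: prime_fieldD; last exact: (prime_field_nat 1).
  apply: prime_fieldD; first by apply: prime_fieldB; apply: lam0.
  by rewrite rho_sub; apply: prime_fieldB; apply: prime_field_nat.
set mu := \row_i _; have mu0 : in_Lambda0 mu.
  move=> i; rewrite mxE; apply: prime_fieldB; first exact: lam0.
  by rewrite -natrM; apply: prime_field_nat.
have mu01 : mu 0 i0 = mu 0 i1.
  by rewrite !mxE !(eq_sym _ k) (negPf ki0) (negPf ki1) lam01.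
(* Here t = b - x + 1. Shifting lambda by t + 1 gives (x; x-1, x-2), and shifting mu by t gives
   (x-2; x, x-1), a cyclic permutation of it. *)
rewrite -(phi_diagonal t.+1 lam0 lam01) -(phi_diagonal t mu0 mu01).
set w := (tperm i0 k * tperm i0 i1)%g.
have wk : w k = i1 by rewrite permM tpermR tpermL.
have w0 : w i0 = k by rewrite permM tpermL tpermD // eq_sym.
have w1 : w i1 = i0 by rewrite permM (tpermD i01 ki1) tpermR.
set nu := \row_i (lambda 0 i - _); rewrite -(phi_dot w^-1 (lambda := nu)); last first.
  move=> i; rewrite mxE; apply: prime_fieldB; first exact: lam0.
  by rewrite -natrD -natrM; apply: prime_field_nat.
have rho01 := rho_step i1_i0.
congr phi; apply/rowP => i; rewrite dotE invgK !mxE.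
have [->|ik] := eqVneq i k.
  rewrite wk !(eq_sym _ i0) (negPf i01) eqxx (eq_sym i0 k) (negPf ki0) (negPf ki1).
  by rewrite -[t.+1%:R]natr1 -tE /=; ring.
have [->|i_i0] := eqVneq i i0.
  rewrite w0 (negPf ki0) (negPf ki1) (negPf i01) -tE lam01.
  rewrite -[in RHS](subrK (rho 0 i1) (rho 0 i0)) rho01 /=.
  ring.
have [->|i_i1] := eqVneq i i1.
  rewrite w1 eqxx (negPf i01) lam01 -[t.+1%:R]natr1 -tE.
  rewrite -[in RHS](subrK (rho 0 i1) (rho 0 i0)) rho01 /=.
  ring.
have wi : w i = i by rewrite permM !tpermD 1?eq_sym.
by rewrite wi (negPf i_i0) (negPf i_i1) /= !(addr0, mulr0, subr0) addrK.
Qed.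

(** Steps of length 2 reach the whole prime field because p is odd. *)
Lemma phi_coord (lambda : 'rV[F]_n) k x : in_Lambda0 lambda ->
  lambda 0 i0 = lambda 0 i1 -> k != i0 -> k != i1 -> prime_field x ->
  phi (\row_i (lambda 0 i - x * (i == k)%:R)) = phi lambda.
Proof.
move=> lam0 lam01 ki0 ki1 /(prime_field_half p_odd)[t ->].
elim: t => [|t <-].
  by congr phi; apply/rowP => i; rewrite mxE !mul0r subr0.
set mu := \row_i (_ - t%:R * _ * _).
have mu0 : in_Lambda0 mu.
  move=> i; rewrite mxE; apply: prime_fieldB; first exact: lam0.
  by rewrite -!natrM; apply: prime_field_nat.
have mu01 : mu 0 i0 = mu 0 i1.
  by rewrite !mxE lam01 !(eq_sym _ k) (negPf ki0) (negPf ki1).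
rewrite -(phi_two_coord mu0 mu01 ki0 ki1); congr phi.
by apply/rowP => i; rewrite !mxE -natr1; ring.
Qed.

(** [phi_coord] clears the coordinates other than i0, i1 one at a time, and [phi_diagonal] clears
    the common value of these two. *)
Lemma phi_wall (lambda : 'rV[F]_n) : in_Lambda0 lambda ->
  lambda 0 i0 = lambda 0 i1 -> phi lambda = phi 0.
Proof.
move=> lam0 lam01.
have clear (s : seq 'I_n) : {in s, forall k, (k != i0) && (k != i1)} ->
    phi (\row_i (if i \in s then 0 else lambda 0 i)) = phi lambda.
  elim: s => [|k s IHs] hs; first by congr phi; apply/rowP => i; rewrite mxE.
  have hs' : {in s, forall k, (k != i0) && (k != i1)}.
    by move=> l ls; apply: hs; rewrite inE ls orbT.
  rewrite -IHs //; set mu := \row_i (if i \in s then _ else _).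
  have nis i : ~~ ((i != i0) && (i != i1)) -> (i \in s) = false.
    by move=> h; apply/negP => /hs'; apply/negP.
  have mu0 : in_Lambda0 mu.
    move=> i; rewrite mxE; case: ifP => _; [exact: prime_field_nat 0%N|exact: lam0].
  have mu01 : mu 0 i0 = mu 0 i1 by rewrite !mxE !nis ?eqxx ?andbF.
  have /andP[k0 k1] := hs k (mem_head _ _).
  rewrite -(phi_coord mu0 mu01 k0 k1 (mu0 k)); congr phi.
  apply/rowP => i; rewrite !mxE inE; have [->|ik] := eqVneq i k.
    by rewrite mulr1 subrr.
  by rewrite mulr0 subr0.
pose s := enum [pred i | (i != i0) && (i != i1)].
have inS i : (i \in s) = (i != i0) && (i != i1) by rewrite mem_enum.
rewrite -(clear s) => [|i]; last by rewrite inS.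
set mu := \row_i _.
have mu0 : in_Lambda0 mu.
  by move=> i; rewrite mxE; case: ifP => _; [exists 0%N|exact: lam0].
have mu01 : mu 0 i0 = mu 0 i1 by rewrite !mxE !inS !eqxx andbF.
have [t tE] := lam0 i1; rewrite -(phi_diagonal t mu0 mu01); congr phi.
apply/rowP => i; rewrite !mxE inS -tE.
have [->|i_i0] := eqVneq i i0.
  by rewrite (negPf i01) /= addr0 mulr1 lam01 subrr.
have [->|i_i1] := eqVneq i i1.
  by rewrite /= add0r mulr1 subrr.
by rewrite /= addr0 mulr0 subrr.
Qed.

(** One factor of Theta vanishes at lambda. A permutation moves (i, j) to the last two indices,
    where rho accounts for exactly the difference 1, so the new weight has equal last
    coordinates. *)
Lemma phi_link (lambda : 'rV[F]_n) i j : in_Lambda0 lambda -> i != j ->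
  (lambda + rho) 0 i - (lambda + rho) 0 j = 1 -> phi lambda = phi 0.
Proof.
move=> lam0 ij lamij.
pose w := (tperm i0 i * tperm (tperm i0 i i1) j)%g.
have w0 : w i0 = i.
  rewrite permM tpermL tpermD //; last by rewrite eq_sym.
  by rewrite -{2}(tpermL i0 i) (inj_eq perm_inj) eq_sym.
have w1 : w i1 = j by rewrite permM tpermL.
rewrite -(phi_dot w^-1 lam0); apply: phi_wall; first exact: dot_Lambda0.
rewrite !dotE invgK w0 w1; apply/eqP; rewrite -subr_eq0; apply/eqP.
by rewrite -[X in _ = X](subrr 1) -{1}lamij -(rho_step i1_i0) !mxE; ring.
Qed.

End DotInvariance.
End DotAction.

(** * The central character of an element of Z *)

Section CentralCharacterOfZ.
Variables (F : closedFieldType) (n p : nat).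
Hypothesis charFp : p \in [pchar F].
Hypothesis p_odd : odd p.
Local Notation iota := (@Defs.iota F n p charFp).

Lemma verma_lowering_neq (lambda : 'rV[F]_n) (k k1 : 'I_n) j :
    in_Lambda0 lambda -> k1 = k.+1 :> nat -> (j < p)%N ->
  ~ verma_ideal iota lambda (iota (gl_elt (delta_mx k1 k)) ^+ j).
Proof.
move=> lam0 k1k jp; have [N [f [v [f_n f_h f_e]]]] := lowering_rep charFp p_odd lam0 k1k jp.
have HL : hw_ideal iota lambda (fun u => f u *m v = 0).
  split=> [|x hx|i]; last 2 first.
  - exact: f_n.
  - have fA : f ((lambda 0 i)%:A) = (lambda 0 i)%:A by exact: rmorph_alg.
    have e := etrans (raddfB f (iota (h_elt F i)) _)
      (congr1 (fun u => f (iota (h_elt F i)) - u) fA).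
    apply: etrans (congr1 (mulmx^~ v) e) _.
    by rewrite mulmxBl f_h -scalemxAl mul1mx subrr.
  split=> [|u w fu fw|a u fu]; first by rewrite raddf0 mul0mx.
    by rewrite raddfD mulmxDl fu fw addr0.
  by rewrite rmorphM -mulmxE -mulmxA fu mulmx0.
by move/(verma_ideal_min HL)/eqP; rewrite rmorphXn; apply/negP.
Qed.

(** L contains the left ideal generated by n^+, and modulo L a polynomial in the h_i equals its
    value at mu. *)
Lemma hw_ideal_projection (z : ubar n charFp) f (mu : 'rV[F]_n) L :
    left_ideal_nplus (z - uh_in_ubar f) -> in_Lambda0 mu -> hw_ideal iota mu L ->
  L (z - (uh_eval mu f)%:A).
Proof.
move=> zf mu0 HL; apply: (left_ideal_trans HL (v := uh_in_ubar f)).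
  elim: zf => [|u x w hx _ Lw]; first exact: (left_ideal0 HL).
  by apply: (left_idealD HL) => //; apply/(left_idealM HL)/(hw_ideal_nplus HL).
have [g [<- gX]] := uh_in_ubar_lrmorphism n charFp p_odd.
have [q ->] := to_quot_surj f; rewrite uh_evalE //.
exact: (hw_ideal_poly (g := (g \o to_quot _)%FUN) q HL gX).
Qed.

Variables (z : ubar n charFp) (f : uh n charFp).
Hypotheses (zZ : in_Z z) (zf : left_ideal_nplus (z - uh_in_ubar f)).

Let act a : {lrmorphism ubar n charFp -> ubar n charFp} := sval (act_lrmorphism charFp a).

Let act_iota a x : act a (iota x) = iota (Ad a x).
Proof. exact: (proj2 (svalP (act_lrmorphism charFp a))). Qed.

Let z_inv a : act a z = z.
Proof.
by rewrite (proj1 (svalP (act_lrmorphism charFp a))); have [_ ->] := zZ.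
Qed.

Let z_g1 x : in_g1 x -> z * iota x = iota x * z.
Proof. by have [_ _ zx] := zZ => /zx/eqP; rewrite subr_eq0 => /eqP. Qed.

Lemma uh_eval_reflection (lambda : 'rV[F]_n) (k k1 : 'I_n) m :
    in_Lambda0 lambda -> k1 = k.+1 :> nat -> (m.+1 < p)%N ->
    m%:R = lambda 0 k - lambda 0 k1 ->
    in_Lambda0 (\row_i (lambda 0 i - m.+1%:R * ((i == k)%:R - (i == k1)%:R))) ->
  uh_eval (\row_i (lambda 0 i - m.+1%:R * ((i == k)%:R - (i == k1)%:R))) f =
    uh_eval lambda f.
Proof.
exact: (phi_reflection charFp p_odd (@iota_bracket F n p charFp)
  (@ubar_ind F n p charFp (odd_pchar_two_neq0 charFp p_odd)) act_iota
  verma_lowering_neq z_inv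
  (phi := fun mu => uh_eval mu f) (fun mu L => @hw_ideal_projection z f mu L zf)).
Qed.

Lemma uh_eval_shift (lambda : 'rV[F]_n) (k k1 : 'I_n) :
    in_Lambda0 lambda -> k1 = k.+1 :> nat -> k1.+1 = n ->
    lambda 0 k = lambda 0 k1 ->
    in_Lambda0 (\row_i (lambda 0 i - (i == k)%:R - (i == k1)%:R)) ->
  uh_eval (\row_i (lambda 0 i - (i == k)%:R - (i == k1)%:R)) f = uh_eval lambda f.
Proof.
exact: (phi_shift charFp p_odd (@iota_bracket F n p charFp)
  (@ubar_ind F n p charFp (odd_pchar_two_neq0 charFp p_odd)) act_iota
  verma_lowering_neq z_inv z_g1
  (phi := fun mu => uh_eval mu f) (fun mu L => @hw_ideal_projection z f mu L zf)).
Qed.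

End CentralCharacterOfZ.

(** * Values of Theta and the conclusion *)

Section ThetaValues.
Variables (F : fieldType) (n p : nat).
Hypothesis charFp : p \in [pchar F].
Variable rho : 'rV[F]_n.
Hypothesis rho_step : forall i j : 'I_n, j = i.+1 :> nat -> rho 0 i - rho 0 j = 1.

Definition theta_value (mu : 'rV[F]_n) : F :=
  \prod_i \prod_(j | i != j) ((mu + rho) 0 i - (mu + rho) 0 j - 1).

Lemma uh_eval_Theta (mu : 'rV[F]_n) : in_Lambda0 mu ->
  uh_eval mu (Theta n charFp) = theta_value mu.
Proof.
move=> mu0; rewrite /Theta /theta_value.
have evM := fun f g => @uh_evalM F n p charFp mu f g mu0.
have ev1 := @uh_eval1 F n p charFp mu mu0.
rewrite (big_morph _ evM ev1); apply: eq_bigr => i _.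
rewrite (big_morph _ evM ev1); apply: eq_bigr => j _.
set c := (_ - _ - 1 : F); set gi := uh_gen _ i; set gj := uh_gen _ j.
have -> : gi - gj + c%:A = c *: 1 + ((-1) *: gj + gi).
  by rewrite scaleN1r addrC [gi - gj]addrC.
rewrite !uh_evalP // ev1 !uh_gen_eval // /c -(rho_sub rho_step) !mxE; ring.
Qed.

Lemma theta_value_dot w (mu : 'rV[F]_n) :
  theta_value (dot rho w mu) = theta_value mu.
Proof.
rewrite /theta_value [RHS](reindex_inj (@perm_inj _ w^-1%g)) /=.
apply: eq_bigr => i _; rewrite [RHS](reindex_inj (@perm_inj _ w^-1%g)) /=.
apply: eq_big => [j|j _]; first by rewrite (inj_eq perm_inj).
by rewrite /dot subrK !mxE.
Qed.

End ThetaValues.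

Theorem theorem3p14 (F : closedFieldType) (n p : nat)
    (charFp : p \in [pchar F]) (rho : 'rV[F]_n) :
  (2 <= n)%N ->
  (forall i j : 'I_n, j = i.+1 :> nat -> rho 0 i - rho 0 j = 1) ->
  (3 < p)%N -> (n * (n - 1) < p)%N ->
  forall z : ubar n charFp, in_Z z ->
  exists (f : uh n charFp) (c : F),
    dot_invariant rho f /\ harish_chandra z = Theta n charFp * f + c%:A.
Proof.
move=> n_ge2 rho_step p_gt3 _ z zZ.
have p_odd : odd p.
  by case: (even_prime (pcharf_prime charFp)) => // p2; rewrite p2 in p_gt3.
have [[f0 hf0]|no_f] := boolp.EM (exists f, in_l (z - uh_in_ubar f)); last first.
  (* Here [harish_chandra z] is the default value 0, which has the required form. *)
  exists 0, 0; split=> [w lambda lam0|].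
    by rewrite !uh_eval0 //; apply: (dot_Lambda0 charFp rho_step).
  rewrite mulr0 scale0r addr0; apply: classical_sets.xgetPN => f hf.
  by apply: no_f; exists f.
have [zf _] : in_l (z - uh_in_ubar (harish_chandra z)).
  by apply: (@classical_sets.xgetPex _ 0 (fun f => in_l (z - uh_in_ubar f))); exists f0.
set f := harish_chandra z in zf *.
have refl := uh_eval_reflection p_odd zZ zf.
have shift := uh_eval_shift p_odd zZ zf.
have i1n : (n.-1 < n)%N by rewrite ltn_predL ltnW.
have i0n : (n.-2 < n)%N by apply: leq_ltn_trans i1n; apply: leq_pred.
pose i0 := Ordinal i0n; pose i1 := Ordinal i1n.
have i1_i0 : i1 = i0.+1 :> nat by rewrite /=; lia.
have i1_last : i1.+1 = n by rewrite /=; lia.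
have inv := phi_dot charFp rho_step refl.
have link := phi_link charFp rho_step refl p_odd shift i1_i0 i1_last.
(* The weight 0 has equal last coordinates, so it is a zero of Theta and c is the value of phi on
   all of them. *)
set c := uh_eval 0 f; pose T := theta_value rho.
(* On the zeros of Theta the product with Theta ignores the value of G; the constant 0 keeps G
   invariant, as the zero set is stable under the dot action. *)
pose G mu := if T mu == 0 then 0 else (uh_eval mu f - c) / T mu.
have [f' f'E] := uh_interpolation charFp G.
exists f', c; split=> [w lambda lam0|].
  have dlam0 := dot_Lambda0 charFp rho_step w^-1 lam0.
  by rewrite !f'E // /G /T theta_value_dot inv.
apply: uh_ext => mu mu0; rewrite addrC uh_evalP // uh_eval1 // uh_evalM //.
rewrite (uh_eval_Theta charFp rho_step) // f'E // mulr1 /G -/(T mu).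
have [T0|T_neq0] := eqVneq (T mu) 0; last by rewrite mulrC divfK // addrC subrK.
rewrite mulr0 addr0; move/eqP: T0; rewrite /T /theta_value.
move=> /prodf_eq0[i _ /prodf_eq0[j ij]]; rewrite subr_eq0 => /eqP.
exact: link.
Qed.
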